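(* Let $\mu>1$, let $\lambda\in\mathbf V(\Lambda)$, and let $(z_0,z_1,\dots,z_N)$ be a shortest path in $\Lambda$ from $z_0=0$ to $z_N=\lambda$. Then $f\in\mathbf H^2_\mu(\mathbb C)$ is a solution of the basic interpolation problem $$f(z_0)=f(z_1)=\dots=f(z_N)=0$$ if, and only if, $f(z)$ is of the form $$f(z)=\frac{z}{\mu}\odot B_\mu^{a_1}(z)\odot\dots\odot B_\mu^{a_N}(z)\odot g(z),$$ where $$a_n=\frac{z_n-z_{n-1}-1}{2},\quad n=1,\dots,N,$$ and $g\in\mathbf H^2_\mu(\mathbb C)$. In this case $\|f\|_{\mathbf H^2_\mu(\mathbb C)}=\|g\|_{\mathbf H^2_\mu(\mathbb C)}$.
   Context: Rhombic lattice: $\Lambda$ is a monohedral (edge-to-edge) tessellation of $\mathbb C$ by mutually congruent (nondegenerate) rhombi of side length 1, viewed as a planar graph with vertex set $\mathbf V(\Lambda)$, (undirected) edge set $\mathbf E(\Lambda)$ and face set $\mathbf F(\Lambda)$ (the rhombi). $\hat{\mathbf E}(\Lambda)=\{b-a:(a,b)\in\mathbf E(\Lambda)\}$ is the set of edge directions; it is finite and closed under $e\mapsto -e$. A path from $a$ to $b$ is a finite sequence $(z_0=a,z_1,\dots,z_N=b)$ of vertices with consecutive ones adjacent; it is closed if $a=b$. Standing assumptions: $0\in\mathbf V(\Lambda)$; $1\in\hat{\mathbf E}(\Lambda)$; and both sides of every track $F$ in $\Lambda$ contain tracks that are coherent to $F$. Here a track is a sequence $(F_n)_{n\in\mathbb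 Z}$ of faces such that for every $n$ the faces $F_n,F_{n+1}$ are adjacent and the edges shared by $F_n$ with $F_{n+1}$ and with $F_{n-1}$ are two opposite sides of $F_n$; these shared edges are the ties of the track. The sides of a track are the two connected components of the graph obtained by deleting all ties of the track from $\mathbf E(\Lambda)$. Two tracks are coherent if their ties are parallel. DA functions: for $f:\mathbf V(\Lambda)\to\mathcal V$ ($\mathcal V$ a complex vector space) and a path $\gamma=(z_0,\dots,z_N)$, $\int_\gamma f\,\delta z=\sum_{n=1}^N\frac{f(z_{n-1})+f(z_n)}{2}(z_n-z_{n-1})$. $f$ is discrete analytic (DA) if $\int_\gamma f\,\delta z=0$ for every closed path $\gamma$; $\int_a^b f\,\delta z$ denotes the then path-independent integral along any path from $a$ to $b$. The forward shift $Z_+$ on DA functions is $(Z_+f)(z)=\frac{f(0)-f(z)}{2}+\int_0^z f\,\delta z$ (again a DA function). Basis and Hardy space: $z^{(0)}=1$ and $z^{(n)}=Z_+z^{(n-1)}$ for $n\ge1$; in particular $z^{(1)}=z$. For $\mu>1$, $\mathbf H^2_\mu(\mathbb C)$ is the reproducing kernel Hilbert space of complex-valued DA functions on $\Lambda$ with kernel $K_\mu(z,w)=\sum_{n\ge0}\mu^{-2n}z^{(n)}\overline{w^{(n)}}$; it consists of the functions $f(z)=\sum_{n\ge0}z^{(n)}\hat f(n)$ with $\|f\|^2=\sum_{n\ge0}\mu^{2n}|\hat f(n)|^2<\infty$. Blaschke factors: for $|a|\le1$, $\mu>1$, the $\mu$-dilated Blaschke factor is the DA function $$B_\mu^a(z)=D+C\left(1-z\tfrac{A}{\mu}\right)^{-\odot}\odot\left(z\tfrac{B}{\mu}\right),\qquad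 \begin{pmatrix}A&B\\C&D\end{pmatrix}=\begin{pmatrix}\bar a/\mu&\sqrt{1-|a|^2/\mu^2}\\ \sqrt{1-|a|^2/\mu^2}&-a/\mu\end{pmatrix}.$$ Here, for $c\in\mathbb C$ with $|c|<1$, $G(z)=(1-zc)^{-\odot}$ is the DA function with $G-cZ_+G=1$, given by $G(z)=\prod_{k=1}^M\frac{2+c(1+u_k-u_{k-1})}{2+c(1+u_{k-1}-u_k)}$ for any path $(u_0,\dots,u_M)$ from $0$ to $z$; and $G\odot(z\beta)=\beta Z_+G$ for a scalar $\beta$. Thus $B_\mu^a=D+\frac{CB}{\mu}Z_+\left(1-z\frac{\bar a}{\mu^2}\right)^{-\odot}$. Products: for $h(z)=\sum_n z^{(n)}\hat h(n)\in\mathbf H^2_\mu(\mathbb C)$, $B_\mu^a\odot h:=M_{B_\mu^a}h:=\sum_{n\ge0}\hat h(n)\,Z_+^nB_\mu^a$, which belongs to $\mathbf H^2_\mu(\mathbb C)$, and $\frac z\mu\odot h:=\frac1\mu Z_+h$. The iterated product in the claim is the successive application of these operators to $g$. *)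

(* Defs.v *)
From Stdlib Require Import Reals ZArith List ClassicalEpsilon.
From Coquelicot Require Import Coquelicot.
Import ListNotations.
Open Scope C_scope.

(** ** Rhombic lattices *)

(* The rhombus with vertices [org], [org + du], [org + du + dv], [org + dv]. *)
Record rhombus := Rhombus { org : C; du : C; dv : C }.

Definition region (Q : rhombus) (x : C) : Prop :=
  exists s t : R, (0 <= s <= 1)%R /\ (0 <= t <= 1)%R /\
    x = org Q + s * du Q + t * dv Q.

Definition inner_region (Q : rhombus) (x : C) : Prop :=
  exists s t : R, (0 < s < 1)%R /\ (0 < t < 1)%R /\
    x = org Q + s * du Q + t * dv Q.

Definition parallel (e e' : C) : Prop := Im (Cconj e * e') = 0%R.

Definition unit_rhombus (Q : rhombus) : Prop :=
  Cmod (du Q) = 1%R /\ Cmod (dv Q) = 1%R /\ ~ parallel (du Q) (dv Q).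

Definition corners (Q : rhombus) : list C :=
  [org Q; org Q + du Q; org Q + du Q + dv Q; org Q + dv Q].

Definition is_side (Q : rhombus) (a b : C) : Prop :=
  let p := org Q in let u := du Q in let v := dv Q in
  let l := [(p, p + u); (p + u, p + u + v); (p + u + v, p + v); (p + v, p)] in
  In (a, b) l \/ In (b, a) l.

Definition segment (a b x : C) : Prop :=
  exists t : R, (0 <= t <= 1)%R /\ x = a + t * (b - a).

Definition congruent (S T : C -> Prop) : Prop :=
  exists phi : C -> C,
    (forall x y, Cmod (phi x - phi y) = Cmod (x - y)) /\
    (forall y, T y <-> exists x, S x /\ phi x = y).

Definition edge_to_edge (Q Q' : rhombus) : Prop :=
  let common x := region Q x /\ region Q' x in
  (forall x, ~ common x) \/
  (exists a, In a (corners Q) /\ In a (corners Q') /\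
     forall x, common x <-> x = a) \/
  (exists a b, is_side Q a b /\ is_side Q' a b /\
     forall x, common x <-> segment a b x).

Record rhombic_lattice := {
  face : Type;
  tile : face -> rhombus;
  tile_unit : forall i, unit_rhombus (tile i);
  tile_congruent : forall i j, congruent (region (tile i)) (region (tile j));
  tile_cover : forall x, exists i, region (tile i) x;
  tile_disjoint : forall i j, i <> j ->
    forall x, ~ (inner_region (tile i) x /\ inner_region (tile j) x);
  tile_edge_to_edge : forall i j, i <> j -> edge_to_edge (tile i) (tile j)
}.

Definition vertex (L : rhombic_lattice) (z : C) : Prop :=
  exists i : face L, In z (corners (tile L i)).

Definition edge (L : rhombic_lattice) (a b : C) : Prop :=
  exists i : face L, is_side (tile L i) a b.

Definition edge_direction (L : rhombic_lattice) (e : C) : Prop :=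
  exists a b, edge L a b /\ e = b - a.

(* The path [(z 0, ..., z N)]; the values of [z] beyond [N] are irrelevant. *)
Definition is_path (L : rhombic_lattice) (N : nat) (z : nat -> C) (a b : C)
  : Prop :=
  vertex L a /\ z 0%nat = a /\ z N = b /\
  forall n, (n < N)%nat -> edge L (z n) (z (S n)).

Definition shortest_path (L : rhombic_lattice) (N : nat) (z : nat -> C)
  (a b : C) : Prop :=
  is_path L N z a b /\
  forall (M : nat) (w : nat -> C), is_path L M w a b -> (N <= M)%nat.

(** ** Tracks *)

Definition shared_side (L : rhombic_lattice) (i j : face L) (a b : C) : Prop :=
  i <> j /\ is_side (tile L i) a b /\ is_side (tile L j) a b.

(* Two sides of a rhombus are opposite when they have no common endpoint. *)
Definition opposite_sides (Q : rhombus) (a b c d : C) : Prop :=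
  is_side Q a b /\ is_side Q c d /\ a <> c /\ a <> d /\ b <> c /\ b <> d.

Definition is_track (L : rhombic_lattice) (F : Z -> face L) : Prop :=
  forall n : Z, exists a b c d,
    shared_side L (F n) (F (n + 1)%Z) a b /\
    shared_side L (F n) (F (n - 1)%Z) c d /\
    opposite_sides (tile L (F n)) a b c d.

Definition tie (L : rhombic_lattice) (F : Z -> face L) (a b : C) : Prop :=
  exists n : Z, shared_side L (F n) (F (n + 1)%Z) a b.

Definition coherent (L : rhombic_lattice) (F F' : Z -> face L) : Prop :=
  forall a b c d, tie L F a b -> tie L F' c d -> parallel (b - a) (d - c).

(* [x] and [y] lie on the same side of the track [F], that is, in the same
   connected component of the graph without the ties of [F]. *)
Definition same_side (L : rhombic_lattice) (F : Z -> face L) (x y : C)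
  : Prop :=
  exists (N : nat) (z : nat -> C), is_path L N z x y /\
    forall n, (n < N)%nat -> ~ tie L F (z n) (z (S n)).

Record standing_assumptions (L : rhombic_lattice) : Prop := {
  vertex_0 : vertex L 0;
  direction_1 : edge_direction L 1;
  (* The sides of [F] are the classes of [same_side L F]; each is given by a
     representative [x]. *)
  coherent_tracks : forall F : Z -> face L, is_track L F ->
    forall x, vertex L x ->
    exists F' : Z -> face L, is_track L F' /\ coherent L F F' /\
      forall n y, In y (corners (tile L (F' n))) -> same_side L F x y
}.

(** ** Discrete analytic functions

    Functions on the vertices are total functions [C -> C], of which only the
    values at the vertices matter. *)

Definition path_integral (f : C -> C) (N : nat) (z : nat -> C) : C :=
  sum_n_m (fun n => (f (z (n - 1)%nat) + f (z n)) / 2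
                    * (z n - z (n - 1)%nat)) 1 N.

Definition discrete_analytic (L : rhombic_lattice) (f : C -> C) : Prop :=
  forall (N : nat) (z : nat -> C) (a : C),
    is_path L N z a a -> path_integral f N z = 0.

(* Some path from [a] to [b]: its number of steps and its points. *)
Definition some_path (L : rhombic_lattice) (a b : C) : nat * (nat -> C) :=
  epsilon (inhabits (0%nat, fun _ : nat => RtoC 0))
    (fun p : nat * (nat -> C) => is_path L (fst p) (snd p) a b).

(* For discrete analytic [f] the choice of the path is immaterial. *)
Definition integral (L : rhombic_lattice) (f : C -> C) (a b : C) : C :=
  let p := some_path L a b in path_integral f (fst p) (snd p).

Definition Zplus (L : rhombic_lattice) (f : C -> C) (z : C) : C :=
  (f 0 - f z) / 2 + integral L f 0 z.

Definition zpow (L : rhombic_lattice) (n : nat) : C -> C :=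
  Nat.iter n (Zplus L) (fun _ => 1).

(** ** Hardy spaces *)

Definition is_coef (L : rhombic_lattice) (mu : R) (f : C -> C) (c : nat -> C)
  : Prop :=
  ex_series (fun n => mu ^ (2 * n) * Cmod (c n) ^ 2)%R /\
  forall z, vertex L z ->
    is_series (V := C_NormedModule) (fun n => zpow L n z * c n) (f z).

(* The reproducing kernel Hilbert space with kernel
   [sum_n mu ^ (- 2 n) z^(n) (w^(n))^*]. *)
Definition H2 (L : rhombic_lattice) (mu : R) (f : C -> C) : Prop :=
  discrete_analytic L f /\ exists c, is_coef L mu f c.

(* For [f] in [H2 L mu] the coefficients are unique: a power series that
   converges on the disc of radius [mu > 1] and whose function on the lattice
   vanishes has infinitely many zeros (with multiplicity) in the closed unit
   disc. *)
Definition coef (L : rhombic_lattice) (mu : R) (f : C -> C) : nat -> C :=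
  epsilon (inhabits (fun _ : nat => RtoC 0)) (is_coef L mu f).

Definition H2norm (L : rhombic_lattice) (mu : R) (f : C -> C) : R :=
  sqrt (Series (fun n => mu ^ (2 * n) * Cmod (coef L mu f n) ^ 2)%R).

(** ** Blaschke factors and products *)

(* The function [(1 - z c)^(-odot)], for [Cmod c < 1], as a product along
   some path from [0] to [z]; the choice of the path is immaterial. *)
Definition geom (L : rhombic_lattice) (c z : C) : C :=
  let p := some_path L 0 z in
  let u := snd p in
  fold_right Cmult 1
    (map (fun k => (2 + c * (1 + u k - u (k - 1)%nat))
                   / (2 + c * (1 + u (k - 1)%nat - u k)))
         (seq 1 (fst p))).

Definition blaschke (L : rhombic_lattice) (mu : R) (a z : C) : C :=
  let s := sqrt (1 - Cmod a ^ 2 / mu ^ 2)%R in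
  let A := Cconj a / mu in
  let B := RtoC s in
  let C' := RtoC s in
  let D := - a / mu in
  D + C' * (B / mu * Zplus L (geom L (A / mu)) z).

Definition Cseries (u : nat -> C) : C :=
  (Series (fun n => Re (u n)), Series (fun n => Im (u n))).

(* [B_mu^a odot h] *)
Definition blaschke_mul (L : rhombic_lattice) (mu : R) (a : C) (h : C -> C)
  (z : C) : C :=
  Cseries (fun n => coef L mu h n * Nat.iter n (Zplus L) (blaschke L mu a) z).

(* [(z / mu) odot h] *)
Definition shift_mul (L : rhombic_lattice) (mu : R) (h : C -> C) (z : C) : C :=
  Zplus L h z / mu.

(* Main.v *)
(* Let [f] have the coefficients [c], and let [h(t) = sum c_n t^n], a power series on
   the disc of radius [mu].  For an edge [e = v - u] put [a = (e - 1) / 2].  The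
   generating function [G_v(t) = sum v^(n) t^n] satisfies
   [(1 - a t) G_v = (1 + (1 + a) t) G_u], so the function with series [(t - a) h] takes
   at [v] the value which the function with series [(t + 1 + a) h] takes at [u].
   Hence divisibility of the series by [t (t - a_1) ... (t - a_N)] makes [f] vanish
   along the path.  Conversely, a function with series [t (t - a_1) ... (t - a_(m-1)) h]
   takes at [z_m] the value [e_m h(a_m) prod_(k<m) (e_m + e_k) / 2], so that [f(z_m) = 0]
   allows to split off [t - a_m], provided that the path contains no two opposite
   directions.  The Blaschke factor of [a] is [t - a] up to a factor invertible on the
   disc, and multiplication by it is isometric.

   A shortest path contains no two opposite directions [e], [- e].  The tiles met by the
   track through an edge [e] form a strip that cuts each line parallel to [e] in a unit
   interval, so it separates the plane, and a closed path crosses it equally often in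
   both directions.  If a path contains [e] and later [- e], at minimal distance, then
   both edges are ties of the same strip, and walking along the other side of the strip
   is a shortcut. *)
From Stdlib Require Import Reals List ZArith Lra Lia Psatz.
From Stdlib Require Import Classical ClassicalEpsilon FunctionalExtensionality.
From Coquelicot Require Import Coquelicot.
Require Import Defs.
Import ListNotations.
Open Scope C_scope.

(** * Unit rhombi *)

(** A function of the Hardy space is handled through a coefficient sequence [c]: its value at [v] is
    [pairing (zeta v) c], and [delay], [mul_root] and [blaschke_coef] act on [c] alone. The roots
    [half e] lie in the closed unit disc, so [zeta v] is bounded by a multiple of [r ^ n] for every
    [r > 1], while [c] is summable against [r ^ n] for [r < mu]; hence the auxiliary radius [r]
    between 1 and [mu]. Two choices made by [epsilon] shape the proof. Paths: the values [z^(n)] do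
    not depend on the path because the operators [step e] commute, [step (- e)] inverts [step e],
    and the steps of a closed walk cancel in pairs. Coefficients: [coef] enters the products and the
    norm, so its uniqueness has to be settled first. It comes from the interpolation argument
    itself: a function vanishing at all vertices vanishes along arbitrarily long shortest paths, so
    its series is divisible by arbitrarily many Blaschke factors. Each of them costs the leading
    coefficient a factor [mu], while the energy stays the same. *)

Definition dot (e x : C) : R := (Re e * Re x + Im e * Im x)%R.
Definition cross (e x : C) : R := (Re e * Im x - Im e * Re x)%R.

Ltac cx := repeat match goal with x : C |- _ => destruct x as [? ?] end;
  unfold dot, cross, Cplus, Cminus, Copp, Cmult, RtoC, Cconj, Re, Im in *; simpl in *.

Lemma cross_plus e x y : cross e (x + y) = (cross e x + cross e y)%R.
Proof. cx; ring. Qed.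
Lemma cross_minus e x y : cross e (x - y) = (cross e x - cross e y)%R.
Proof. cx; ring. Qed.
Lemma cross_opp e x : cross e (- x) = (- cross e x)%R.
Proof. cx; ring. Qed.
Lemma cross_opp_l e x : cross (- e) x = (- cross e x)%R.
Proof. cx; ring. Qed.
Lemma cross_scal e t x : cross e (RtoC t * x) = (t * cross e x)%R.
Proof. cx; ring. Qed.
Lemma cross_self e : cross e e = 0%R.
Proof. cx; ring. Qed.
Lemma cross_antisym e f : cross f e = (- cross e f)%R.
Proof. cx; ring. Qed.
Lemma dot_plus e x y : dot e (x + y) = (dot e x + dot e y)%R.
Proof. cx; ring. Qed.
Lemma dot_minus e x y : dot e (x - y) = (dot e x - dot e y)%R.
Proof. cx; ring. Qed.
Lemma dot_scal e t x : dot e (RtoC t * x) = (t * dot e x)%R.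
Proof. cx; ring. Qed.
Lemma Cmod_sqr x : (Cmod x * Cmod x = Re x * Re x + Im x * Im x)%R.
Proof. generalize (Cmod2_alt x); simpl; intro H; lra. Qed.
Lemma dot_self e : dot e e = (Cmod e * Cmod e)%R.
Proof. rewrite Cmod_sqr; reflexivity. Qed.
Lemma dot_cross_sqr e f :
  (dot e f * dot e f + cross e f * cross e f = (Cmod e * Cmod e) * (Cmod f * Cmod f))%R.
Proof. rewrite !Cmod_sqr; unfold dot, cross; ring. Qed.
Lemma cross_bound e f : (Rabs (cross e f) <= Cmod e * Cmod f)%R.
Proof.
  generalize (dot_cross_sqr e f), (Cmod_ge_0 e), (Cmod_ge_0 f); intros.
  apply Rsqr_incr_0_var; [|nra]. rewrite <- Rsqr_abs. unfold Rsqr. nra.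
Qed.
Lemma dot_bound e f : (Rabs (dot e f) <= Cmod e * Cmod f)%R.
Proof.
  generalize (dot_cross_sqr e f), (Cmod_ge_0 e), (Cmod_ge_0 f); intros.
  apply Rsqr_incr_0_var; [|nra]. rewrite <- Rsqr_abs. unfold Rsqr. nra.
Qed.
Lemma dot_cross_inj e x y : Cmod e = 1%R -> dot e x = dot e y ->
  cross e x = cross e y -> x = y.
Proof.
  intros He Hd Hc.
  assert (H : (Re e * Re e + Im e * Im e = 1)%R) by (rewrite <- Cmod_sqr, He; ring).
  unfold dot, cross in *. destruct x as [x1 x2], y as [y1 y2], e as [e1 e2]; simpl in *.
  apply injective_projections; simpl.
  - transitivity ((e1 * e1 + e2 * e2) * x1)%R; [rewrite H; ring|].
    transitivity (e1 * (e1 * x1 + e2 * x2) - e2 * (e1 * x2 - e2 * x1))%R; [ring|].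
    rewrite Hd, Hc. transitivity ((e1 * e1 + e2 * e2) * y1)%R; [ring|rewrite H; ring].
  - transitivity ((e1 * e1 + e2 * e2) * x2)%R; [rewrite H; ring|].
    transitivity (e2 * (e1 * x1 + e2 * x2) + e1 * (e1 * x2 - e2 * x1))%R; [ring|].
    rewrite Hd, Hc. transitivity ((e1 * e1 + e2 * e2) * y2)%R; [ring|rewrite H; ring].
Qed.

(** Cramer's rule for [x = u + s e + t f]; the determinant is [cross e f]. *)
Definition coord1 (u e f x : C) : R := (cross (x - u) f / cross e f)%R.
Definition coord2 (u e f x : C) : R := (cross e (x - u) / cross e f)%R.

Lemma coords_eq u e f x : cross e f <> 0%R ->
  x = u + coord1 u e f x * e + coord2 u e f x * f.
Proof.
  intros H. unfold coord1, coord2. cx.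
  apply injective_projections; simpl; field; auto.
Qed.
Lemma coord1_val u e f (s t : R) : cross e f <> 0%R ->
  coord1 u e f (u + s * e + t * f) = s.
Proof. intros H. unfold coord1. cx. field; auto. Qed.
Lemma coord2_val u e f (s t : R) : cross e f <> 0%R ->
  coord2 u e f (u + s * e + t * f) = t.
Proof. intros H. unfold coord2. cx. field; auto. Qed.
Lemma coords_uniq u e f (s t s' t' : R) : cross e f <> 0%R ->
  u + s * e + t * f = u + s' * e + t' * f -> s = s' /\ t = t'.
Proof.
  intros H E. split.
  - rewrite <- (coord1_val u e f s t H), E. apply coord1_val; auto.
  - rewrite <- (coord2_val u e f s t H), E. apply coord2_val; auto.
Qed.

(** The record [rhombus] singles out a corner and an order of the sides. The tiling axioms see only
    these four sets, so a tile may be described from whichever side is convenient. *)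
Definition same_rhombus (Q Q' : rhombus) : Prop :=
  (forall x, region Q x <-> region Q' x) /\
  (forall x, inner_region Q x <-> inner_region Q' x) /\
  (forall x, In x (corners Q) <-> In x (corners Q')) /\
  (forall a b, is_side Q a b <-> is_side Q' a b).

(* Up to the choice of a corner and the order of the sides, [Q] is [Rhombus u e f]. *)
Definition frame (Q : rhombus) (u e f : C) : Prop :=
  Cmod e = 1%R /\ Cmod f = 1%R /\ cross e f <> 0%R /\
  same_rhombus Q (Rhombus u e f).

Lemma same_rhombus_trans Q1 Q2 Q3 :
  same_rhombus Q1 Q2 -> same_rhombus Q2 Q3 -> same_rhombus Q1 Q3.
Proof.
  intros (A & B & D & E) (A' & B' & D' & E').
  split; [|split; [|split]]; intros; etransitivity; eauto.
Qed.

Lemma same_swap u e f : same_rhombus (Rhombus u e f) (Rhombus u f e).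
Proof.
  assert (E : u + f + e = u + e + f) by ring.
  split; [|split; [|split]].
  - intros x; split; intros (s & t & H1 & H2 & ->); exists t, s; simpl;
      repeat split; try lra; ring.
  - intros x; split; intros (s & t & H1 & H2 & ->); exists t, s; simpl;
      repeat split; try lra; ring.
  - intros x; unfold corners; simpl; rewrite E; tauto.
  - intros a b; unfold is_side; simpl; rewrite E; rewrite !pair_equal_spec; tauto.
Qed.

Lemma same_flip u e f : same_rhombus (Rhombus u e f) (Rhombus (u + e) (- e) f).
Proof.
  assert (E : u + e + - e = u) by ring.
  split; [|split; [|split]].
  - intros x; split; intros (s & t & H1 & H2 & ->); exists (1 - s)%R, t; simpl;
      repeat split; try lra; rewrite RtoC_minus; ring.
  - intros x; split; intros (s & t & H1 & H2 & ->); exists (1 - s)%R, t; simpl;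
      repeat split; try lra; rewrite RtoC_minus; ring.
  - intros x; unfold corners; simpl; rewrite E; tauto.
  - intros a b; unfold is_side; simpl; rewrite E; rewrite !pair_equal_spec; tauto.
Qed.

Lemma frame_swap Q u e f : frame Q u e f -> frame Q u f e.
Proof.
  intros (A & B & D & E); split; [|split; [|split]]; auto.
  - rewrite cross_antisym; lra.
  - eapply same_rhombus_trans; [apply E|apply same_swap].
Qed.
Lemma frame_flip Q u e f : frame Q u e f -> frame Q (u + e) (- e) f.
Proof.
  intros (A & B & D & E); split; [|split; [|split]]; auto.
  - rewrite Cmod_opp; auto.
  - rewrite cross_opp_l; lra.
  - eapply same_rhombus_trans; [apply E|apply same_flip].
Qed.
Lemma frame_flip2 Q u e f : frame Q u e f -> frame Q (u + f) e (- f).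
Proof. intros H; apply frame_swap, frame_flip, frame_swap, H. Qed.

Lemma frame_unit_rhombus Q : unit_rhombus Q -> frame Q (org Q) (du Q) (dv Q).
Proof.
  intros (A & B & D). split; [|split; [|split]]; auto.
  - intros H; apply D. unfold parallel. rewrite <- H. cx; ring.
  - destruct Q; split; [|split; [|split]]; simpl; tauto.
Qed.

(** Swaps and flips turn the given frame into eight, one for each oriented side. *)
Lemma frame_side Q a b : unit_rhombus Q -> is_side Q a b ->
  exists f, frame Q a (b - a) f.
Proof.
  intros HQ H. apply frame_unit_rhombus in HQ.
  destruct Q as [p u v]; simpl in *.
  unfold is_side in H; simpl in H; rewrite !pair_equal_spec in H.
  assert (H1 := frame_flip _ _ _ _ HQ).
  assert (H2 := frame_flip2 _ _ _ _ HQ).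
  assert (H3 := frame_flip2 _ _ _ _ H1).
  assert (S0 := frame_swap _ _ _ _ HQ).
  assert (S1 := frame_swap _ _ _ _ H1).
  assert (S2 := frame_swap _ _ _ _ H2).
  assert (S3 := frame_swap _ _ _ _ H3).
  decompose [or and] H; clear H; try tauto; subst;
    match goal with |- exists f, frame _ ?x ?y _ =>
      first [ replace y with u by ring | replace y with (- u) by ring
            | replace y with v by ring | replace y with (- v) by ring ] end;
    eauto.
Qed.

Lemma frame_corners Q u e f : frame Q u e f -> forall x, In x (corners Q) <->
  (x = u \/ x = u + e \/ x = u + e + f \/ x = u + f).
Proof.
  intros (_ & _ & _ & _ & _ & H & _) x. rewrite H. unfold corners; simpl.
  split; intros D; decompose [or] D; subst; try tauto.
Qed.
Lemma frame_region Q u e f : frame Q u e f -> forall x, region Q x <->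
  (0 <= coord1 u e f x <= 1 /\ 0 <= coord2 u e f x <= 1)%R.
Proof.
  intros (_ & _ & D & H & _ & _ & _) x. rewrite H. unfold region; simpl. split.
  - intros (s & t & A & B & ->). rewrite coord1_val, coord2_val; auto.
  - intros (A & B). exists (coord1 u e f x), (coord2 u e f x). repeat split; try lra.
    apply coords_eq; auto.
Qed.
Lemma frame_inner Q u e f : frame Q u e f -> forall x, inner_region Q x <->
  (0 < coord1 u e f x < 1 /\ 0 < coord2 u e f x < 1)%R.
Proof.
  intros (_ & _ & D & _ & H & _ & _) x. rewrite H. unfold inner_region; simpl. split.
  - intros (s & t & A & B & ->). rewrite coord1_val, coord2_val; auto.
  - intros (A & B). exists (coord1 u e f x), (coord2 u e f x). repeat split; try lra.
    apply coords_eq; auto.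
Qed.
Lemma frame_sides Q u e f : frame Q u e f -> forall a b, is_side Q a b <->
  exists t : R, (t = 0%R \/ t = 1%R) /\
   ((a = u + t * f /\ b = u + t * f + e) \/ (b = u + t * f /\ a = u + t * f + e) \/
    (a = u + t * e /\ b = u + t * e + f) \/ (b = u + t * e /\ a = u + t * e + f)).
Proof.
  intros (_ & _ & _ & _ & _ & _ & H) a b. rewrite H. unfold is_side; simpl.
  rewrite !pair_equal_spec.
  assert (E0 : forall x, u + RtoC 0 * x = u) by (intros; ring).
  assert (E1 : forall x, u + RtoC 1 * x = u + x) by (intros; ring).
  assert (E2 : u + f + e = u + e + f) by ring.
  split.
  - intros D.
    decompose [or and] D; subst; try tauto;
    ((exists 0%R; rewrite !E0; tauto) || (exists 1%R; rewrite !E1, ?E2; tauto)).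
  - intros (t & [-> | ->] & D); rewrite ?E0, ?E1, ?E2 in D; decompose [or and] D; subst; tauto.
Qed.

Lemma Cmod_frame_sum e f (x y : R) : Cmod e = 1%R -> Cmod f = 1%R ->
  (Cmod (x * e + y * f) * Cmod (x * e + y * f)
   = x * x + y * y + 2 * x * y * dot e f)%R.
Proof.
  intros He Hf.
  assert (H1 : (Re e * Re e + Im e * Im e = 1)%R) by (rewrite <- Cmod_sqr, He; ring).
  assert (H2 : (Re f * Re f + Im f * Im f = 1)%R) by (rewrite <- Cmod_sqr, Hf; ring).
  rewrite Cmod_sqr. clear He Hf. cx.
  transitivity (x * x * (r1 * r1 + r2 * r2) + y * y * (r * r + r0 * r0)
    + 2 * x * y * (r1 * r + r2 * r0))%R; [ring|].
  rewrite H1, H2; ring.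
Qed.

(* The diameter of a unit rhombus is its longer diagonal. *)
Lemma congruent_dot Q Q' u e f u' e' f' :
  frame Q u e f -> frame Q' u' e' f' -> congruent (region Q) (region Q') ->
  (Rabs (dot e' f') <= Rabs (dot e f))%R.
Proof.
  intros F F' (phi & Hiso & Hsurj).
  assert (K : exists p q, region Q' p /\ region Q' q /\
            (Cmod (p - q) * Cmod (p - q) = 2 + 2 * Rabs (dot e' f'))%R).
  { assert (HF' := frame_region _ _ _ _ F').
    destruct F' as (He' & Hf' & Hc & _).
    assert (HR : forall s t : R, (0 <= s <= 1)%R -> (0 <= t <= 1)%R ->
      region Q' (u' + s * e' + t * f')).
    { intros s t Hs Ht. apply HF'. rewrite coord1_val, coord2_val; auto. }
    destruct (Rle_lt_dec 0 (dot e' f')) as [D|D].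
    - exists (u' + 1%R * e' + 1%R * f'), (u' + 0%R * e' + 0%R * f').
      split; [apply HR; lra|split; [apply HR; lra|]].
      replace (u' + 1%R * e' + 1%R * f' - (u' + 0%R * e' + 0%R * f'))
        with (RtoC 1 * e' + RtoC 1 * f') by ring.
      rewrite Cmod_frame_sum, Rabs_pos_eq; auto; lra.
    - exists (u' + 1%R * e' + 0%R * f'), (u' + 0%R * e' + 1%R * f').
      split; [apply HR; lra|split; [apply HR; lra|]].
      replace (u' + 1%R * e' + 0%R * f' - (u' + 0%R * e' + 1%R * f'))
        with (RtoC 1 * e' + RtoC (Ropp 1) * f') by (rewrite RtoC_opp; ring).
      rewrite Cmod_frame_sum, Rabs_left; auto; lra. }
  destruct K as (p' & q' & Hp & Hq & E).
  apply Hsurj in Hp; apply Hsurj in Hq.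
  destruct Hp as (p & Hp & <-), Hq as (q & Hq & <-).
  rewrite Hiso in E.
  destruct F as (He & Hf & Hc & HR & _).
  apply HR in Hp; apply HR in Hq.
  destruct Hp as (s & t & Hs & Ht & ->), Hq as (s' & t' & Hs' & Ht' & ->); simpl in *.
  replace (u + s * e + t * f - (u + s' * e + t' * f))
    with ((s - s')%R * e + (t - t')%R * f) in E by (rewrite !RtoC_minus; ring).
  rewrite Cmod_frame_sum in E; auto.
  assert (A : (Rabs (s - s') <= 1)%R) by (apply Rabs_le; lra).
  assert (B : (Rabs (t - t') <= 1)%R) by (apply Rabs_le; lra).
  assert (M : ((s - s') * (t - t') * dot e f <= 1 * 1 * Rabs (dot e f))%R).
  { eapply Rle_trans; [apply Rle_abs|]. rewrite !Rabs_mult.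
    apply Rmult_le_compat_r; [apply Rabs_pos|].
    apply Rmult_le_compat; auto using Rabs_pos. }
  assert (A2 : ((s - s') * (s - s') <= 1)%R) by nra.
  assert (B2 : ((t - t') * (t - t') <= 1)%R) by nra.
  lra.
Qed.

(** * Local finiteness of the tiling *)

Section Lattice.

Variable L : rhombic_lattice.

(* The sine of the angles of the tiles; the choice of the tile is immaterial because the
   tiles are congruent. *)
Definition sine : R :=
  match excluded_middle_informative (exists i : face L, True) with
  | left H => let i := proj1_sig (constructive_indefinite_description _ H) in
      Rabs (cross (du (tile L i)) (dv (tile L i)))
  | right _ => 1%R
  end.

Lemma frame_tile i : frame (tile L i) (org (tile L i)) (du (tile L i)) (dv (tile L i)).
Proof. apply frame_unit_rhombus, tile_unit. Qed.

(** Used in both directions, congruence fixes [Rabs (dot e f)], and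
    [dot e f ^ 2 + cross e f ^ 2 = 1] for unit sides. *)
Lemma frame_sine i u e f : frame (tile L i) u e f -> Rabs (cross e f) = sine.
Proof.
  intros F.
  assert (K : forall j u' e' f', frame (tile L j) u' e' f' ->
            Rabs (cross e' f') = Rabs (cross e f)).
  { intros j u' e' f' F'.
    assert (D : Rabs (dot e' f') = Rabs (dot e f)).
    { apply Rle_antisym; eapply congruent_dot; eauto; apply tile_congruent. }
    destruct F as (He & Hf & _), F' as (He' & Hf' & _).
    generalize (dot_cross_sqr e f), (dot_cross_sqr e' f').
    rewrite He, Hf, He', Hf'. intros.
    assert (D2 : Rsqr (dot e' f') = Rsqr (dot e f)).
    { rewrite (Rsqr_abs (dot e' f')), (Rsqr_abs (dot e f)), D; reflexivity. }
    apply Rsqr_eq_abs_0. unfold Rsqr in *. lra. }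
  unfold sine. destruct excluded_middle_informative as [H|H].
  - symmetry. eapply K. apply frame_tile.
  - exfalso; eauto.
Qed.

Lemma sine_pos : (0 < sine)%R.
Proof.
  destruct (tile_cover L 0) as [i _].
  rewrite <- (frame_sine i _ _ _ (frame_tile i)).
  apply Rabs_pos_lt. apply (frame_tile i).
Qed.

(** The same constant [/ sine] serves all tiles; this makes the metric estimates below uniform over
    the lattice. *)
Lemma coord1_lip i u e f x y : frame (tile L i) u e f ->
  (Rabs (coord1 u e f y - coord1 u e f x) <= Cmod (y - x) / sine)%R.
Proof.
  intros F. unfold coord1.
  replace (cross (y - u) f / cross e f - cross (x - u) f / cross e f)%R
    with (- cross f (y - x) / cross e f)%R.
  - unfold Rdiv. rewrite Rabs_mult, Rabs_inv, (frame_sine _ _ _ _ F), Rabs_Ropp.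
    apply Rmult_le_compat_r; [left; apply Rinv_0_lt_compat, sine_pos|].
    eapply Rle_trans; [apply cross_bound|]. destruct F as (_ & -> & _); lra.
  - destruct F as (_ & _ & F & _).
    rewrite !(cross_antisym f), !cross_minus. field; rewrite cross_antisym; lra.
Qed.
Lemma coord2_lip i u e f x y : frame (tile L i) u e f ->
  (Rabs (coord2 u e f y - coord2 u e f x) <= Cmod (y - x) / sine)%R.
Proof.
  intros F. unfold coord2.
  replace (cross e (y - u) / cross e f - cross e (x - u) / cross e f)%R
    with (cross e (y - x) / cross e f)%R.
  - unfold Rdiv. rewrite Rabs_mult, Rabs_inv, (frame_sine _ _ _ _ F).
    apply Rmult_le_compat_r; [left; apply Rinv_0_lt_compat, sine_pos|].
    eapply Rle_trans; [apply cross_bound|]. destruct F as (-> & _); lra.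
  - destruct F as (_ & _ & F & _).
    rewrite !cross_minus. field; auto.
Qed.

Lemma region_closed i x : ~ region (tile L i) x ->
  exists eps : R, (0 < eps)%R /\
    forall y, (Cmod (y - x) < eps)%R -> ~ region (tile L i) y.
Proof.
  intros H. assert (F := frame_tile i). rewrite (frame_region _ _ _ _ F) in H.
  set (c1 := coord1 _ _ _ x) in H. set (c2 := coord2 _ _ _ x) in H.
  assert (K : exists m : R, (0 < m)%R /\ forall r1 r2 : R,
    (Rabs (r1 - c1) < m -> Rabs (r2 - c2) < m ->
     ~ (0 <= r1 <= 1 /\ 0 <= r2 <= 1))%R).
  { destruct (Rlt_le_dec c1 0); [|destruct (Rlt_le_dec 1 c1);
      [|destruct (Rlt_le_dec c2 0); [|destruct (Rlt_le_dec 1 c2)]]].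
    - exists (- c1)%R; split; [lra|]; intros ? ? A B; apply Rabs_def2 in A; lra.
    - exists (c1 - 1)%R; split; [lra|]; intros ? ? A B; apply Rabs_def2 in A; lra.
    - exists (- c2)%R; split; [lra|]; intros ? ? A B; apply Rabs_def2 in B; lra.
    - exists (c2 - 1)%R; split; [lra|]; intros ? ? A B; apply Rabs_def2 in B; lra.
    - exfalso; lra. }
  destruct K as (m & Hm & K).
  exists (m * sine)%R. split; [apply Rmult_lt_0_compat; auto using sine_pos|].
  intros y Hy Hr. rewrite (frame_region _ _ _ _ F) in Hr. revert Hr.
  assert (E : (Cmod (y - x) / sine < m)%R).
  { apply Rmult_lt_reg_r with sine; [apply sine_pos|].
    unfold Rdiv; rewrite Rmult_assoc, Rinv_l; [lra|]. generalize sine_pos; lra. }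
  apply K; (eapply Rle_lt_trans; [|exact E]).
  - apply (coord1_lip i); auto.
  - apply (coord2_lip i); auto.
Qed.

Definition centre (Q : rhombus) : C := org Q + (1/2)%R * du Q + (1/2)%R * dv Q.

(** Opposite sides of a tile are at distance [sine], so its inscribed circle has radius
    [sine / 2]. *)
Lemma near_centre_inner i y : (Cmod (y - centre (tile L i)) < sine / 2)%R ->
  inner_region (tile L i) y.
Proof.
  intros H. assert (F := frame_tile i). apply (frame_inner _ _ _ _ F).
  assert (Hs := sine_pos).
  assert (A := coord1_lip i _ _ _ (centre (tile L i)) y F).
  assert (B := coord2_lip i _ _ _ (centre (tile L i)) y F).
  assert (E : (Cmod (y - centre (tile L i)) / sine < 1 / 2)%R).
  { apply Rmult_lt_reg_r with sine; auto.
    unfold Rdiv at 1; rewrite Rmult_assoc, Rinv_l; lra. }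
  unfold centre in A at 1. unfold centre in B at 1.
  rewrite coord1_val in A by apply F. rewrite coord2_val in B by apply F.
  apply Rle_lt_trans with (2 := E) in A. apply Rle_lt_trans with (2 := E) in B.
  apply Rabs_def2 in A. apply Rabs_def2 in B. lra.
Qed.

(** For distinct tiles the midpoint of the two centres would lie inside both inscribed circles,
    hence in both interiors. *)
Lemma centres_separated i j :
  (Cmod (centre (tile L i) - centre (tile L j)) < sine)%R -> i = j.
Proof.
  intros H. apply NNPP; intros D.
  apply (tile_disjoint L i j D
    ((1/2)%R * centre (tile L i) + (1/2)%R * centre (tile L j))).
  set (p := centre (tile L i)) in *. set (q := centre (tile L j)) in *.
  assert (E : forall r t : C, (Cmod (r - t) < sine)%R ->
     (Cmod ((1/2)%R * (r - t)) < sine / 2)%R).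
  { intros r t Hr. rewrite Cmod_mult, Cmod_R, Rabs_pos_eq; lra. }
  assert (E2 : RtoC (1/2) + RtoC (1/2) = 1) by (rewrite <- RtoC_plus; f_equal; lra).
  split; apply near_centre_inner; fold p q.
  - replace ((1/2)%R * p + (1/2)%R * q - p) with ((1/2)%R * (q - p)).
    + apply E. replace (q - p) with (- (p - q)) by ring. rewrite Cmod_opp; auto.
    + replace p with ((RtoC (1/2) + RtoC (1/2)) * p) at 3 by (rewrite E2; ring). ring.
  - replace ((1/2)%R * p + (1/2)%R * q - q) with ((1/2)%R * (p - q)); [auto|].
    replace q with ((RtoC (1/2) + RtoC (1/2)) * q) at 3 by (rewrite E2; ring). ring.
Qed.

Lemma region_centre i y : region (tile L i) y ->
  (Cmod (y - centre (tile L i)) <= 1)%R.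
Proof.
  intros H. destruct (tile_unit L i) as (Hu & Hv & _).
  destruct H as (s & t & Hs & Ht & ->). unfold centre.
  replace (org (tile L i) + s * du (tile L i) + t * dv (tile L i) -
    (org (tile L i) + (1/2)%R * du (tile L i) + (1/2)%R * dv (tile L i)))
   with ((s - 1/2)%R * du (tile L i) + (t - 1/2)%R * dv (tile L i))
   by (rewrite !RtoC_minus; ring).
  eapply Rle_trans; [apply Cmod_triangle|].
  rewrite !Cmod_mult, Hu, Hv, !Cmod_R.
  assert (Rabs (s - 1/2) <= 1/2)%R by (apply Rabs_le; lra).
  assert (Rabs (t - 1/2) <= 1/2)%R by (apply Rabs_le; lra). lra.
Qed.

Lemma NoDup_map_inj_on {A B} (g : A -> B) (l : list A) :
  (forall x y, In x l -> In y l -> g x = g y -> x = y) -> NoDup l -> NoDup (map g l).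
Proof.
  intros H D. induction D as [|x l Hx D IH]; simpl; constructor.
  - intros K. apply in_map_iff in K. destruct K as (y & E & Hy).
    apply Hx. rewrite (H x y); simpl; auto.
  - apply IH. intros; apply H; simpl; auto.
Qed.

Lemma floor_bounds (r M : R) : (Rabs r <= M)%R ->
  (- (up M) - 1 <= Int_part r <= up M)%Z.
Proof.
  intros H. apply Rabs_le_between in H.
  destruct (base_Int_part r) as [A B]. destruct (archimed M) as [D _].
  split; apply le_IZR; rewrite ?minus_IZR, ?opp_IZR; lra.
Qed.

(* Pigeonhole: the centres fall into distinct cells of a fine grid. *)
Lemma tiles_near_finite x : exists M : nat, forall l : list (face L), NoDup l ->
  (forall i, In i l -> exists y, (Cmod (y - x) <= 1)%R /\ region (tile L i) y) ->
  (length l <= M)%nat.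
Proof.
  (* Two centres in one square cell of side [h] are less than [sqrt 2 * h] apart, which is below
     [sine]. *)
  set (h := (sine / 2)%R).
  assert (Hh : (0 < h)%R) by (generalize sine_pos; unfold h; lra).
  set (cell (i : face L) := let c := centre (tile L i) - x in
    (Int_part (Re c / h), Int_part (Im c / h))).
  set (b := up (2 / h)).
  set (range := map (fun k => (Z.of_nat k - b - 1)%Z) (seq 0 (Z.to_nat (2 * b + 2)))).
  exists (length (list_prod range range)). intros l Hl Hnear.
  rewrite <- (length_map cell). apply NoDup_incl_length.
  - apply NoDup_map_inj_on; auto. intros i j _ _ E.
    apply centres_separated. unfold cell in E; cbv zeta in E.
    apply pair_equal_spec in E. destruct E as [E1 E2].
    set (ci := centre (tile L i)) in *. set (cj := centre (tile L j)) in *.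
    assert (K : forall r1 r2 : R, Int_part (r1 / h) = Int_part (r2 / h) ->
              (Rabs (r1 - r2) < h)%R).
    { intros r1 r2 E. destruct (base_Int_part (r1 / h)), (base_Int_part (r2 / h)).
      rewrite E in *. apply Rabs_def1.
      - apply Rmult_lt_reg_r with (/ h)%R; [apply Rinv_0_lt_compat; auto|].
        rewrite Rinv_r; unfold Rdiv in *; lra.
      - apply Rmult_lt_reg_r with (/ h)%R; [apply Rinv_0_lt_compat; auto|].
        replace (- h * / h)%R with (-1)%R by (field; lra); unfold Rdiv in *; lra. }
    apply K in E1. apply K in E2.
    replace (Re (ci - x) - Re (cj - x))%R with (Re (ci - cj)) in E1
      by (unfold Re; simpl; ring).
    replace (Im (ci - x) - Im (cj - x))%R with (Im (ci - cj)) in E2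
      by (unfold Im; simpl; ring).
    apply Rsqr_incrst_0; [|apply Cmod_ge_0|generalize sine_pos; lra].
    unfold Rsqr. rewrite Cmod_sqr.
    replace sine with (2 * h)%R by (unfold h; lra).
    apply Rabs_def2 in E1. apply Rabs_def2 in E2. nra.
  - intros p Hp. apply in_map_iff in Hp. destruct Hp as (i & <- & Hi).
    destruct (Hnear i Hi) as (y & Hy & Hr). apply region_centre in Hr.
    assert (D : (Cmod (centre (tile L i) - x) <= 2)%R).
    { replace (centre (tile L i) - x) with (- (y - centre (tile L i)) + (y - x)) by ring.
      eapply Rle_trans; [apply Cmod_triangle|]. rewrite Cmod_opp; lra. }
    assert (Rng : forall r, (Rabs r <= 2)%R -> In (Int_part (r / h)) range).
    { intros r H2. assert (H3 : (Rabs (r / h) <= 2 / h)%R).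
      { unfold Rdiv. rewrite Rabs_mult, (Rabs_pos_eq (/ h)).
        - apply Rmult_le_compat_r; auto. left; apply Rinv_0_lt_compat; auto.
        - left; apply Rinv_0_lt_compat; auto. }
      apply floor_bounds in H3. fold b in H3.
      apply in_map_iff. exists (Z.to_nat (Int_part (r / h) + b + 1)). split; [lia|].
      apply in_seq. lia. }
    unfold cell. apply in_prod; apply Rng; (eapply Rle_trans; [|exact D]).
    + apply re_le_Cmod.
    + eapply Rle_trans; [|apply Rmax_Cmod]. apply Rmax_r.
Qed.

(** Otherwise tiles that avoid [x] would come arbitrarily close to it. Each of them is closed and
    keeps a positive distance from [x], so the next one found closer is new; in the end more tiles
    meet the unit disc around [x] than [tiles_near_finite] allows. *)
Lemma locally_finite x : exists eps : R, (0 < eps)%R /\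
  forall i y, (Cmod (y - x) < eps)%R -> region (tile L i) y -> region (tile L i) x.
Proof.
  apply NNPP; intros H.
  destruct (tiles_near_finite x) as [M HM].
  assert (K : forall n : nat, exists l : list (face L), length l = n /\ NoDup l /\
     forall i, In i l -> ~ region (tile L i) x /\
       exists y, (Cmod (y - x) <= 1)%R /\ region (tile L i) y).
  { induction n as [|n (l & El & Nl & Hl)].
    - exists nil; repeat split; try constructor; simpl in *; tauto.
    - assert (B : exists eps : R, (0 < eps <= 1)%R /\ forall i, In i l ->
        forall y, (Cmod (y - x) < eps)%R -> ~ region (tile L i) y).
      { clear El Nl. induction l as [|j l IH].
        - exists 1%R; split; [lra|]. simpl; tauto.
        - destruct IH as (e1 & He1 & H1); [intros; apply Hl; simpl; auto|].
          destruct (region_closed j x) as (e2 & He2 & H2); [apply Hl; simpl; auto|].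
          exists (Rmin e1 e2). split.
          + split; [apply Rmin_glb_lt; lra|]. eapply Rle_trans; [apply Rmin_l|lra].
          + intros i [<-|Hi] y Hy.
            * apply H2. eapply Rlt_le_trans; [exact Hy|apply Rmin_r].
            * apply H1; auto. eapply Rlt_le_trans; [exact Hy|apply Rmin_l]. }
      destruct B as (eps & He & Heps).
      assert (Ex : exists i y, (Cmod (y - x) < eps)%R /\ region (tile L i) y /\
                ~ region (tile L i) x).
      { apply NNPP; intros N. apply H. exists eps; split; [lra|].
        intros i y Hy Hr. apply NNPP; intros Hn. apply N; eauto. }
      destruct Ex as (i & y & Hy & Hr & Hn).
      exists (i :: l). split; [simpl; lia|]. split.
      + constructor; auto. intros Hi. eapply Heps; eauto.
      + intros j [<-|Hj]; auto. split; auto. exists y; split; auto; lra. }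
  destruct (K (S M)) as (l & El & Nl & Hl).
  assert (length l <= M)%nat; [|lia].
  apply HM; auto. intros i Hi; apply Hl; auto.
Qed.

End Lattice.

(** * Tiles that share a side *)

Section Tiling.

Variable L : rhombic_lattice.

Lemma is_side_sym Q a b : is_side Q a b -> is_side Q b a.
Proof. unfold is_side; tauto. Qed.
Lemma is_side_corners Q a b : is_side Q a b -> In a (corners Q) /\ In b (corners Q).
Proof.
  unfold is_side, corners; simpl; rewrite !pair_equal_spec; intuition (subst; auto).
Qed.
Lemma corner_region Q x : In x (corners Q) -> region Q x.
Proof.
  unfold corners; simpl. intros [<-|[<-|[<-|[<-|[]]]]].
  - exists 0%R, 0%R; repeat split; try lra; ring.
  - exists 1%R, 0%R; repeat split; try lra; ring.
  - exists 1%R, 1%R; repeat split; try lra; ring.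
  - exists 0%R, 1%R; repeat split; try lra; ring.
Qed.

Lemma edge_sym a b : edge L a b -> edge L b a.
Proof. intros [i H]; exists i; apply is_side_sym, H. Qed.
Lemma edge_vertices a b : edge L a b -> vertex L a /\ vertex L b.
Proof. intros [i H]; apply is_side_corners in H; split; exists i; tauto. Qed.
Lemma frame_edge i u e f : frame (tile L i) u e f -> edge L u (u + e).
Proof.
  intros F. exists i. apply (frame_sides _ _ _ _ F). exists 0%R; split; auto.
  left; split; ring.
Qed.
Lemma edge_length a b : edge L a b -> Cmod (b - a) = 1%R.
Proof.
  intros [i H]. destruct (frame_side _ _ _ (tile_unit L i) H) as (f & He & _). exact He.
Qed.

(** A vertex cannot lie inside a side of another tile: two tiles that meet in a segment have it as a
    full side, and a corner of a tile that lies on one of its own sides is an endpoint of that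
    side. *)
Lemma vertex_in_region i v : vertex L v -> region (tile L i) v ->
  In v (corners (tile L i)).
Proof.
  intros [j Hj] Hr. destruct (classic (i = j)) as [<-|D]; auto.
  destruct (tile_edge_to_edge L i j D) as [H|[(a & Ha & _ & H)|(a & b & Hi & Hs & H)]].
  - exfalso; apply (H v); split; auto using corner_region.
  - assert (v = a) by (apply H; split; auto using corner_region). subst; auto.
  - destruct (proj1 (H v)) as (t & _ & E); [split; auto using corner_region|].
    destruct (frame_side _ _ _ (tile_unit L j) Hs) as (f & F).
    apply (frame_corners _ _ _ _ F) in Hj.
    assert (Hc : cross (b - a) f <> 0%R) by apply F.
    apply is_side_corners in Hi. destruct Hi.
    assert (E1 : coord1 a (b - a) f v = t /\ coord2 a (b - a) f v = 0%R).
    { rewrite E. replace (a + t * (b - a)) with (a + t * (b - a) + 0%R * f) by ring.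
      rewrite coord1_val, coord2_val; auto. }
    destruct Hj as [->|[->|[Hj|Hj]]]; auto.
    + replace (a + (b - a)) with b by ring; auto.
    + replace v with (a + 1%R * (b - a) + 1%R * f) in E1 by (rewrite Hj; ring).
      rewrite coord2_val in E1; auto. lra.
    + replace v with (a + 0%R * (b - a) + 1%R * f) in E1 by (rewrite Hj; ring).
      rewrite coord2_val in E1; auto. lra.
Qed.

(** The condition [0 < s < 1] excludes the two sides parallel to [f], on which the first coordinate
    is 0 or 1. *)
Lemma side_through Q u e f (s t : R) a b : frame Q u e f -> (0 < s < 1)%R ->
  is_side Q a b -> segment a b (u + s * e + t * f) ->
  (t = 0%R \/ t = 1%R) /\
  ((a = u + t * f /\ b = u + t * f + e) \/ (b = u + t * f /\ a = u + t * f + e)).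
Proof.
  intros F Hs Hab (k & Hk & E).
  apply (frame_sides _ _ _ _ F) in Hab. destruct Hab as (r & Hr & H).
  assert (Hc : cross e f <> 0%R) by apply F.
  destruct H as [[-> ->]|[[-> ->]|[[-> ->]|[-> ->]]]].
  - replace (u + r * f + k * (u + r * f + e - (u + r * f)))
      with (u + k * e + r * f) in E by ring.
    apply coords_uniq in E; auto. destruct E as [_ ->]; auto.
  - replace (u + r * f + e + k * (u + r * f - (u + r * f + e)))
      with (u + (1 - k)%R * e + r * f) in E by (rewrite RtoC_minus; ring).
    apply coords_uniq in E; auto. destruct E as [_ ->]; auto.
  - replace (u + r * e + k * (u + r * e + f - (u + r * e)))
      with (u + r * e + k * f) in E by ring.
    apply coords_uniq in E; auto. lra.
  - replace (u + r * e + f + k * (u + r * e - (u + r * e + f)))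
      with (u + r * e + (1 - k)%R * f) in E by (rewrite RtoC_minus; ring).
    apply coords_uniq in E; auto. lra.
Qed.

(** This passes from a common point to a common side. The point has first coordinate strictly
    between 0 and 1, so it is not a corner, and edge-to-edge tiles that share such a point share a
    side through it. *)
Lemma tile_through i j u e f (s t : R) : frame (tile L i) u e f ->
  (0 < s < 1)%R -> (0 <= t <= 1)%R -> region (tile L j) (u + s * e + t * f) ->
  i = j \/ ((t = 0%R \/ t = 1%R) /\ is_side (tile L j) (u + t * f) (u + t * f + e)).
Proof.
  intros F Hs Ht Hr. destruct (classic (i = j)) as [<-|D]; auto.
  assert (Hc : cross e f <> 0%R) by apply F.
  assert (Hi : region (tile L i) (u + s * e + t * f)).
  { apply (frame_region _ _ _ _ F). rewrite coord1_val, coord2_val; auto; lra. }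
  destruct (tile_edge_to_edge L i j D) as [H|[(a & Ha & _ & H)|(a & b & Ha & Hs' & H)]].
  - exfalso; eapply H; eauto.
  - exfalso. assert (E : u + s * e + t * f = a) by (apply H; auto). clear H. subst a.
    apply (frame_corners _ _ _ _ F) in Ha.
    destruct Ha as [E|[E|[E|E]]].
    + replace u with (u + 0%R * e + 0%R * f) in E at 2 by ring.
      apply coords_uniq in E; auto; lra.
    + replace (u + e) with (u + 1%R * e + 0%R * f) in E by ring.
      apply coords_uniq in E; auto; lra.
    + replace (u + e + f) with (u + 1%R * e + 1%R * f) in E by ring.
      apply coords_uniq in E; auto; lra.
    + replace (u + f) with (u + 0%R * e + 1%R * f) in E by ring.
      apply coords_uniq in E; auto; lra.
  - right. destruct (side_through _ _ _ _ s t _ _ F Hs Ha) as [A [[-> ->]|[-> ->]]];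
      auto using is_side_sym. apply H; auto.
Qed.

Lemma frame_cross_case i u e f : frame (tile L i) u e f ->
  cross e f = sine L \/ cross e f = (- sine L)%R.
Proof.
  intros F. rewrite <- (frame_sine L _ _ _ _ F). unfold Rabs.
  destruct Rcase_abs; lra.
Qed.

(** If the tile at hand lies to the right, the midpoint of the edge is moved slightly to the left
    ([Ci] is a quarter turn). By local finiteness a tile covering the moved point also contains the
    midpoint, so it has the edge as a side, and the moved point shows on which side of the edge it
    lies. *)
Lemma tile_left_of_edge a b : edge L a b ->
  exists j f, frame (tile L j) a (b - a) f /\ cross (b - a) f = sine L.
Proof.
  intros Hab. assert (Hs := sine_pos L).
  assert (Hlen := edge_length _ _ Hab). destruct Hab as [i Hab].
  destruct (frame_side _ _ _ (tile_unit L i) Hab) as (f & F).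
  destruct (frame_cross_case _ _ _ _ F) as [E|E]; [eauto|].
  set (e := b - a) in *.
  destruct (locally_finite L (a + (1/2)%R * e)) as (eps & He & Hloc).
  set (x := a + (1/2)%R * e + (eps / 2)%R * (Ci * e)).
  assert (Hx : cross e (x - a) = (eps / 2)%R).
  { unfold x. replace (a + (1/2)%R * e + (eps/2)%R * (Ci * e) - a)
      with ((1/2)%R * e + (eps/2)%R * (Ci * e)) by ring.
    rewrite cross_plus, !cross_scal, cross_self.
    replace (cross e (Ci * e)) with (Cmod e * Cmod e)%R.
    - rewrite Hlen; ring.
    - rewrite Cmod_sqr. unfold cross, Re, Im; simpl; ring. }
  destruct (tile_cover L x) as [j Hj].
  assert (Hm : region (tile L j) (a + (1/2)%R * e)).
  { apply Hloc with x; auto. unfold x.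
    replace (a + (1/2)%R * e + (eps / 2)%R * (Ci * e) - (a + (1/2)%R * e))
      with ((eps / 2)%R * (Ci * e)) by ring.
    rewrite !Cmod_mult, Cmod_Ci, Hlen, Cmod_R, Rabs_pos_eq; lra. }
  destruct (tile_through i j a e f (1/2) 0 F) as [<-|[_ S]]; try lra.
  - replace (a + (1/2)%R * e + 0%R * f) with (a + (1/2)%R * e) by ring; auto.
  - exfalso. apply (frame_region _ _ _ _ F) in Hj. destruct Hj as [_ Hj].
    unfold coord2 in Hj. rewrite Hx, E in Hj. destruct Hj as [Hj _].
    apply Rmult_le_compat_r with (r := sine L) in Hj; [|lra].
    replace (eps / 2 / - sine L * sine L)%R with (- (eps / 2))%R in Hj by (field; lra). lra.
  - replace (a + 0%R * f) with a in S by ring.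
    destruct (frame_side _ _ _ (tile_unit L j) S) as (g & G).
    replace (a + e - a) with e in G by ring.
    exists j, g; split; auto.
    destruct (frame_cross_case _ _ _ _ G) as [E'|E']; auto. exfalso.
    apply (frame_region _ _ _ _ G) in Hj. destruct Hj as [_ Hj].
    unfold coord2 in Hj. rewrite Hx, E' in Hj. destruct Hj as [Hj _].
    apply Rmult_le_compat_r with (r := sine L) in Hj; [|lra].
    replace (eps / 2 / - sine L * sine L)%R with (- (eps / 2))%R in Hj by (field; lra). lra.
Qed.

(** * Walks *)

(** A walk records its steps rather than its vertices: the operators transported along it depend on
    directions only, and the same list can be walked on both sides of a strip. *)
Inductive walk : C -> list C -> C -> Prop :=
| walk_nil a : walk a nil a
| walk_cons a d l b : edge L a (a + d) -> walk (a + d) l b -> walk a (d :: l) b.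

Lemma walk_app a l b l' c : walk a l b -> walk b l' c -> walk a (l ++ l') c.
Proof. induction 1; simpl; auto. intros; constructor; auto. Qed.
Lemma walk_edge a b : edge L a b -> walk a [b - a] b.
Proof.
  intros H. replace b with (a + (b - a)) at 2 by ring. repeat constructor.
  replace (a + (b - a)) with b by ring; auto.
Qed.
Lemma walk_rev a l b : walk a l b -> walk b (rev (map Copp l)) a.
Proof.
  induction 1 as [|a d l b H W IH]; simpl; [constructor|].
  eapply walk_app; [apply IH|].
  replace (- d) with (a - (a + d)) by ring. apply walk_edge, edge_sym, H.
Qed.

Lemma walk_split l l' a b : walk a (l ++ l') b ->
  exists c, walk a l c /\ walk c l' b.
Proof.
  revert a. induction l as [|d l IH]; simpl; intros a W.
  - exists a; split; auto; constructor.
  - inversion W as [|? ? ? ? Wd W']; subst. destruct (IH _ W') as (c & C1 & C2).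
    exists c; split; auto. constructor; auto.
Qed.

Definition reachable a b := exists l, walk a l b.

Lemma reachable_trans a b c : reachable a b -> reachable b c -> reachable a c.
Proof. intros [l H] [l' H']; exists (l ++ l'); eapply walk_app; eauto. Qed.
Lemma reachable_sym a b : reachable a b -> reachable b a.
Proof. intros [l H]; eexists; apply walk_rev; eauto. Qed.

Lemma corners_reachable i a b : In a (corners (tile L i)) ->
  In b (corners (tile L i)) -> reachable a b.
Proof.
  assert (F := frame_tile L i).
  set (u := org (tile L i)) in *. set (e := du (tile L i)) in *. set (f := dv (tile L i)) in *.
  assert (E1 := frame_edge _ _ _ _ F).
  assert (E2 := frame_edge _ _ _ _ (frame_swap _ _ _ _ F)).
  assert (E3 := frame_edge _ _ _ _ (frame_swap _ _ _ _ (frame_flip _ _ _ _ F))).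
  assert (K : forall x, In x (corners (tile L i)) -> reachable u x).
  { intros x Hx. apply (frame_corners _ _ _ _ F) in Hx.
    destruct Hx as [-> | [-> | [-> | -> ]]].
    - exists nil; constructor.
    - eexists; apply walk_edge; auto.
    - eapply reachable_trans; eexists; apply walk_edge; [exact E1|exact E3].
    - eexists; apply walk_edge; auto. }
  intros Ha Hb. eapply reachable_trans; [apply reachable_sym|]; apply K; auto.
Qed.

Lemma tiles_meet i j x : region (tile L i) x -> region (tile L j) x ->
  exists a, In a (corners (tile L i)) /\ In a (corners (tile L j)).
Proof.
  intros Hi Hj. destruct (classic (i = j)) as [<-|D].
  - exists (org (tile L i)); unfold corners; simpl; auto.
  - destruct (tile_edge_to_edge L i j D) as [H|[(a & Ha & Hb & H)|(a & b & Ha & Hs' & H)]].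
    + exfalso; eapply H; eauto.
    + eauto.
    + exists a. split; [eapply (is_side_corners _ _ _ Ha)|eapply (is_side_corners _ _ _ Hs')].
Qed.

(** Connectedness of the interval: the indicator function of [P] is continuous, and by the
    intermediate value theorem it would take the value 1/2. *)
Lemma locally_constant_segment (P : R -> Prop) :
  (forall t, exists eps, (0 < eps)%R /\
     forall r, (Rabs (r - t) < eps)%R -> (P r <-> P t)) -> P 0%R -> P 1%R.
Proof.
  intros H P0. apply NNPP; intros P1.
  set (g := fun t => if excluded_middle_informative (P t) then 0%R else 1%R).
  assert (Hg : continuity g).
  { intros t eps Heps. destruct (H t) as (d & Hd & K). exists d; split; auto.
    intros r [_ Hr]. simpl in *. unfold R_dist in *. apply K in Hr. unfold g.
    destruct (excluded_middle_informative (P r)), (excluded_middle_informative (P t));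
      try tauto; rewrite Rminus_eq_0, Rabs_R0; auto. }
  destruct (IVT_gen g 0 1 (1/2) Hg) as (t & _ & Ht).
  - unfold g.
    destruct (excluded_middle_informative (P 0%R)), (excluded_middle_informative (P 1%R));
      try tauto. rewrite Rmin_left, Rmax_right; lra.
  - unfold g in Ht. destruct excluded_middle_informative; lra.
Qed.

(** The segment from [a] to [b] is followed from tile to tile. Tiles through a nearby point also
    contain the given point, and tiles with a common point share a corner; so the statement that all
    corners of the tiles at parameter [t] are reachable is locally constant in [t]. *)
Lemma vertices_reachable a b : vertex L a -> vertex L b -> reachable a b.
Proof.
  intros Ha Hb.
  set (P := fun t : R => forall i, region (tile L i) (a + t * (b - a)) ->
    forall v, In v (corners (tile L i)) -> reachable a v).
  assert (H : P 1%R).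
  { apply locally_constant_segment.
    - intros t. destruct (locally_finite L (a + t * (b - a))) as (eps & He & Hloc).
      exists (eps / (Cmod (b - a) + 1))%R.
      assert (Hc := Cmod_ge_0 (b - a)).
      split; [apply Rdiv_lt_0_compat; lra|].
      intros r Hr.
      assert (Hd : (Cmod (a + r * (b - a) - (a + t * (b - a))) < eps)%R).
      { replace (a + r * (b - a) - (a + t * (b - a))) with ((r - t)%R * (b - a))
          by (rewrite RtoC_minus; ring).
        rewrite Cmod_mult, Cmod_R.
        apply Rle_lt_trans with (Rabs (r - t) * (Cmod (b - a) + 1))%R.
        - apply Rmult_le_compat_l; [apply Rabs_pos|lra].
        - apply Rmult_lt_reg_r with (/ (Cmod (b - a) + 1))%R.
          + apply Rinv_0_lt_compat; lra.
          + rewrite Rmult_assoc, Rinv_r by lra. unfold Rdiv in Hr; lra. }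
      split; intros HP i Hi v Hv.
      + destruct (tile_cover L (a + r * (b - a))) as [j Hj].
        assert (Hj' := Hloc _ _ Hd Hj).
        destruct (tiles_meet _ _ _ Hj' Hi) as (w & W1 & W2).
        eapply reachable_trans; [apply (HP j Hj w W1)|].
        eapply corners_reachable; eauto.
      + apply (HP i); auto. eapply Hloc; eauto.
    - intros i Hi v Hv. replace (a + 0%R * (b - a)) with a in Hi by ring.
      eapply corners_reachable; eauto. apply vertex_in_region; auto. }
  destruct (tile_cover L b) as [i Hi].
  apply (H i).
  - replace (a + 1%R * (b - a)) with b by ring; auto.
  - apply vertex_in_region; auto.
Qed.

End Tiling.

Lemma lipschitz_continuity (g : R -> R) (K : R) :
  (forall r t, (Rabs (g r - g t) <= K * Rabs (r - t))%R) -> continuity g.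
Proof.
  intros H t eps Heps.
  assert (HK : (0 <= Rabs K)%R) by apply Rabs_pos.
  exists (eps / (Rabs K + 1))%R. split; [apply Rdiv_lt_0_compat; lra|].
  intros r [_ Hr]. simpl in *. unfold R_dist in *.
  eapply Rle_lt_trans; [apply H|].
  apply Rle_lt_trans with ((Rabs K + 1) * Rabs (r - t))%R.
  - apply Rmult_le_compat_r; [apply Rabs_pos|]. generalize (Rle_abs K); lra.
  - apply Rmult_lt_compat_l with (r := (Rabs K + 1)%R) in Hr; [|lra].
    eapply Rlt_le_trans; [exact Hr|]. right; field; lra.
Qed.

(** * Piecewise linear interpolation *)

Definition interp (x : Z -> R) (t : R) : R :=
  (x (Int_part t) + (t - IZR (Int_part t)) * (x (Int_part t + 1)%Z - x (Int_part t)))%R.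

Lemma Int_part_eq (n : Z) (t : R) : (IZR n <= t < IZR n + 1)%R -> Int_part t = n.
Proof.
  intros H. destruct (base_Int_part t).
  apply Z.le_antisymm; apply Z.lt_succ_r; apply lt_IZR; rewrite succ_IZR; lra.
Qed.

Lemma interp_on x (n : Z) (t : R) : (IZR n <= t <= IZR n + 1)%R ->
  interp x t = (x n + (t - IZR n) * (x (n + 1)%Z - x n))%R.
Proof.
  intros H. unfold interp. destruct (Req_dec t (IZR n + 1)) as [->|D].
  - rewrite (Int_part_eq (n + 1)); rewrite plus_IZR; lra.
  - rewrite (Int_part_eq n); lra.
Qed.

Lemma interp_lipschitz x : (forall n, (Rabs (x (n + 1)%Z - x n) <= 1)%R) ->
  forall r t, (Rabs (interp x r - interp x t) <= Rabs (r - t))%R.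
Proof.
  intros Hx.
  assert (A : forall (n : Z) r t, (IZR n <= r <= IZR n + 1)%R -> (IZR n <= t <= IZR n + 1)%R ->
            (Rabs (interp x r - interp x t) <= Rabs (r - t))%R).
  { intros n r t Hr Ht. rewrite !(interp_on x n) by auto.
    replace (x n + (r - IZR n) * (x (n + 1)%Z - x n)
      - (x n + (t - IZR n) * (x (n + 1)%Z - x n)))%R
      with ((r - t) * (x (n + 1)%Z - x n))%R by ring.
    rewrite Rabs_mult. rewrite <- (Rmult_1_r (Rabs (r - t))) at 2.
    apply Rmult_le_compat_l; [apply Rabs_pos|apply Hx]. }
  assert (B : forall (k : nat) (n : Z) r t, (IZR n <= r <= IZR n + 1)%R ->
     (IZR n + INR k <= t <= IZR n + INR k + 1)%R ->
            (Rabs (interp x t - interp x r) <= Rabs (t - r))%R).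
  { induction k as [|k IH]; intros n r t Hr Ht.
    - simpl in Ht. apply (A n); lra.
    - rewrite S_INR in Ht.
      assert (E := IH n r (IZR n + INR k + 1)%R Hr). rewrite INR_IZR_INZ in *.
      assert (P : (0 <= IZR (Z.of_nat k))%R) by (apply IZR_le; lia).
      assert (E2 : (Rabs (interp x t - interp x (IZR n + IZR (Z.of_nat k) + 1))
        <= Rabs (t - (IZR n + IZR (Z.of_nat k) + 1)))%R).
      { apply (A (n + Z.of_nat k + 1)%Z); rewrite !plus_IZR; lra. }
      replace (interp x t - interp x r)%R with
        ((interp x t - interp x (IZR n + IZR (Z.of_nat k) + 1)) +
         (interp x (IZR n + IZR (Z.of_nat k) + 1) - interp x r))%R by ring.
      eapply Rle_trans; [apply Rabs_triang|].
      rewrite (Rabs_pos_eq (t - r)) by lra.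
      rewrite (Rabs_pos_eq (t - _)) in E2 by lra.
      rewrite (Rabs_pos_eq (_ + 1 - r)) in E by lra. lra. }
  assert (D : forall r t, (r <= t)%R -> (Rabs (interp x t - interp x r) <= Rabs (t - r))%R).
  { intros r t H. destruct (base_Int_part r), (base_Int_part t).
    assert (Int_part r <= Int_part t)%Z.
    { apply Z.lt_succ_r, lt_IZR. rewrite succ_IZR. lra. }
    apply (B (Z.to_nat (Int_part t - Int_part r)) (Int_part r)); [lra|].
    rewrite INR_IZR_INZ, Z2Nat.id, minus_IZR by lia. lra. }
  intros r t. destruct (Rle_lt_dec r t).
  - rewrite Rabs_minus_sym, (Rabs_minus_sym r). apply D; auto.
  - apply D; lra.
Qed.

Section Strips.

Variable L : rhombic_lattice.
Notation s := (sine L).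

(** * Strips *)

(* The tiles of a track, listed along the ties [(spos n, spos n + sdir)]. *)
Record strip := Strip {
  sdir : C;
  spos : Z -> C;
  strip_tile : forall n, exists i,
    frame (tile L i) (spos n) sdir (spos (n + 1)%Z - spos n) /\
    cross sdir (spos (n + 1)%Z - spos n) = s
}.

(** The tile left of a tie leads to the next tie, the tile left of the reversed tie leads to the
    previous one. Iterating the two choices from [a] gives a sequence over [Z]. *)
Lemma strip_through_edge a b : edge L a b ->
  exists F : strip, sdir F = b - a /\ spos F 0 = a.
Proof.
  intros Hab. set (e := b - a).
  assert (E0 : edge L a (a + e)) by (replace (a + e) with b by (unfold e; ring); auto).
  set (goes p q := exists i, frame (tile L i) p e (q - p) /\ cross e (q - p) = s).
  set (up p := epsilon (inhabits p) (fun q => goes p q)).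
  set (down q := epsilon (inhabits q) (fun p => goes p q)).
  assert (Hgoes : forall p q, goes p q -> edge L p (p + e) /\ edge L q (q + e)).
  { intros p q (i & F & _). split; [eapply frame_edge, F|].
    apply frame_flip2, frame_edge in F. replace (p + (q - p)) with q in F by ring; auto. }
  assert (Hup : forall p, edge L p (p + e) -> goes p (up p)).
  { intros p Hp. unfold up. apply epsilon_spec.
    destruct (tile_left_of_edge L _ _ Hp) as (j & f & F & E).
    replace (p + e - p) with e in * by ring.
    exists (p + f), j. replace (p + f - p) with f by ring; auto. }
  assert (Hdown : forall q, edge L q (q + e) -> goes (down q) q).
  { intros q Hq. unfold down. apply epsilon_spec. apply edge_sym in Hq.
    destruct (tile_left_of_edge L _ _ Hq) as (j & f & F & E).
    replace (q - (q + e)) with (- e) in * by ring.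
    apply frame_flip, frame_flip2 in F.
    exists (q + f), j. replace (q - (q + f)) with (- f) by ring.
    rewrite cross_opp, <- cross_opp_l. split; auto.
    replace (q + e + - e) with q in F by ring.
    replace (- - e) with e in F by ring; auto. }
  assert (Eup : forall k, edge L (Nat.iter k up a) (Nat.iter k up a + e)).
  { induction k; simpl; auto. apply (Hgoes _ _ (Hup _ IHk)). }
  assert (Edown : forall k, edge L (Nat.iter k down a) (Nat.iter k down a + e)).
  { induction k; simpl; auto. apply (Hgoes _ _ (Hdown _ IHk)). }
  set (pos n := if (0 <=? n)%Z then Nat.iter (Z.to_nat n) up a
                else Nat.iter (Z.to_nat (- n)) down a).
  assert (Hpos : forall n, goes (pos n) (pos (n + 1)%Z)).
  { intros n. unfold pos.
    destruct (Z.leb_spec 0 n).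
    - destruct (Z.leb_spec 0 (n + 1)); [|lia].
      replace (Z.to_nat (n + 1)) with (S (Z.to_nat n)) by lia. apply Hup, Eup.
    - replace (if (0 <=? n + 1)%Z then Nat.iter (Z.to_nat (n + 1)) up a
        else Nat.iter (Z.to_nat (- (n + 1))) down a)
        with (Nat.iter (Z.to_nat (- (n + 1))) down a).
      + replace (Z.to_nat (- n)) with (S (Z.to_nat (- (n + 1)))) by lia. apply Hdown, Edown.
      + destruct (Z.leb_spec 0 (n + 1)); auto.
        replace (n + 1)%Z with 0%Z by lia; reflexivity. }
  exists (Strip e pos Hpos). split; reflexivity.
Qed.

Variable F : strip.
Notation e := (sdir F).
Notation u := (spos F).

Lemma sdir_unit : Cmod e = 1%R.
Proof. destruct (strip_tile F 0) as (i & (H & _) & _); exact H. Qed.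
Lemma strip_step_unit n : Cmod (u (n + 1)%Z - u n) = 1%R.
Proof. destruct (strip_tile F n) as (i & (_ & H & _) & _); exact H. Qed.
Lemma strip_step_cross n : cross e (u (n + 1)%Z - u n) = s.
Proof. destruct (strip_tile F n) as (i & _ & H); exact H. Qed.

(** The ties climb in equal steps, without bound in both directions: this is why every line parallel
    to [sdir] meets the strip. *)
Lemma strip_level n : cross e (u n) = (cross e (u 0%Z) + IZR n * s)%R.
Proof.
  revert n. apply Z.bi_induction.
  - intros x y ->; tauto.
  - ring.
  - intros n. generalize (strip_step_cross n).
    rewrite cross_minus, <- Z.add_1_r, plus_IZR. intros; lra.
Qed.

(* In the orthonormal coordinates [dot e], [cross e], the strip occupies on the line at
   height [y] the interval from [left_side y] to [left_side y + 1]; [offset x] is the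
   position of [x] relative to it. *)
Definition left_side (y : R) : R :=
  interp (fun n => dot e (u n)) ((y - cross e (u 0%Z)) / s).

Definition offset (x : C) : R := (dot e x - left_side (cross e x))%R.

Lemma left_side_lipschitz y y' :
  (Rabs (left_side y - left_side y') <= / s * Rabs (y - y'))%R.
Proof.
  unfold left_side. eapply Rle_trans; [apply interp_lipschitz|].
  - intros n. rewrite <- dot_minus. eapply Rle_trans; [apply dot_bound|].
    rewrite sdir_unit, strip_step_unit. lra.
  - right. assert (Hs := sine_pos L).
    replace ((y - cross e (u 0%Z)) / s - (y' - cross e (u 0%Z)) / s)%R
      with (/ s * (y - y'))%R by (field; lra).
    rewrite Rabs_mult, (Rabs_pos_eq (/ s)); auto. left; apply Rinv_0_lt_compat; auto.
Qed.

Lemma offset_shift x (t : R) : offset (x + t * e) = (offset x + t)%R.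
Proof.
  unfold offset.
  rewrite dot_plus, cross_plus, dot_scal, cross_scal, cross_self, dot_self, sdir_unit.
  rewrite Rmult_0_r, Rplus_0_r. ring.
Qed.
Lemma offset_tie n : offset (u n) = 0%R.
Proof.
  unfold offset, left_side. assert (Hs := sine_pos L).
  replace ((cross e (u n) - cross e (u 0%Z)) / s)%R with (IZR n).
  - rewrite (interp_on _ n) by lra. ring.
  - rewrite (strip_level n). field; lra.
Qed.
Lemma offset_tie_end n : offset (u n + e) = 1%R.
Proof.
  replace (u n + e) with (u n + RtoC 1 * e) by ring.
  rewrite offset_shift, offset_tie; ring.
Qed.

(** The height above tie 0 is measured in units of the sine; its integer part selects the tile, its
    fractional part the position along it. In particular a point with offset in [0, 1] lies in tile
    [n]. *)
Lemma strip_point x : exists (n : Z) (t : R), (0 <= t < 1)%R /\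
  x = u n + offset x * e + t * (u (n + 1)%Z - u n) /\
  cross e x = (cross e (u 0%Z) + (IZR n + t) * s)%R.
Proof.
  assert (Hs := sine_pos L).
  set (w := ((cross e x - cross e (u 0%Z)) / s)%R).
  exists (Int_part w), (w - IZR (Int_part w))%R.
  destruct (base_Int_part w). split; [lra|].
  assert (E : cross e x = (cross e (u 0%Z) + (IZR (Int_part w) + (w - IZR (Int_part w))) * s)%R).
  { unfold w at 2. field_simplify; [|lra]. ring. }
  assert (E' : cross e x = (cross e (u 0%Z) + w * s)%R) by (unfold w; field; lra).
  split; [|rewrite E' at 1; ring].
  apply (dot_cross_inj e); [apply sdir_unit| |].
  - rewrite !dot_plus, !dot_scal, dot_minus, dot_self, sdir_unit.
    unfold offset, left_side, interp. fold w. ring.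
  - rewrite !cross_plus, !cross_scal, strip_step_cross, cross_self, strip_level, E'. ring.
Qed.

(** A vertex with offset strictly between 0 and 1 would lie in a tile of the strip, hence be a
    corner of it, but corners have first coordinate 0 or 1. *)
Lemma vertex_offset v : vertex L v -> (offset v <= 0 \/ 1 <= offset v)%R.
Proof.
  intros Hv. destruct (Rle_lt_dec (offset v) 0) as [|D1]; auto.
  destruct (Rle_lt_dec 1 (offset v)) as [|D2]; auto. exfalso.
  destruct (strip_point v) as (n & t & Ht & E & _).
  destruct (strip_tile F n) as (i & Fr & Hc).
  set (o := offset v) in *. set (f := u (n + 1)%Z - u n) in *.
  assert (Hf : cross e f <> 0%R) by apply Fr.
  assert (Hi : In v (corners (tile L i))).
  { apply vertex_in_region; auto. apply (frame_region _ _ _ _ Fr).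
    rewrite E, coord1_val, coord2_val; auto; lra. }
  apply (frame_corners _ _ _ _ Fr) in Hi. rewrite E in Hi.
  destruct Hi as [E'|[E'|[E'|E']]].
  - replace (u n) with (u n + 0%R * e + 0%R * f) in E' at 2 by ring.
    apply coords_uniq in E'; auto; lra.
  - replace (u n + e) with (u n + 1%R * e + 0%R * f) in E' by ring.
    apply coords_uniq in E'; auto; lra.
  - replace (u n + e + f) with (u n + 1%R * e + 1%R * f) in E' by ring.
    apply coords_uniq in E'; auto; lra.
  - replace (u n + f) with (u n + 0%R * e + 1%R * f) in E' by ring.
    apply coords_uniq in E'; auto; lra.
Qed.

(** Real-valued, so that the differences [crossing] telescope along a walk. By [vertex_offset] any
    threshold strictly between 0 and 1 would give the same values at vertices. *)
Definition beyond (v : C) : R := if Rle_dec 1 (offset v) then 1%R else 0%R.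

Definition crossing (p d : C) : R := (beyond (p + d) - beyond p)%R.

(** Along the edge the offset varies continuously between a value at most 0 and a value at least 1,
    so it equals 1/2 somewhere. That point lies in a tile of the strip, halfway across, and by
    [side_through] a side through it is a tie. *)
Lemma crossing_tie p d : edge L p (p + d) -> crossing p d <> 0%R ->
  exists n, (p = u n /\ d = e) \/ (p = u n + e /\ d = - e).
Proof.
  intros Hpd Hc.
  assert (Hd : Cmod d = 1%R).
  { rewrite <- (edge_length _ _ _ Hpd). f_equal; ring. }
  destruct (edge_vertices _ _ _ Hpd) as [V1 V2].
  apply vertex_offset in V1. apply vertex_offset in V2.
  set (g := fun t : R => offset (p + t * d)).
  assert (Hg : continuity g).
  { apply (lipschitz_continuity _ (1 + / s)). intros r t. unfold g, offset.
    rewrite !dot_plus, !cross_plus, !dot_scal, !cross_scal.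
    set (A := left_side _). set (B := left_side _).
    replace (dot e p + r * dot e d - A - (dot e p + t * dot e d - B))%R
      with (dot e d * (r - t) + - (A - B))%R by ring.
    eapply Rle_trans; [apply Rabs_triang|]. rewrite Rabs_Ropp, Rabs_mult.
    rewrite Rmult_plus_distr_r. apply Rplus_le_compat.
    - apply Rmult_le_compat_r; [apply Rabs_pos|].
      eapply Rle_trans; [apply dot_bound|]. rewrite sdir_unit, Hd; lra.
    - unfold A, B. eapply Rle_trans; [apply left_side_lipschitz|].
      apply Rmult_le_compat_l; [left; apply Rinv_0_lt_compat, sine_pos|].
      replace (cross e p + r * cross e d - (cross e p + t * cross e d))%R
        with (cross e d * (r - t))%R by ring.
      rewrite Rabs_mult. rewrite <- (Rmult_1_l (Rabs (r - t))) at 2.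
      apply Rmult_le_compat_r; [apply Rabs_pos|].
      eapply Rle_trans; [apply cross_bound|]. rewrite sdir_unit, Hd; lra. }
  assert (G0 : g 0%R = offset p) by (unfold g; f_equal; ring).
  assert (G1 : g 1%R = offset (p + d)) by (unfold g; f_equal; ring).
  destruct (IVT_gen g 0 1 (1/2) Hg) as (t & Ht & E).
  { rewrite G0, G1. unfold crossing, beyond in Hc.
    destruct (Rle_dec 1 (offset p)), (Rle_dec 1 (offset (p + d))); try lra.
    - rewrite Rmin_right, Rmax_left; lra.
    - rewrite Rmin_left, Rmax_right; lra. }
  rewrite Rmin_left, Rmax_right in Ht by lra.
  unfold g in E. destruct (strip_point (p + t * d)) as (n & r & Hr & Ex & _).
  rewrite E in Ex.
  destruct (strip_tile F n) as (i & Fr & _).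
  assert (Fr' := frame_flip2 _ _ _ _ Fr).
  destruct Hpd as [j Hj].
  assert (Seg : segment p (p + d) (u n + RtoC (1/2) * e + r * (u (n + 1)%Z - u n))).
  { exists t; split; auto. rewrite <- Ex. ring. }
  assert (T : i = j \/ ((r = 0%R \/ r = 1%R) /\
    is_side (tile L j) (u n + r * (u (n + 1)%Z - u n)) (u n + r * (u (n + 1)%Z - u n) + e))).
  { apply (tile_through L i j _ _ _ (1/2)); auto; try lra.
    rewrite <- Ex. apply is_side_corners in Hj. destruct Hj as [J1 J2].
    apply corner_region in J1. apply corner_region in J2.
    assert (Fj := frame_tile L j). set (c := tile L j) in *.
    destruct J1 as (s1 & t1 & Hs1 & Ht1 & E1), J2 as (s2 & t2 & Hs2 & Ht2 & E2).
    exists ((1 - t) * s1 + t * s2)%R, ((1 - t) * t1 + t * t2)%R.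
    split; [nra|split; [nra|]].
    replace (p + t * d) with ((1 - t)%R * p + t * (p + d)) by (rewrite RtoC_minus; ring).
    rewrite E2, E1. rewrite !RtoC_plus, !RtoC_mult, !RtoC_minus. ring. }
  assert (S : forall Q a f (t' : R), frame Q a e f -> is_side Q p (p + d) ->
    segment p (p + d) (a + RtoC (1/2) * e + t' * f) ->
    (t' = 0%R \/ t' = 1%R) /\ ((p = a + t' * f /\ d = e) \/ (p = a + t' * f + e /\ d = - e))).
  { intros Q a f t' HF HS HG.
    destruct (side_through _ _ _ _ (1/2) t' _ _ HF ltac:(lra) HS HG) as [A B].
    split; auto. destruct B as [[B1 B2]|[B1 B2]].
    - left; split; auto. replace d with (p + d - p) by ring. rewrite B2, B1; ring.
    - right; split; auto. replace d with (p + d - p) by ring. rewrite B1, B2; ring. }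
  assert (Fin : forall t' : R, (t' = 0%R \/ t' = 1%R) ->
     exists m, u n + t' * (u (n + 1)%Z - u n) = u m).
  { intros t' [-> | ->]; [exists n|exists (n + 1)%Z]; ring. }
  (* Either the edge is a side of the tile of the strip itself, or the point lies on a tie that is
     also a side of tile [j]; in the frame of [j] based on this tie the point has second coordinate
     0. *)
  destruct T as [<-|[Hr' T]].
  - destruct (S _ _ _ _ Fr Hj Seg) as [A B].
    destruct (Fin r A) as [m Em]. exists m. rewrite <- Em. auto.
  - destruct (frame_side _ _ _ (tile_unit L j) T) as (f & Fj).
    set (a := u n + r * (u (n + 1)%Z - u n)) in *.
    replace (a + e - a) with e in Fj by ring.
    destruct (Fin r Hr') as [m Em]. fold a in Em. exists m. rewrite <- Em.
    destruct (S _ _ _ 0%R Fj Hj) as [_ B].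
    + replace (a + RtoC (1/2) * e + RtoC 0 * f) with (u n + RtoC (1 / 2) * e + r * (u (n + 1)%Z - u n))
        by (unfold a; ring). auto.
    + replace (a + RtoC 0 * f) with a in B by ring. auto.
Qed.

End Strips.

(** * Closed and shortest walks *)

Section ClosedWalks.

Variable L : rhombic_lattice.
Notation sdir := (sdir L).
Notation spos := (spos L).
Notation crossing := (crossing L).
Notation beyond := (beyond L).

Lemma beyond_tie F n : beyond F (spos F n) = 0%R.
Proof. unfold beyond. rewrite offset_tie. destruct Rle_dec; lra. Qed.
Lemma beyond_tie_end F n : beyond F (spos F n + sdir F) = 1%R.
Proof. unfold beyond. rewrite offset_tie_end. destruct Rle_dec; lra. Qed.
Lemma crossing_of_tie F n : crossing F (spos F n) (sdir F) = 1%R.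
Proof. unfold crossing. rewrite beyond_tie, beyond_tie_end. ring. Qed.

Lemma crossing_back F p d : crossing F (p + d) (- d) = (- crossing F p d)%R.
Proof. unfold crossing. replace (p + d + - d) with p by ring. ring. Qed.

(** The signed crossings around the tile between the two ties cancel. If the ties had different
    crossings, so would the other two sides, and [e] and [f] would both be plus or minus [sdir F'],
    hence parallel. *)
Lemma crossing_next_tie F F' n :
  crossing F' (spos F n) (sdir F) = crossing F' (spos F (n + 1)%Z) (sdir F).
Proof.
  destruct (strip_tile L F n) as (i & Fr & Hs).
  set (u := spos F n) in *. set (u' := spos F (n + 1)%Z) in *.
  set (e := sdir F) in *. set (f := u' - u) in *.
  assert (E1 := frame_edge L _ _ _ _ Fr).
  assert (E2 := frame_edge L _ _ _ _ (frame_flip2 _ _ _ _ Fr)).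
  assert (E3 := frame_edge L _ _ _ _ (frame_swap _ _ _ _ Fr)).
  assert (E4 := frame_edge L _ _ _ _ (frame_swap _ _ _ _ (frame_flip _ _ _ _ Fr))).
  replace (u + f) with u' in E2 by (unfold f; ring).
  apply NNPP; intros D.
  assert (Cyc : (crossing F' u e + crossing F' (u + e) f
                 = crossing F' u f + crossing F' u' e)%R).
  { unfold crossing. replace (u + e + f) with (u' + e) by (unfold f; ring).
    replace (u + f) with u' by (unfold f; ring). ring. }
  assert (De : e = sdir F' \/ e = - sdir F').
  { destruct (Req_dec (crossing F' u e) 0) as [Z|Z].
    - destruct (crossing_tie L F' u' e E2) as (m & [[_ H]|[_ H]]); auto; lra.
    - destruct (crossing_tie L F' u e E1) as (m & [[_ H]|[_ H]]); auto; lra. }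
  assert (Df : f = sdir F' \/ f = - sdir F').
  { destruct (Req_dec (crossing F' u f) 0) as [Z|Z].
    - destruct (crossing_tie L F' (u + e) f E4) as (m & [[_ H]|[_ H]]); auto; lra.
    - destruct (crossing_tie L F' u f E3) as (m & [[_ H]|[_ H]]); auto; lra. }
  assert (Hp := sine_pos L). rewrite <- Hs in Hp.
  destruct De as [-> | ->], Df as [-> | ->];
    rewrite ?cross_opp_l, ?cross_opp, cross_self in Hp; lra.
Qed.

Lemma crossing_same_strip F F' n m :
  crossing F' (spos F n) (sdir F) = crossing F' (spos F m) (sdir F).
Proof.
  transitivity (crossing F' (spos F 0) (sdir F)); [|symmetry];
    [revert n|revert m]; apply Z.bi_induction; auto; try (intros x y ->; tauto);
    intros x; rewrite (crossing_next_tie F F' x), <- Z.add_1_r; tauto.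
Qed.

Fixpoint steps (a : C) (l : list C) : list (C * C) :=
  match l with
  | nil => nil
  | d :: l' => (a, d) :: steps (a + d) l'
  end.

Definition crossing_sum F (m : list (C * C)) : R :=
  fold_right (fun pd r => crossing F (fst pd) (snd pd) + r)%R 0%R m.

Lemma crossing_sum_app F m m' :
  crossing_sum F (m ++ m') = (crossing_sum F m + crossing_sum F m')%R.
Proof. induction m as [|x m IH]; simpl; [|rewrite IH]; ring. Qed.

Lemma crossing_sum_neg F m : (crossing_sum F m < 0)%R ->
  exists p d, In (p, d) m /\ (crossing F p d < 0)%R.
Proof.
  induction m as [|[p d] m IH]; simpl; [lra|]. intros H.
  destruct (Rlt_le_dec (crossing F p d) 0); [eauto|].
  destruct IH as (p' & d' & A & B); [lra|eauto].
Qed.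

(** Removing two steps that are not adjacent destroys a walk. What survives is that the remaining
    steps are edges and that every strip has crossing sum zero; the induction in [balanced_fold]
    runs on this. *)
Definition balanced (m : list (C * C)) : Prop :=
  (forall p d, In (p, d) m -> edge L p (p + d)) /\
  forall F, crossing_sum F m = 0%R.

Lemma walk_balanced a l : walk L a l a -> balanced (steps a l).
Proof.
  assert (K : forall b, walk L a l b ->
     (forall p d, In (p, d) (steps a l) -> edge L p (p + d)) /\
     forall F, crossing_sum F (steps a l) = (beyond F b - beyond F a)%R).
  { intros b. induction 1 as [|a d l b H W [IH1 IH2]]; simpl.
    - split; [tauto|]; intros; ring.
    - split.
      + intros p d' [E|E]; auto. apply pair_equal_spec in E. destruct E; subst; auto.
      + intros F. rewrite IH2. unfold crossing. ring. }
  intros W. destruct (K a W) as [A B]. split; auto. intros F; rewrite B; ring.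
Qed.

Section Fold.

Variables (X : Type) (T : C -> X -> X).
Hypothesis T_comm : forall d d' x, T d (T d' x) = T d' (T d x).
Hypothesis T_opp : forall d x, T (- d) (T d x) = x.

(** It is applied to [step], to make the values [z^(n)] independent of the path, and to translation
    by the sign of a cross product, to compare lengths in [shortcut_up]. *)
Definition fold_steps (l : list C) (x : X) : X := fold_left (fun y d => T d y) l x.

Lemma fold_steps_app l l' x : fold_steps (l ++ l') x = fold_steps l' (fold_steps l x).
Proof. apply fold_left_app. Qed.

Lemma fold_steps_comm l d x : fold_steps l (T d x) = T d (fold_steps l x).
Proof.
  revert x. induction l as [|d' l IH]; intros x; simpl; auto.
  rewrite T_comm. apply IH.
Qed.

(* A strip is crossed equally often in both directions, so the steps cancel in
   pairs. *)
Lemma balanced_fold m : balanced m -> forall x, fold_steps (map snd m) x = x.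
Proof.
  remember (length m) as n eqn:En. revert m En.
  induction n as [n IH] using lt_wf_ind. intros m -> [Hm Hs] x.
  destruct m as [|[p d] m]; auto.
  destruct (strip_through_edge L p (p + d)) as (F & Ed & Ep); [apply Hm; simpl; auto|].
  replace (p + d - p) with d in Ed by ring.
  assert (H1 : crossing F p d = 1%R) by (rewrite <- Ed, <- Ep; apply crossing_of_tie).
  destruct (crossing_sum_neg F m) as (p' & d' & Hin & Hneg).
  { generalize (Hs F). simpl. lra. }
  destruct (crossing_tie L F p' d') as (k & [[E1 E2]|[E1 E2]]); [|lra| |].
  - apply Hm; simpl; auto.
  - exfalso. rewrite E1, E2, crossing_of_tie in Hneg. lra.
  - destruct (in_split _ _ Hin) as (m1 & m2 & ->).
    simpl. rewrite map_app, fold_steps_app. simpl.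
    change (fold_steps (map snd m2) (T d' (fold_steps (map snd m1) (T d x))) = x).
    rewrite !fold_steps_comm, E2, Ed, T_opp, <- fold_steps_app, <- map_app.
    apply (IH (length (m1 ++ m2))); auto.
    + simpl. rewrite !length_app. simpl. lia.
    + split.
      * intros q c Hq. apply Hm. simpl. right. apply in_app_iff. apply in_app_iff in Hq.
        simpl; tauto.
      (* The removed steps pass two ties of [F] in opposite directions, and [F'] counts all ties of
         [F] alike, so together they contribute zero. *)
      * intros F'. assert (H := Hs F'). simpl in H.
        rewrite crossing_sum_app in *. simpl in H.
        rewrite E1, E2, crossing_back, <- Ed, <- Ep in H.
        rewrite (crossing_same_strip F F' k 0) in H. lra.
Qed.

Lemma closed_walk_fold a l x : walk L a l a -> fold_steps l x = x.
Proof.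
  intros W. assert (E : l = map snd (steps a l)).
  { clear W. revert a. induction l as [|d l IH]; simpl; intros; f_equal; auto. }
  rewrite E. apply balanced_fold, walk_balanced, W.
Qed.

Lemma walks_fold a b l l' x : walk L a l b -> walk L a l' b ->
  fold_steps l x = fold_steps l' x.
Proof.
  intros W W'.
  assert (K : forall m y, fold_steps m (fold_steps (rev (map Copp m)) y) = y).
  { induction m as [|d m IH]; intros y; simpl; auto.
    rewrite fold_steps_app. simpl.
    change (fold_steps m (T d (T (- d) (fold_steps (rev (map Copp m)) y))) = y).
    replace d with (- - d) at 1 by ring. rewrite T_opp. apply IH. }
  assert (C0 : fold_steps (rev (map Copp l')) (fold_steps l x) = x).
  { rewrite <- fold_steps_app. apply (closed_walk_fold a).
    eapply walk_app; [exact W|apply walk_rev, W']. }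
  rewrite <- C0 at 2. symmetry. apply K.
Qed.

End Fold.

(** The two boundary lines of a strip are translates of each other by [sdir F], so one list of steps
    serves both. That all its steps rise is what bounds its length later. *)
Lemma strip_walk F n (k : nat) : exists l, walk L (spos F n) l (spos F (n + Z.of_nat k)) /\
  walk L (spos F n + sdir F) l (spos F (n + Z.of_nat k) + sdir F) /\
  forall d, In d l -> (0 < cross (sdir F) d)%R.
Proof.
  induction k as [|k (l & W & W' & Hl)].
  - exists nil. simpl. replace (n + 0)%Z with n by lia.
    repeat split; try constructor; simpl; tauto.
  - set (m := (n + Z.of_nat k)%Z) in *.
    replace (n + Z.of_nat (S k))%Z with (m + 1)%Z by (unfold m; lia).
    destruct (strip_tile L F m) as (i & Fr & Hc).
    exists (l ++ [spos F (m + 1)%Z - spos F m]). repeat split.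
    + eapply walk_app; [exact W|]. apply walk_edge.
      apply frame_swap, frame_edge in Fr.
      replace (spos F (m + 1)%Z) with (spos F m + (spos F (m + 1)%Z - spos F m)) by ring; auto.
    + eapply walk_app; [exact W'|].
      apply frame_flip, frame_swap, frame_edge in Fr.
      replace (spos F (m + 1)%Z - spos F m)
        with (spos F (m + 1)%Z + sdir F - (spos F m + sdir F)) by ring.
      apply walk_edge.
      replace (spos F (m + 1)%Z + sdir F)
        with (spos F m + sdir F + (spos F (m + 1)%Z - spos F m)) by ring; auto.
    + intros d Hd. apply in_app_iff in Hd. destruct Hd as [Hd|[<-|[]]]; auto.
      rewrite Hc. apply sine_pos.
Qed.

Lemma beyond_constant F a l b : walk L a l b ->
  ~ In (sdir F) l -> ~ In (- sdir F) l -> beyond F a = beyond F b.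
Proof.
  induction 1 as [|a d l b H W IH]; simpl; auto. intros H1 H2.
  rewrite <- IH by tauto.
  destruct (Req_dec (crossing F a d) 0) as [Z|Z]; [unfold crossing in Z; lra|].
  destruct (crossing_tie L F a d H Z) as (n & [[_ E]|[_ E]]); tauto.
Qed.

(** The last two hypotheses say that the left side of [F'] is not to the left of that of [F] at the
    height of [spos F' 0], and the other way round at the height of [spos F 0]. So the left sides
    agree at some height in between, where both strips contain the same point, and a tile or a tie
    through it belongs to both. *)
Lemma strips_meet F F' : sdir F' = sdir F ->
  (cross (sdir F) (spos F 0) <= cross (sdir F) (spos F' 0))%R ->
  (1 <= offset L F (spos F' 0 + sdir F))%R -> (1 <= offset L F' (spos F 0 + sdir F))%R ->
  exists n m : Z, (0 <= n)%Z /\ (m <= 0)%Z /\ spos F n = spos F' m.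
Proof.
  intros Hd Hy H1 H2. set (e := sdir F) in *.
  assert (Hs := sine_pos L).
  assert (He : Cmod e = 1%R) by apply sdir_unit.
  replace (spos F' 0 + e) with (spos F' 0 + RtoC 1 * e) in H1 by ring.
  replace (spos F 0 + e) with (spos F 0 + RtoC 1 * e) in H2 by ring.
  unfold e in H1. rewrite offset_shift in H1.
  rewrite <- Hd, offset_shift in H2.
  assert (Z1 := offset_tie L F 0). assert (Z2 := offset_tie L F' 0).
  unfold offset in H1, H2, Z1, Z2. rewrite Hd in *. fold e in H1, H2, Z1, Z2.
  destruct (IVT_gen (fun y => left_side L F y - left_side L F' y)%R
     (cross e (spos F 0)) (cross e (spos F' 0)) 0) as (y & Y1 & Y2).
  - apply (lipschitz_continuity _ (2 * / sine L)). intros r t.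
    replace (left_side L F r - left_side L F' r - (left_side L F t - left_side L F' t))%R
      with ((left_side L F r - left_side L F t) + - (left_side L F' r - left_side L F' t))%R by ring.
    eapply Rle_trans; [apply Rabs_triang|]. rewrite Rabs_Ropp.
    generalize (left_side_lipschitz L F r t), (left_side_lipschitz L F' r t). lra.
  - rewrite Rmin_right, Rmax_left; lra.
  - rewrite Rmin_left, Rmax_right in Y1 by lra.
    (* The point at height [y] halfway across both strips; [Ci * e] is the unit vector of the
       height. *)
    set (x := (left_side L F y + 1/2)%R * e + y * (Ci * e)).
    assert (Ei : cross e (Ci * e) = 1%R).
    { replace 1%R with (Cmod e * Cmod e)%R by (rewrite He; ring).
      rewrite Cmod_sqr; unfold cross, Re, Im; simpl; ring. }
    assert (Di : dot e (Ci * e) = 0%R) by (unfold dot, Re, Im; simpl; ring).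
    assert (Xc : cross e x = y).
    { unfold x. rewrite cross_plus, !cross_scal, cross_self, Ei. ring. }
    assert (Xd : dot e x = (left_side L F y + 1 / 2)%R).
    { unfold x. rewrite dot_plus, !dot_scal, dot_self, Di, He. ring. }
    assert (O1 : offset L F x = (1/2)%R).
    { unfold offset. fold e. rewrite Xc, Xd. ring. }
    assert (O2 : offset L F' x = (1/2)%R).
    { unfold offset. rewrite Hd. rewrite Xc, Xd. lra. }
    destruct (strip_point L F x) as (n & t & Ht & X1 & L1).
    destruct (strip_point L F' x) as (m & t' & Ht' & X2 & L2).
    rewrite O1 in X1. rewrite O2 in X2. rewrite Hd in *. fold e in X1, X2, L1, L2.
    rewrite Xc in L1, L2.
    destruct (strip_tile L F n) as (i & F1 & C1).
    destruct (strip_tile L F' m) as (j & F2 & C2).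
    rewrite Hd in *. fold e in F1, F2, C1, C2.
    set (f := spos F (n + 1)%Z - spos F n) in *.
    set (f' := spos F' (m + 1)%Z - spos F' m) in *.
    exists n, m. split; [|split].
    + assert (0 <= IZR n + t)%R by nra. apply Z.lt_succ_r, lt_IZR. rewrite succ_IZR. lra.
    + assert (IZR m + t' <= 0)%R by nra. apply le_IZR. lra.
    + assert (Hr : region (tile L j) (spos F n + RtoC (1 / 2) * e + t * f)).
      { rewrite <- X1, X2. apply (frame_region _ _ _ _ F2).
        rewrite coord1_val, coord2_val by apply F2. lra. }
      destruct (tile_through L i j _ _ _ (1/2) t F1) as [<-|[Ht0 S]]; auto; try lra.
      (* One tile in two frames with the same first side [e] and with positive [cross]: both start
         at its lower left corner, since any other corner contradicts heights or positions along
         [e]. *)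
      * assert (A : In (spos F' m) (corners (tile L i)))
          by (apply (frame_corners _ _ _ _ F2); auto).
        assert (B : In (spos F n) (corners (tile L i)))
          by (apply (frame_corners _ _ _ _ F1); auto).
        apply (frame_corners _ _ _ _ F1) in A. apply (frame_corners _ _ _ _ F2) in B.
        assert (A1 := f_equal (cross e)). assert (A2 := f_equal (dot e)).
        assert (D1 : dot e e = 1%R) by (rewrite dot_self, He; ring).
        destruct A as [A|[A|[A|A]]]; auto; destruct B as [B|[B|[B|B]]]; auto; exfalso;
        generalize (A1 _ _ A), (A1 _ _ B), (A2 _ _ A), (A2 _ _ B);
        rewrite ?cross_plus, ?dot_plus, ?cross_self, ?C1, ?C2, ?D1; lra.
      * assert (t = 0%R) by lra. subst t.
        replace (spos F n + RtoC 0 * f) with (spos F n) in S by ring.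
        destruct (side_through _ _ _ _ (1/2) t' _ _ F2 ltac:(lra) S) as [A B].
        { rewrite <- X2, X1. exists (1/2)%R. split; [lra|]. ring. }
        assert (t' = 0%R) by lra. subst t'.
        replace (spos F' m + RtoC 0 * f') with (spos F' m) in B by ring.
        destruct B as [[B _]|[B B']]; auto. exfalso.
        rewrite <- B in B'. apply (f_equal (dot e)) in B'.
        rewrite !dot_plus, dot_self, He in B'. lra.
Qed.

Lemma sign_bound r : (sign r <= 1)%R.
Proof.
  destruct (total_order_T r 0) as [[H|H]|H].
  - rewrite sign_eq_m1; lra.
  - rewrite H, sign_0; lra.
  - rewrite sign_eq_1; lra.
Qed.

(** The walk [l] uses neither [e] nor [- e], so it crosses neither the strip through [u] nor the one
    through [w], and these strips meet. The new walk follows the left side of the first strip up to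
    the common tie, then that of the second. By [walks_fold] the number of rising minus falling
    steps, relative to [e], is the same for all walks from [u + e] to [w + e]; it is the full length
    of the new list, whose steps all rise, and at most the length of [l]. *)
Lemma shortcut_up u w e l : edge L u (u + e) -> edge L w (w + e) ->
  (cross e u <= cross e w)%R ->
  walk L (u + e) l (w + e) -> ~ In e l -> ~ In (- e) l ->
  exists l', walk L u l' w /\ (length l' <= length l)%nat.
Proof.
  intros Hu Hw Hy W N1 N2.
  destruct (strip_through_edge L _ _ Hu) as (F & Ed & Ep).
  destruct (strip_through_edge L _ _ Hw) as (F' & Ed' & Ep').
  replace (u + e - u) with e in Ed by ring. replace (w + e - w) with e in Ed' by ring.
  subst e u w.
  assert (B1 := beyond_constant F _ _ _ W N1 N2).
  rewrite <- Ed' in N1, N2.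
  assert (B2 := beyond_constant F' _ _ _ W N1 N2).
  rewrite beyond_tie_end in B1.
  rewrite <- Ed' in B2. rewrite beyond_tie_end in B2. rewrite Ed' in B2.
  destruct (strips_meet F F') as (n & m & Hn & Hm & E); auto.
  { unfold beyond in B1. destruct Rle_dec; lra. }
  { unfold beyond in B2. destruct Rle_dec; lra. }
  destruct (strip_walk F 0 (Z.to_nat n)) as (l1 & W1 & W1' & P1).
  destruct (strip_walk F' m (Z.to_nat (- m))) as (l2 & W2 & W2' & P2).
  replace (0 + Z.of_nat (Z.to_nat n))%Z with n in * by lia.
  replace (m + Z.of_nat (Z.to_nat (- m)))%Z with 0%Z in * by lia.
  rewrite Ed' in *. rewrite <- E in W2, W2'.
  exists (l1 ++ l2). split; [eapply walk_app; eauto|].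
  assert (W3 : walk L (spos F 0 + sdir F) (l1 ++ l2) (spos F' 0 + sdir F))
    by (eapply walk_app; eauto).
  assert (Ef := walks_fold R (fun d x => x + sign (cross (sdir F) d))%R
     ltac:(intros; simpl; ring)
     ltac:(intros; simpl; rewrite cross_opp, sign_opp; ring)
     _ _ _ _ 0%R W3 W).
  assert (U : forall l r, (fold_steps R (fun d x => x + sign (cross (sdir F) d)) l r
        <= r + INR (length l))%R).
  { intros l0. induction l0 as [|d l0 IH]; intros r; [simpl; lra|].
    simpl length. rewrite S_INR. simpl. eapply Rle_trans; [apply IH|].
    generalize (sign_bound (cross (sdir F) d)). lra. }
  assert (V : forall l r, (forall d, In d l -> (0 < cross (sdir F) d)%R) ->
     (fold_steps R (fun d x => x + sign (cross (sdir F) d)) l r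
        = r + INR (length l))%R).
  { intros l0. induction l0 as [|d l0 IH]; intros r P; [simpl; lra|].
    simpl length. rewrite S_INR. simpl. fold (fold_steps R).
    change (fold_steps R (fun d x => x + sign (cross (sdir F) d))%R l0
      (r + sign (cross (sdir F) d)) = r + (INR (length l0) + 1))%R.
    rewrite IH by (intros; apply P; simpl; auto).
    rewrite sign_eq_1 by (apply P; simpl; auto). lra. }
  rewrite V in Ef.
  - apply INR_le. generalize (U l 0%R). lra.
  - intros d Hd. apply in_app_iff in Hd. destruct Hd; auto.
Qed.

Lemma shortcut u w e l : edge L u (u + e) -> edge L w (w + e) ->
  walk L (u + e) l (w + e) -> ~ In e l -> ~ In (- e) l ->
  exists l', walk L u l' w /\ (length l' <= length l)%nat.
Proof.
  intros Hu Hw W N1 N2. destruct (Rle_lt_dec (cross e u) (cross e w)) as [D|D].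
  - eapply shortcut_up; eauto.
  - destruct (shortcut_up w u e (rev (map Copp l))) as (l' & W' & Hl'); auto.
    + lra.
    + apply walk_rev, W.
    + intros H. apply N2. apply in_rev, in_map_iff in H. destruct H as (x & <- & H).
      replace (- - x) with x by ring; auto.
    + intros H. apply N1. apply in_rev, in_map_iff in H. destruct H as (x & E & H).
      replace e with x; auto. replace x with (- - x) by ring. rewrite E. ring.
    + exists (rev (map Copp l')). split; [apply walk_rev, W'|].
      rewrite length_rev, length_map in *. auto.
Qed.

Lemma shortest_walk_no_opposite a l b : walk L a l b ->
  (forall l', walk L a l' b -> (length l <= length l')%nat) ->
  forall l1 d l2 l3, l <> l1 ++ d :: l2 ++ - d :: l3.
Proof.
  intros W Hmin l1 d l2. remember (length l2) as n eqn:En.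
  revert l1 d l2 En. induction n as [n IH] using lt_wf_ind.
  intros l1 d l2 -> l3 E.
  destruct (classic (In d l2)) as [H1|H1].
  { destruct (in_split _ _ H1) as (m1 & m2 & ->).
    apply (IH (length m2) ltac:(rewrite length_app; simpl; lia)
      (l1 ++ d :: m1) d m2 eq_refl l3). rewrite E, <- !app_assoc. reflexivity. }
  destruct (classic (In (- d) l2)) as [H2|H2].
  { destruct (in_split _ _ H2) as (m1 & m2 & ->).
    apply (IH (length m1) ltac:(rewrite length_app; simpl; lia)
      l1 d m1 eq_refl (m2 ++ - d :: l3)). rewrite E, <- !app_assoc. reflexivity. }
  rewrite E in W. destruct (walk_split L _ _ _ _ W) as (u & U1 & U2).
  inversion U2 as [|? ? ? ? E1 U3]; subst.
  destruct (walk_split L _ _ _ _ U3) as (w & V1 & V2).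
  inversion V2 as [|? ? ? ? E2 V3]; subst.
  destruct (shortcut u (w + - d) d l2) as (l' & W' & Hl'); auto.
  - replace (w + - d + d) with w by ring. apply edge_sym; auto.
  - replace (w + - d + d) with w by ring. auto.
  - assert (K := Hmin _ (walk_app L _ _ _ _ _ U1 (walk_app L _ _ _ _ _ W' V3))).
    rewrite !length_app in K. simpl in K. rewrite !length_app in K. simpl in K. lia.
Qed.

End ClosedWalks.

(** * Complex series *)

Notation Cis_series := (is_series (V := C_NormedModule)).

Lemma Csum_n (u : nat -> C) n :
  sum_n (G := C_AbelianMonoid) u n = (sum_n (fun k => Re (u k)) n, sum_n (fun k => Im (u k)) n).
Proof.
  induction n as [|n IH].
  - rewrite !sum_O. destruct (u 0%nat); reflexivity.
  - rewrite !sum_Sn, IH. reflexivity.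
Qed.

Lemma Cis_series_iff (u : nat -> C) (l : C) : Cis_series u l <->
  is_series (fun n => Re (u n)) (Re l) /\ is_series (fun n => Im (u n)) (Im l).
Proof.
  unfold is_series. split.
  - intros H. split.
    + apply (filterlim_ext (fun n => fst (sum_n (G := C_AbelianMonoid) u n))).
      { intros n; rewrite Csum_n; reflexivity. }
      eapply filterlim_comp; [exact H|].
      intros P [eps HP]. exists eps. intros y [Hy _]. apply HP, Hy.
    + apply (filterlim_ext (fun n => snd (sum_n (G := C_AbelianMonoid) u n))).
      { intros n; rewrite Csum_n; reflexivity. }
      eapply filterlim_comp; [exact H|].
      intros P [eps HP]. exists eps. intros y [_ Hy]. apply HP, Hy.
  - intros [H1 H2] P [eps HP].
    assert (A := H1 _ (locally_ball _ eps)). assert (B := H2 _ (locally_ball _ eps)).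
    destruct A as [N1 A], B as [N2 B]. exists (Nat.max N1 N2). intros n Hn.
    apply HP. rewrite Csum_n. split; [apply A|apply B]; lia.
Qed.

Lemma Cseries_unique (u : nat -> C) (l : C) : Cis_series u l -> Cseries u = l.
Proof.
  intros H. apply Cis_series_iff in H. destruct H as [H1 H2].
  unfold Cseries. rewrite (is_series_unique _ _ H1), (is_series_unique _ _ H2).
  destruct l; reflexivity.
Qed.

Lemma Cseries_correct (u : nat -> C) : ex_series (fun n => Cmod (u n)) ->
  Cis_series u (Cseries u).
Proof.
  intros H. apply Cis_series_iff. unfold Cseries; simpl. split; apply Series_correct.
  - apply (ex_series_le (V := R_CompleteNormedModule)) with (2 := H).
    intros n. apply re_le_Cmod.
  - apply (ex_series_le (V := R_CompleteNormedModule)) with (2 := H).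
    intros n. eapply Rle_trans; [|apply Rmax_Cmod]. apply Rmax_r.
Qed.

Lemma Cseries_ext (u w : nat -> C) : (forall n, u n = w n) -> Cseries u = Cseries w.
Proof. intros H. unfold Cseries. f_equal; apply Series_ext; intros; rewrite H; auto. Qed.

Lemma Cseries_plus (u w : nat -> C) : ex_series (fun n => Cmod (u n)) ->
  ex_series (fun n => Cmod (w n)) -> Cseries (fun n => u n + w n) = Cseries u + Cseries w.
Proof.
  intros H1 H2. apply Cseries_unique.
  apply (is_series_plus (V := C_NormedModule)); apply Cseries_correct; auto.
Qed.
Lemma Cseries_scal (k : C) (u : nat -> C) : ex_series (fun n => Cmod (u n)) ->
  Cseries (fun n => k * u n) = k * Cseries u.
Proof.
  intros H1. apply Cseries_unique.
  apply (is_series_scal (V := C_NormedModule)); apply Cseries_correct; auto.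
Qed.
Lemma Cseries_incr (u : nat -> C) : ex_series (fun n => Cmod (u n)) ->
  Cseries u = u 0%nat + Cseries (fun n => u (S n)).
Proof.
  intros H. apply Cseries_unique.
  apply (is_series_decr_1 (V := C_NormedModule)).
  match goal with |- is_series _ ?x => replace x with (Cseries (fun n => u (S n))) end.
  - apply Cseries_correct. apply (ex_series_incr_1 (fun n => Cmod (u n))), H.
  - change (Cseries (fun n => u (S n)) = u 0%nat + Cseries (fun n => u (S n)) + - u 0%nat). ring.
Qed.
Lemma Cseries_le (u : nat -> C) (w : nat -> R) : (forall n, (Cmod (u n) <= w n)%R) ->
  ex_series w -> (Cmod (Cseries u) <= Series w)%R.
Proof.
  intros H Hw.
  assert (Hu : ex_series (fun n => Cmod (u n))).
  { apply (ex_series_le (V := R_CompleteNormedModule)) with (2 := Hw).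
    intros n. simpl. rewrite Rabs_pos_eq; auto using Cmod_ge_0. }
  assert (A := Cseries_correct u Hu).
  assert (B := Series_correct _ Hw).
  apply (is_lim_seq_le (fun n => Cmod (sum_n (G := C_AbelianMonoid) u n)) (fun n => sum_n w n)
    (Cmod (Cseries u)) (Series w)).
  - intros n. induction n as [|n IH].
    + rewrite !sum_O. apply H.
    + rewrite !sum_Sn. eapply Rle_trans; [apply Cmod_triangle|].
      apply Rplus_le_compat; auto.
  - apply (filterlim_comp _ _ _ (sum_n (G := C_AbelianMonoid) u) Cmod eventually
      (locally (T := C_UniformSpace) (Cseries u))); [exact A|].
    apply (filterlim_norm (V := C_NormedModule)).
  - exact B.
Qed.

(* Coquelicot states equalities of series in the carrier of [R_NormedModule], which
   [ring] does not recognise. *)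
Ltac Req := match goal with |- ?a = ?b => change (@eq R a b) end.

(** * Pairing of sequences *)

(** On power series [delay] is multiplication by [t]; its transpose under [pairing] is [advance]. *)
Definition delay (c : nat -> C) (n : nat) : C := match n with 0%nat => 0 | S m => c m end.
Definition advance (c : nat -> C) (n : nat) : C := c (S n).
Definition lin (x : C) (c : nat -> C) (y : C) (d : nat -> C) (n : nat) : C := x * c n + y * d n.
Definition unit_seq (n : nat) : C := match n with 0%nat => 1 | _ => 0 end.

Definition pairing (zeta c : nat -> C) : C := Cseries (fun n => zeta n * c n).

Section Growth.

Variable r : R.
Hypothesis Hr : (1 < r)%R.

(** [grow] is meant for the values [z^(n)] at a vertex, [adm] for coefficients. Together they make a
    pairing absolutely convergent. *)
Definition grow (zeta : nat -> C) : Prop :=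
  exists K : R, forall n, (Cmod (zeta n) <= K * r ^ n)%R.
Definition adm (c : nat -> C) : Prop := ex_series (fun n => Cmod (c n) * r ^ n)%R.

Lemma pow_r_pos n : (0 < r ^ n)%R.
Proof. apply pow_lt; lra. Qed.

Lemma grow_K zeta : grow zeta ->
  exists K : R, (0 <= K)%R /\ forall n, (Cmod (zeta n) <= K * r ^ n)%R.
Proof.
  intros [K H]. exists K; split; auto.
  generalize (H 0%nat), (Cmod_ge_0 (zeta 0%nat)); simpl; lra.
Qed.

Lemma pairing_summable zeta c : grow zeta -> adm c ->
  ex_series (fun n => Cmod (zeta n * c n)).
Proof.
  intros [K HK] Hc.
  apply (ex_series_le (V := R_CompleteNormedModule) _ (fun n => K * (Cmod (c n) * r ^ n))%R).
  - intros n. simpl. rewrite Rabs_pos_eq by apply Cmod_ge_0. rewrite Cmod_mult.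
    generalize (HK n), (Cmod_ge_0 (c n)). intros A B.
    apply Rmult_le_compat_r with (r := Cmod (c n)) in A; auto. lra.
  - apply (ex_series_scal (V := R_NormedModule) K), Hc.
Qed.

Lemma grow_lin x zeta y eta : grow zeta -> grow eta -> grow (lin x zeta y eta).
Proof.
  intros [K H] [K' H']. exists (Cmod x * K + Cmod y * K')%R. intros n. unfold lin.
  eapply Rle_trans; [apply Cmod_triangle|]. rewrite !Cmod_mult, Rmult_plus_distr_r, !Rmult_assoc.
  apply Rplus_le_compat; apply Rmult_le_compat_l; auto using Cmod_ge_0.
Qed.
Lemma grow_advance zeta : grow zeta -> grow (advance zeta).
Proof. intros [K H]. exists (K * r)%R. intros n. rewrite Rmult_assoc. apply H. Qed.
Lemma grow_unit : grow unit_seq.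
Proof.
  exists 1%R. intros [|n]; simpl; rewrite ?Cmod_0, ?Cmod_1; [lra|].
  generalize (pow_r_pos n); nra.
Qed.
Lemma grow_geom a : (Cmod a <= 1)%R -> grow (fun n => a ^ n).
Proof.
  intros Ha. exists 1%R. intros n. rewrite Cmod_pow, Rmult_1_l.
  apply pow_incr. split; [apply Cmod_ge_0|lra].
Qed.

Lemma adm_lin x c y d : adm c -> adm d -> adm (lin x c y d).
Proof.
  intros Hc Hd.
  apply (ex_series_le (V := R_CompleteNormedModule) _
    (fun n => Cmod x * (Cmod (c n) * r ^ n) + Cmod y * (Cmod (d n) * r ^ n))%R).
  - intros n. simpl. assert (A := pow_r_pos n).
    rewrite Rabs_pos_eq by (apply Rmult_le_pos; [apply Cmod_ge_0|lra]).
    unfold lin. rewrite <- !Rmult_assoc, <- Rmult_plus_distr_r.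
    apply Rmult_le_compat_r; [lra|]. rewrite <- !Cmod_mult. apply Cmod_triangle.
  - apply (ex_series_plus (V := R_NormedModule)); apply (ex_series_scal (V := R_NormedModule)); auto.
Qed.
Lemma adm_delay c : adm c -> adm (delay c).
Proof.
  intros H. apply ex_series_incr_1. simpl.
  apply (ex_series_ext (fun n => r * (Cmod (c n) * r ^ n))%R).
  - intros n. Req. ring.
  - apply (ex_series_scal (V := R_NormedModule) r), H.
Qed.
Lemma adm_advance c : adm c -> adm (advance c).
Proof.
  intros H. apply ex_series_incr_1 in H. simpl in H.
  apply (ex_series_ext (fun n => / r * (Cmod (c (S n)) * (r * r ^ n)))%R).
  - intros n. Req. unfold advance. field. lra.
  - apply (ex_series_scal (V := R_NormedModule) (Rinv r)), H.
Qed.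
Lemma adm_geom a : (r * Cmod a < 1)%R -> adm (fun n => a ^ n).
Proof.
  intros H. apply (ex_series_ext (fun n => (r * Cmod a) ^ n)%R).
  - intros n. Req. rewrite Cmod_pow, Rpow_mult_distr. ring.
  - apply ex_series_geom. rewrite Rabs_pos_eq; auto.
    apply Rmult_le_pos; [lra|apply Cmod_ge_0].
Qed.
Lemma adm_unit : adm unit_seq.
Proof.
  apply ex_series_incr_1. apply (ex_series_ext (fun n => 0 ^ n * 0)%R).
  - intros n. simpl. Req. rewrite Cmod_0. ring.
  - apply ex_series_scal_r, ex_series_geom. rewrite Rabs_R0; lra.
Qed.

Lemma pairing_lin_r zeta x c y d : grow zeta -> adm c -> adm d ->
  pairing zeta (lin x c y d) = x * pairing zeta c + y * pairing zeta d.
Proof.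
  intros Hz Hc Hd. assert (A := pairing_summable _ _ Hz Hc).
  assert (B := pairing_summable _ _ Hz Hd). unfold pairing.
  rewrite <- !Cseries_scal by auto.
  assert (M : forall (k : C) w, ex_series (fun n => Cmod (w n)) -> ex_series (fun n => Cmod (k * w n))).
  { intros k w Hw. apply (ex_series_ext (fun n => Cmod k * Cmod (w n))%R).
    - intros; rewrite Cmod_mult; auto.
    - apply (ex_series_scal (V := R_NormedModule)); auto. }
  rewrite <- Cseries_plus; auto.
  apply Cseries_ext. intros n. unfold lin. ring.
Qed.

Lemma pairing_lin_l x zeta y eta c : grow zeta -> grow eta -> adm c ->
  pairing (lin x zeta y eta) c = x * pairing zeta c + y * pairing eta c.
Proof.
  intros Hz Hc Hd. assert (A := pairing_summable _ _ Hz Hd).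
  assert (B := pairing_summable _ _ Hc Hd). unfold pairing.
  rewrite <- !Cseries_scal by auto.
  assert (M : forall (k : C) w, ex_series (fun n => Cmod (w n)) -> ex_series (fun n => Cmod (k * w n))).
  { intros k w Hw. apply (ex_series_ext (fun n => Cmod k * Cmod (w n))%R).
    - intros; rewrite Cmod_mult; auto.
    - apply (ex_series_scal (V := R_NormedModule)); auto. }
  rewrite <- Cseries_plus; auto.
  apply Cseries_ext. intros n. unfold lin. ring.
Qed.

Lemma pairing_delay zeta c : grow zeta -> adm c ->
  pairing zeta (delay c) = pairing (advance zeta) c.
Proof.
  intros Hz Hc. unfold pairing.
  rewrite Cseries_incr by (apply (pairing_summable _ (delay c)); auto using adm_delay).
  simpl. rewrite Cmult_0_r, Cplus_0_l. reflexivity.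
Qed.

Lemma pairing_unit c : adm c -> pairing unit_seq c = c 0%nat.
Proof.
  intros Hc. unfold pairing.
  rewrite Cseries_incr by (apply pairing_summable; auto using grow_unit).
  rewrite (Cseries_ext (fun n => unit_seq (S n) * c (S n)) (fun n => 0 * (1 ^ n * advance c n)))
    by (intros; simpl; ring).
  rewrite Cseries_scal; [simpl; ring|].
  apply pairing_summable; [apply grow_geom; rewrite Cmod_1; lra|apply adm_advance; auto].
Qed.

(** Needed for the product with a Blaschke factor, where the values of the iterated shifts of the
    factor at a vertex form such a sequence. *)
Lemma pairing_bound zeta c : grow zeta -> adm c ->
  grow (fun n => pairing (fun k => zeta (n + k)%nat) c).
Proof.
  intros Hz Hc. destruct (grow_K _ Hz) as (K & HK & H).
  exists (K * Series (fun k => Cmod (c k) * r ^ k))%R. intros n.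
  replace (K * Series (fun k => Cmod (c k) * r ^ k) * r ^ n)%R
    with (Series (fun k => (K * r ^ n) * (Cmod (c k) * r ^ k))%R).
  - apply Cseries_le.
    + intros k. rewrite Cmod_mult.
      replace (K * r ^ n * (Cmod (c k) * r ^ k))%R with (K * r ^ (n + k) * Cmod (c k))%R
        by (rewrite pow_add; ring).
      apply Rmult_le_compat_r; auto using Cmod_ge_0.
    + apply (ex_series_scal (V := R_NormedModule)), Hc.
  - rewrite Series_scal_l. ring.
Qed.

End Growth.

Ltac Rnorm := match goal with |- (norm ?x <= _)%R => change (norm x) with (Rabs x) end.

(** * Weighted square-summable sequences *)

Lemma ex_series_bounded (u : nat -> R) (B : R) : (forall n, (0 <= u n)%R) ->
  (forall n, (sum_n u n <= B)%R) -> ex_series u.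
Proof.
  intros Hu HB. destruct (ex_finite_lim_seq_incr (sum_n u) B) as [l Hl]; auto.
  - intros n. rewrite sum_Sn. change (sum_n u n <= sum_n u n + u (S n))%R.
    generalize (Hu (S n)); lra.
  - exists l. exact Hl.
Qed.
Lemma sum_n_le_Series (u : nat -> R) n : (forall n, (0 <= u n)%R) -> ex_series u ->
  (sum_n u n <= Series u)%R.
Proof.
  intros Hu He. apply (is_lim_seq_incr_compare (sum_n u)).
  - apply (Series_correct _ He).
  - intros k. rewrite sum_Sn. change (sum_n u k <= sum_n u k + u (S k))%R.
    generalize (Hu (S k)); lra.
Qed.
Lemma term_le_Series (u : nat -> R) n : (forall n, (0 <= u n)%R) -> ex_series u ->
  (u n <= Series u)%R.
Proof.
  intros Hu He. eapply Rle_trans; [|apply (sum_n_le_Series u n); auto].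
  destruct n as [|n]; [rewrite sum_O; lra|].
  rewrite sum_Sn. change (u (S n) <= sum_n u n + u (S n))%R.
  assert (0 <= sum_n u n)%R; [|lra].
  induction n as [|n IH]; [rewrite sum_O; auto|].
  rewrite sum_Sn. change (0 <= sum_n u n + u (S n))%R. generalize (Hu (S n)); lra.
Qed.

(** Convexity of the square, for the combination of [y] and [x / (1 - rho)] with weights [rho] and
    [1 - rho]. *)
Lemma contraction_sqr (rho x y : R) : (0 <= rho < 1)%R ->
  ((rho * y + x) ^ 2 <= rho * y ^ 2 + / (1 - rho) * x ^ 2)%R.
Proof.
  intros H.
  assert (E : (rho * y ^ 2 + / (1 - rho) * x ^ 2 - (rho * y + x) ^ 2
      = / (1 - rho) * (rho * ((1 - rho) * y - x) ^ 2))%R) by (field; lra).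
  assert (P : (0 <= / (1 - rho) * (rho * ((1 - rho) * y - x) ^ 2))%R).
  { apply Rmult_le_pos; [left; apply Rinv_0_lt_compat; lra|].
    apply Rmult_le_pos; [lra|apply pow2_ge_0]. }
  lra.
Qed.

(** Summed over [n], [contraction_sqr] lets the terms in [y] be absorbed with the factor [1 - rho].
    This governs division by [1 - c t], where each coefficient is computed from the previous one. *)
Lemma contraction_forward (rho : R) (x y : nat -> R) : (0 <= rho < 1)%R ->
  (forall n, (0 <= y n)%R) -> (y 0%nat <= x 0%nat)%R ->
  (forall n, (y (S n) <= rho * y n + x (S n))%R) ->
  ex_series (fun n => x n ^ 2)%R -> ex_series (fun n => y n ^ 2)%R.
Proof.
  intros Hrho Hy H0 HS Hx.
  set (K := (/ (1 - rho))%R).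
  assert (HK : (1 <= K)%R).
  { unfold K. rewrite <- Rinv_1. apply Rinv_le_contravar; lra. }
  assert (B : forall n, ((1 - rho) * sum_n (fun n => y n ^ 2)%R n + rho * y n ^ 2
       <= K * sum_n (fun n => x n ^ 2)%R n)%R).
  { induction n as [|n IH].
    - rewrite !sum_O. assert (y 0%nat ^ 2 <= x 0%nat ^ 2)%R.
      { apply pow_incr; split; auto. }
      generalize (pow2_ge_0 (x 0%nat)); nra.
    - rewrite !sum_Sn.
      change (plus (sum_n (fun n => y n ^ 2)%R n) (y (S n) ^ 2)%R)
        with (sum_n (fun n => y n ^ 2)%R n + (y (S n) ^ 2))%R.
      change (plus (sum_n (fun n => x n ^ 2)%R n) (x (S n) ^ 2)%R)
        with (sum_n (fun n => x n ^ 2)%R n + (x (S n) ^ 2))%R.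
      assert (A := contraction_sqr rho (x (S n)) (y n) Hrho). fold K in A.
      assert (y (S n) ^ 2 <= (rho * y n + x (S n)) ^ 2)%R.
      { apply pow_incr; split; auto. }
      lra. }
  apply (ex_series_bounded _ (K * (K * Series (fun n => x n ^ 2)))%R).
  - intros; apply pow2_ge_0.
  - intros n.
    assert (P : (sum_n (fun n => x n ^ 2) n <= Series (fun n => x n ^ 2))%R).
    { apply (sum_n_le_Series (fun n => x n ^ 2)%R); auto. intros; apply pow2_ge_0. }
    specialize (B n).
    assert (Q := pow2_ge_0 (y n)).
    apply Rmult_le_reg_l with (1 - rho)%R; [lra|].
    replace ((1 - rho) * (K * (K * Series (fun n => x n ^ 2))))%R
      with (K * Series (fun n => x n ^ 2))%R by (unfold K; field; lra).
    apply Rmult_le_compat_l with (r := K) in P; nra.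
Qed.

(** Here the recursion runs from [n + 1] down to [n], as in division by [t - a]. It has no starting
    value, so a bound [Y] known beforehand has to control the boundary term. *)
Lemma contraction_backward (rho Y : R) (x y : nat -> R) : (0 <= rho < 1)%R ->
  (forall n, (0 <= y n <= Y)%R) ->
  (forall n, (y n <= rho * y (S n) + x n)%R) ->
  ex_series (fun n => x n ^ 2)%R -> ex_series (fun n => y n ^ 2)%R.
Proof.
  intros Hrho Hy HS Hx.
  set (K := (/ (1 - rho))%R).
  assert (HK : (0 < K)%R) by (apply Rinv_0_lt_compat; lra).
  assert (B : forall n, ((1 - rho) * sum_n (fun n => y n ^ 2)%R n
       <= K * sum_n (fun n => x n ^ 2)%R n + rho * y (S n) ^ 2 - rho * y 0%nat ^ 2)%R).
  { assert (T : forall n, (y n ^ 2 <= rho * y (S n) ^ 2 + K * x n ^ 2)%R).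
    { intros n. eapply Rle_trans; [|apply contraction_sqr; auto].
      apply pow_incr; split; auto. apply Hy. }
    induction n as [|n IH].
    - rewrite !sum_O. generalize (T 0%nat). lra.
    - rewrite !sum_Sn.
      change (plus (sum_n (fun n => y n ^ 2)%R n) (y (S n) ^ 2)%R)
        with (sum_n (fun n => y n ^ 2)%R n + (y (S n) ^ 2))%R.
      change (plus (sum_n (fun n => x n ^ 2)%R n) (x (S n) ^ 2)%R)
        with (sum_n (fun n => x n ^ 2)%R n + (x (S n) ^ 2))%R.
      generalize (T (S n)). lra. }
  apply (ex_series_bounded _ (K * (K * Series (fun n => x n ^ 2) + Y ^ 2))%R).
  - intros; apply pow2_ge_0.
  - intros n.
    assert (P : (sum_n (fun n => x n ^ 2) n <= Series (fun n => x n ^ 2))%R).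
    { apply (sum_n_le_Series (fun n => x n ^ 2)%R); auto. intros; apply pow2_ge_0. }
    specialize (B n).
    assert (Q := pow2_ge_0 (y 0%nat)).
    assert (Q2 : (y (S n) ^ 2 <= Y ^ 2)%R) by (apply pow_incr; apply Hy).
    assert (Q3 := pow2_ge_0 (y (S n))).
    apply Rmult_le_reg_l with (1 - rho)%R; [lra|].
    replace ((1 - rho) * (K * (K * Series (fun n => x n ^ 2) + Y ^ 2)))%R
      with (K * Series (fun n => x n ^ 2) + Y ^ 2)%R by (unfold K; field; lra).
    apply Rmult_le_compat_l with (r := K) in P; nra.
Qed.

(* Operations on the power series [h(t) = sum h_n t^n]: multiplication by [t - a], and
   multiplication and division by [1 - c t]. *)
Definition mul_root (a : C) (h : nat -> C) : nat -> C := lin 1 (delay h) (- a) h.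
Definition mul_roots (l : list C) (h : nat -> C) : nat -> C := fold_right mul_root h l.
Definition mul_factor (c : C) (h : nat -> C) : nat -> C := lin 1 h (- c) (delay h).
Fixpoint div_factor (c : C) (g : nat -> C) (n : nat) : C :=
  match n with
  | 0%nat => g 0%nat
  | S m => c * div_factor c g m + g (S m)
  end.

Lemma mul_root_0 h : mul_root 0 h = delay h.
Proof. extensionality n. unfold mul_root, lin. ring. Qed.
Lemma mul_root_comm a b h : mul_root a (mul_root b h) = mul_root b (mul_root a h).
Proof. extensionality n. unfold mul_root, lin, delay. destruct n as [|[|n]]; ring. Qed.
Lemma mul_roots_comm a l h : mul_roots l (mul_root a h) = mul_root a (mul_roots l h).
Proof. induction l as [|b l IH]; simpl; auto. rewrite IH. apply mul_root_comm. Qed.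
Lemma mul_roots_app l l' h : mul_roots (l ++ l') h = mul_roots l (mul_roots l' h).
Proof. apply fold_right_app. Qed.
Lemma mul_factor_mul_root c a h : mul_factor c (mul_root a h) = mul_root a (mul_factor c h).
Proof. extensionality n. unfold mul_factor, mul_root, lin, delay. destruct n as [|[|n]]; ring. Qed.
Lemma mul_factor_div_factor c g : mul_factor c (div_factor c g) = g.
Proof. extensionality n. unfold mul_factor, lin, delay. destruct n; simpl; ring. Qed.
Lemma div_factor_mul_factor c g : div_factor c (mul_factor c g) = g.
Proof.
  extensionality n. induction n as [|n IH]; simpl; [|rewrite IH];
    unfold mul_factor, lin, delay; ring.
Qed.
Lemma div_factor_mul_root c a h : div_factor c (mul_root a h) = mul_root a (div_factor c h).
Proof.
  rewrite <- (mul_factor_div_factor c h) at 1.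
  rewrite <- mul_factor_mul_root. apply div_factor_mul_factor.
Qed.
Lemma div_factor_mul_roots c l h : div_factor c (mul_roots l h) = mul_roots l (div_factor c h).
Proof. induction l as [|a l IH]; simpl; auto. rewrite div_factor_mul_root, IH; auto. Qed.
Lemma mul_factor_mul_roots c l h : mul_factor c (mul_roots l h) = mul_roots l (mul_factor c h).
Proof. induction l as [|a l IH]; simpl; auto. rewrite mul_factor_mul_root, IH; auto. Qed.

Definition scale (k : C) (h : nat -> C) (n : nat) : C := k * h n.
Lemma scale_mul_root k a h : scale k (mul_root a h) = mul_root a (scale k h).
Proof. extensionality n. unfold scale, mul_root, lin, delay. destruct n; ring. Qed.
Lemma scale_mul_roots k l h : scale k (mul_roots l h) = mul_roots l (scale k h).
Proof. induction l as [|a l IH]; simpl; auto. rewrite scale_mul_root, IH; auto. Qed.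
Lemma div_factor_0 g : div_factor 0 g = g.
Proof. extensionality n. destruct n; simpl; ring. Qed.

(** * Blaschke factors acting on coefficient sequences *)

Section Weight.

Variable mu : R.
Hypothesis Hmu : (1 < mu)%R.

Definition sq (c : nat -> C) : Prop := ex_series (fun n => mu ^ (2 * n) * Cmod (c n) ^ 2)%R.
Definition weight (c : nat -> C) (n : nat) : R := (mu ^ n * Cmod (c n))%R.

Lemma weight_sqr c n : (mu ^ (2 * n) * Cmod (c n) ^ 2 = weight c n ^ 2)%R.
Proof. unfold weight. rewrite Rpow_mult_distr, <- pow_mult, Nat.mul_comm. reflexivity. Qed.
Lemma weight_pos c n : (0 <= weight c n)%R.
Proof. apply Rmult_le_pos; [apply pow_le; lra|apply Cmod_ge_0]. Qed.
Lemma sq_weight c : sq c <-> ex_series (fun n => weight c n ^ 2)%R.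
Proof. split; apply ex_series_ext; intros n; Req; rewrite weight_sqr; auto. Qed.

Lemma sq_lin x c y d : sq c -> sq d -> sq (lin x c y d).
Proof.
  rewrite !sq_weight. intros Hc Hd.
  apply (ex_series_le (V := R_CompleteNormedModule) _
    (fun n => (2 * Cmod x ^ 2) * weight c n ^ 2 + (2 * Cmod y ^ 2) * weight d n ^ 2)%R).
  - intros n. Rnorm. rewrite Rabs_pos_eq by apply pow2_ge_0.
    assert (A : (weight (lin x c y d) n <= Cmod x * weight c n + Cmod y * weight d n)%R).
    { unfold weight, lin.
      replace (Cmod x * (mu ^ n * Cmod (c n)) + Cmod y * (mu ^ n * Cmod (d n)))%R
        with (mu ^ n * (Cmod (x * c n) + Cmod (y * d n)))%R by (rewrite !Cmod_mult; ring).
      apply Rmult_le_compat_l; [apply pow_le; lra|apply Cmod_triangle]. }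
    eapply Rle_trans; [apply pow_incr; split; [apply weight_pos|exact A]|].
    generalize (pow2_ge_0 (Cmod x * weight c n - Cmod y * weight d n)). nra.
  - apply (ex_series_plus (V := R_NormedModule)); apply (ex_series_scal (V := R_NormedModule)); auto.
Qed.
Lemma sq_delay c : sq c -> sq (delay c).
Proof.
  rewrite !sq_weight. intros H. apply ex_series_incr_1.
  apply (ex_series_ext (fun n => mu ^ 2 * weight c n ^ 2)%R).
  - intros n. Req. unfold weight. simpl. ring.
  - apply (ex_series_scal (V := R_NormedModule)), H.
Qed.
Lemma sq_scale k c : sq c -> sq (scale k c).
Proof.
  intros H. replace (scale k c) with (lin k c 0 c); [apply sq_lin; auto|].
  extensionality n. unfold scale, lin. ring.
Qed.
Lemma sq_mul_root a c : sq c -> sq (mul_root a c).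
Proof. intros; apply sq_lin; auto using sq_delay. Qed.
Lemma sq_mul_factor a c : sq c -> sq (mul_factor a c).
Proof. intros; apply sq_lin; auto using sq_delay. Qed.
Lemma sq_mul_roots l c : sq c -> sq (mul_roots l c).
Proof. intros; induction l; simpl; auto using sq_mul_root. Qed.

Lemma sq_div_factor c g : (mu * Cmod c < 1)%R -> sq g -> sq (div_factor c g).
Proof.
  rewrite !sq_weight. intros Hc Hg.
  apply (contraction_forward (mu * Cmod c) (weight g)); auto.
  - split; auto. apply Rmult_le_pos; [lra|apply Cmod_ge_0].
  - apply weight_pos.
  - unfold weight; simpl; lra.
  - intros n. unfold weight. simpl.
    replace (mu * Cmod c * (mu ^ n * Cmod (div_factor c g n)) + mu * mu ^ n * Cmod (g (S n)))%R
      with (mu * mu ^ n * (Cmod (c * div_factor c g n) + Cmod (g (S n))))%R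
      by (rewrite Cmod_mult; ring).
    apply Rmult_le_compat_l; [|apply Cmod_triangle].
    apply Rmult_le_pos; [lra|apply pow_le; lra].
Qed.

(** From [a * b <= a ^ 2 + b ^ 2] with [b = (r / mu) ^ n], whose squares are summable because
    [r < mu]. *)
Lemma sq_adm r c : (1 < r < mu)%R -> sq c -> adm r c.
Proof.
  rewrite sq_weight. intros Hr Hc.
  apply (ex_series_le (V := R_CompleteNormedModule) _
    (fun n => weight c n ^ 2 + ((r / mu) ^ 2) ^ n)%R).
  - intros n. Rnorm. assert (A : (0 < r ^ n)%R) by (apply pow_lt; lra).
    assert (B := Cmod_ge_0 (c n)).
    rewrite Rabs_pos_eq by nra.
    replace (Cmod (c n) * r ^ n)%R with (weight c n * (r / mu) ^ n)%R.
    + rewrite <- pow_mult, Nat.mul_comm, pow_mult.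
      generalize (weight_pos c n), (pow_le (r / mu) n ltac:(apply Rdiv_le_0_compat; lra)).
      intros. nra.
    + unfold weight, Rdiv. rewrite Rpow_mult_distr, pow_inv.
      field. apply pow_nonzero; lra.
  - apply (ex_series_plus (V := R_NormedModule)); auto.
    apply ex_series_geom. rewrite Rabs_pos_eq by apply pow2_ge_0.
    assert (0 < r / mu < 1)%R.
    { split; [apply Rdiv_lt_0_compat; lra|]. apply Rmult_lt_reg_r with mu; [lra|].
      unfold Rdiv; rewrite Rmult_assoc, Rinv_l; lra. }
    simpl. nra.
Qed.

Definition energy (c : nat -> C) : R := Series (fun n => mu ^ (2 * n) * Cmod (c n) ^ 2)%R.

(* Multiplication by [(t / mu - a / mu) / (1 - conj a t / mu^2)]; for [a = 0] this is
   the product with [z / mu]. *)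
Definition blaschke_coef (a : C) (g : nat -> C) : nat -> C :=
  scale (/ mu) (mul_root a (div_factor (Cconj a / mu / mu) g)).

(** The denominator [1 - conj a t / mu^2] has no zero in the closed disc of radius [mu]; this lets
    division by it preserve [sq]. *)
Lemma blaschke_factor_bound a : (Cmod a <= 1)%R ->
  (mu * Cmod (Cconj a / mu / mu) < 1)%R.
Proof.
  intros Ha.
  assert (Hn : RtoC mu <> 0) by (intros E; apply RtoC_inj in E; lra).
  rewrite !Cmod_div, Cmod_conj, Cmod_R, Rabs_pos_eq by (auto || lra).
  apply Rle_lt_trans with (/ mu)%R.
  - replace (mu * (Cmod a / mu / mu))%R with (/ mu * Cmod a)%R by (field; lra).
    rewrite <- (Rmult_1_r (/ mu)) at 2. apply Rmult_le_compat_l; auto.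
    left; apply Rinv_0_lt_compat; lra.
  - rewrite <- Rinv_1. apply Rinv_lt_contravar; lra.
Qed.

Lemma sq_blaschke_coef a g : (Cmod a <= 1)%R -> sq g -> sq (blaschke_coef a g).
Proof.
  intros Ha Hg. apply sq_scale, sq_mul_root, sq_div_factor; auto using blaschke_factor_bound.
Qed.

(* Multiplication by a Blaschke factor is isometric since, for the quotient [q]
   of [g] by [1 - conj a t / mu^2], the two energies differ by a telescoping sum. *)
Lemma blaschke_energy a g : (Cmod a <= 1)%R -> sq g ->
  energy (blaschke_coef a g) = energy g.
Proof.
  intros Ha Hg.
  set (q := div_factor (Cconj a / mu / mu) g).
  assert (Hq : sq q) by (apply sq_div_factor; auto using blaschke_factor_bound).
  assert (Eg : g = mul_factor (Cconj a / mu / mu) q) by (unfold q; rewrite mul_factor_div_factor; auto).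
  assert (Hb := sq_blaschke_coef a g Ha Hg).
  set (k := (1 - Cmod a ^ 2 / mu ^ 2)%R).
  assert (Cdm : forall x : C, (Cmod x ^ 2 = Re x * Re x + Im x * Im x)%R)
    by (intros; rewrite Cmod2_alt; simpl; ring).
  assert (D : forall n, (sum_n (fun n => mu ^ (2 * n) * Cmod (blaschke_coef a g n) ^ 2) n
     = sum_n (fun n => mu ^ (2 * n) * Cmod (g n) ^ 2) n - k * (mu ^ (2 * n) * Cmod (q n) ^ 2))%R).
  { assert (Dv : forall x : C, x / mu = (Re x / mu, Im x / mu)%R).
    { intros [x1 x2]. unfold Cdiv, Cinv, Cmult; simpl. f_equal; field; lra. }
    induction n as [|n IH].
    - rewrite !sum_O. unfold blaschke_coef. fold q.
      assert (E0 : g 0%nat = q 0%nat) by reflexivity. rewrite E0.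
      unfold scale, mul_root, lin, delay.
      replace (/ mu * (1 * 0 + - a * q 0%nat)) with (- (a * q 0%nat) / mu)
        by (unfold Cdiv; ring).
      rewrite Dv, !Cdm. unfold k. rewrite Cdm. destruct a as [a1 a2], (q 0%nat) as [x1 x2].
      simpl. field. lra.
    - rewrite !sum_Sn.
      change (@plus R_AbelianMonoid) with Rplus in *.
      simpl plus. rewrite IH.
      assert (E0 : g (S n) = q (S n) - Cconj a / mu / mu * q n).
      { transitivity (mul_factor (Cconj a / mu / mu) q (S n)); [rewrite <- Eg; auto|].
        unfold mul_factor, lin, delay. ring. }
      assert (E1 : blaschke_coef a g (S n) = (q n - a * q (S n)) / mu).
      { unfold blaschke_coef. fold q. unfold scale, mul_root, lin, delay, Cdiv. ring. }
      rewrite E0, E1. rewrite !Dv, !Cdm. unfold k. rewrite !Cdm.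
      replace (2 * S n)%nat with (S (S (2 * n))) by lia.
      destruct a as [a1 a2], (q n) as [x1 x2], (q (S n)) as [y1 y2].
      cbn -[Nat.mul sum_n pow Cmod]. rewrite <- !tech_pow_Rmult. field. lra. }
  unfold energy. apply is_series_unique.
  assert (Lq : is_lim_seq (fun n => mu ^ (2 * n) * Cmod (q n) ^ 2)%R 0)
    by (apply ex_series_lim_0; auto).
  assert (G : is_lim_seq (sum_n (fun n => mu ^ (2 * n) * Cmod (blaschke_coef a g n) ^ 2)%R)
    (Series (fun n => mu ^ (2 * n) * Cmod (g n) ^ 2)%R)); [|exact G].
  apply (is_lim_seq_ext _ _ _ (fun n => eq_sym (D n))).
  replace (Finite (Series (fun n => mu ^ (2 * n) * Cmod (g n) ^ 2)%R))
    with (Finite (Series (fun n => mu ^ (2 * n) * Cmod (g n) ^ 2)%R - k * 0))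
    by (f_equal; ring).
  apply is_lim_seq_minus'.
  - apply (Series_correct _ Hg).
  - apply (is_lim_seq_scal_l _ k 0), Lq.
Qed.

Definition blaschke_coefs (l : list C) (g : nat -> C) := fold_right blaschke_coef g l.

Lemma blaschke_coefs_sq l g : (forall a, In a l -> (Cmod a <= 1)%R) -> sq g ->
  sq (blaschke_coefs l g) /\ energy (blaschke_coefs l g) = energy g.
Proof.
  intros Hl Hg. induction l as [|a l IH]; simpl; auto.
  destruct IH as [A B]; [intros; apply Hl; simpl; auto|].
  split; [apply sq_blaschke_coef|rewrite blaschke_energy]; auto; apply Hl; simpl; auto.
Qed.

(** Division by the denominators commutes with multiplication by the roots and preserves [sq], so
    all denominators can be gathered in [h]. *)
Lemma blaschke_coefs_roots l g : (forall a, In a l -> (Cmod a <= 1)%R) -> sq g ->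
  exists h, sq h /\ blaschke_coefs l g = mul_roots l h.
Proof.
  intros Hl Hg. induction l as [|a l IH]; simpl; [eauto|].
  destruct IH as (h & Hh & E); [intros; apply Hl; simpl; auto|].
  unfold blaschke_coef at 1. fold (blaschke_coefs l g). rewrite E.
  rewrite div_factor_mul_roots, scale_mul_root, scale_mul_roots.
  eexists; split; [|reflexivity].
  apply sq_scale, sq_div_factor; auto. apply blaschke_factor_bound, Hl; simpl; auto.
Qed.

(** To undo [blaschke_coef], the quotient is multiplied in advance by [mu] and by the denominator,
    which also preserves [sq]. *)
Lemma roots_blaschke_coefs l h : (forall a, In a l -> (Cmod a <= 1)%R) -> sq h ->
  exists g, sq g /\ mul_roots l h = blaschke_coefs l g.
Proof.
  intros Hl. revert h. induction l as [|a l IH]; simpl; intros h Hh; [eauto|].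
  assert (Hn : RtoC mu <> 0) by (intros E; apply RtoC_inj in E; lra).
  set (h' := scale mu (mul_factor (Cconj a / mu / mu) h)).
  destruct (IH (fun b Hb => Hl b (or_intror Hb)) h') as (g & Hg & E).
  { apply sq_scale, sq_mul_factor, Hh. }
  exists g; split; auto. fold (blaschke_coefs l g). rewrite <- E.
  unfold blaschke_coef, h'.
  rewrite <- scale_mul_roots, <- mul_factor_mul_roots.
  set (w := fold_right mul_root h l). change (mul_roots l h) with w.
  extensionality n.
  assert (K : forall k c v m, div_factor c (scale k v) m = k * div_factor c v m).
  { intros k c v m. induction m as [|m IHm]; simpl; [|rewrite IHm]; unfold scale; ring. }
  unfold scale at 1, mul_root, lin, delay.
  destruct n as [|n]; cbv beta iota; rewrite !K, !div_factor_mul_factor; field; auto.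
Qed.

(** The denominator has constant term 1. So for [a <> 0] the leading coefficient is only multiplied
    by [- a / mu], and [m' = m]; for [a = 0] the sequence is delayed and divided by [mu], and
    [m' = m - 1], truncated at 0. *)
Lemma blaschke_first_coef a g m : (Cmod a <= 1)%R ->
  (forall i, (i < m)%nat -> blaschke_coef a g i = 0) ->
  exists m', (forall i, (i < m')%nat -> g i = 0) /\
    (mu * Cmod (blaschke_coef a g m) <= Cmod (g m'))%R.
Proof.
  intros Ha H. set (c := Cconj a / mu / mu) in *.
  assert (Hn : RtoC mu <> 0) by (intros E; apply RtoC_inj in E; lra).
  assert (Eb : forall i, blaschke_coef a g i = (delay (div_factor c g) i - a * div_factor c g i) / mu).
  { intros i. change (blaschke_coef a g i)
      with (/ mu * (1 * delay (div_factor c g) i + - a * div_factor c g i)).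
    unfold Cdiv at 1. ring. }
  assert (Q : forall k, (forall i, (i < k)%nat -> div_factor c g i = 0) ->
     (forall i, (i < k)%nat -> g i = 0) /\ div_factor c g k = g k).
  { intros k Hk. split.
    - intros [|i] Hi; [apply (Hk 0%nat Hi)|].
      assert (A := Hk (S i) Hi). assert (B := Hk i ltac:(lia)). simpl in A.
      rewrite B, Cmult_0_r, Cplus_0_l in A. exact A.
    - destruct k as [|k]; auto. simpl. rewrite Hk by lia. ring. }
  assert (Hm : forall x, (mu * Cmod (x / mu) = Cmod x)%R).
  { intros x. rewrite Cmod_div, Cmod_R, Rabs_pos_eq by (auto || lra). field; lra. }
  assert (Z : forall i, (i < m)%nat -> delay (div_factor c g) i = a * div_factor c g i).
  { intros i Hi. generalize (H i Hi). rewrite Eb. intros E.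
    assert (E' : delay (div_factor c g) i - a * div_factor c g i = 0).
    { replace (delay (div_factor c g) i - a * div_factor c g i)
        with ((delay (div_factor c g) i - a * div_factor c g i) / mu * mu) by (field; auto).
      rewrite E; ring. }
    replace (delay (div_factor c g) i)
      with ((delay (div_factor c g) i - a * div_factor c g i) + a * div_factor c g i) by ring.
    rewrite E'; ring. }
  rewrite Eb, Hm.
  destruct (classic (a = 0)) as [->|Na].
  - destruct m as [|m].
    + exists 0%nat. split; [lia|]. simpl. replace (0 - 0 * g 0%nat) with (RtoC 0) by ring.
      rewrite Cmod_0; apply Cmod_ge_0.
    + destruct (Q m) as [A B].
      { intros i Hi. assert (E := Z (S i) ltac:(lia)). simpl delay in E. rewrite E. ring. }
      exists m. split; auto. simpl delay. rewrite B.
      replace (g m - 0 * div_factor c g (S m)) with (g m) by ring. lra.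
  - assert (D0 : forall i, (i < m)%nat -> div_factor c g i = 0).
    { induction i as [i IH] using lt_wf_ind. intros Hi.
      assert (E : a * div_factor c g i = 0).
      { rewrite <- Z by auto. destruct i as [|i]; auto. apply IH; lia. }
      apply NNPP; intros Nq. exact (Cmult_neq_0 _ _ Na Nq E). }
    destruct (Q m D0) as [A B].
    exists m. split; auto. rewrite B.
    assert (S0 : delay (div_factor c g) m = 0) by (destruct m; [|apply D0]; auto).
    rewrite S0. replace (0 - a * g m) with (- (a * g m)) by ring.
    rewrite Cmod_opp, Cmod_mult. generalize (Cmod_ge_0 (g m)); nra.
Qed.

(* A sequence divisible by arbitrarily many Blaschke factors vanishes: each
   factor shrinks the leading coefficient by [mu]. *)
Lemma blaschke_divisible_zero c : sq c ->
  (forall N : nat, exists l g, (N <= length l)%nat /\ (forall a, In a l -> (Cmod a <= 1)%R) /\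
     sq g /\ c = blaschke_coefs l g) -> forall m, c m = 0.
Proof.
  intros Hc Hdiv. induction m as [m IH] using lt_wf_ind.
  apply NNPP; intros Nz. apply Cmod_gt_0 in Nz.
  assert (K : forall l g m, (forall a, In a l -> (Cmod a <= 1)%R) -> sq g ->
    (forall i, (i < m)%nat -> blaschke_coefs l g i = 0) ->
    ((mu ^ length l * Cmod (blaschke_coefs l g m)) ^ 2 <= energy g)%R).
  { clear - Hmu. intros l. induction l as [|a l IH]; intros g m Ha Hg Hz.
    - simpl length. rewrite pow_O, Rmult_1_l. change (blaschke_coefs nil g m) with (g m).
      eapply Rle_trans; [|apply (term_le_Series (fun n => mu ^ (2 * n) * Cmod (g n) ^ 2)%R m); auto].
      + assert (1 <= mu ^ (2 * m))%R by (apply pow_R1_Rle; lra).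
        generalize (pow2_ge_0 (Cmod (g m))). nra.
      + intros n. apply Rmult_le_pos; [apply pow_le; lra|apply pow2_ge_0].
    - destruct (blaschke_first_coef a (blaschke_coefs l g) m) as (m' & Z & B).
      + apply Ha; simpl; auto.
      + apply Hz.
      + eapply Rle_trans; [|apply (IH g m'); auto; intros; apply Ha; simpl; auto].
        apply pow_incr. split.
        * apply Rmult_le_pos; [apply pow_le; lra|apply Cmod_ge_0].
        * simpl length. simpl pow. simpl fold_right.
          replace (mu * mu ^ length l * Cmod (blaschke_coefs (a :: l) g m))%R
            with (mu ^ length l * (mu * Cmod (blaschke_coef a (blaschke_coefs l g) m)))%R
            by (simpl; ring).
          apply Rmult_le_compat_l; auto. apply pow_le; lra. }
  set (x := Cmod (c m)) in *.
  (* For such [N] the amplified coefficient is at least [energy c + 1], whose square exceeds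
     [energy c]. *)
  destruct (Pow_x_infinity mu ltac:(rewrite Rabs_pos_eq; lra) ((energy c + 1) / x)) as [N HN].
  destruct (Hdiv N) as (l & g & Hl & Ha & Hg & E).
  assert (B := K l g m Ha Hg). rewrite <- E in B. specialize (B IH). fold x in B.
  destruct (blaschke_coefs_sq l g Ha Hg) as [_ En]. rewrite <- E in En. rewrite <- En in B.
  specialize (HN (length l) ltac:(lia)). rewrite Rabs_pos_eq in HN by (apply pow_le; lra).
  apply Rge_le in HN. apply Rmult_le_compat_r with (r := x) in HN; [|lra].
  unfold Rdiv in HN. rewrite Rmult_assoc, Rinv_l, Rmult_1_r in HN by lra.
  assert (0 <= energy c)%R.
  { unfold energy. apply Rle_trans with (2 := term_le_Series (fun n => mu ^ (2 * n) * Cmod (c n) ^ 2)%R 0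
      ltac:(intros; apply Rmult_le_pos; [apply pow_le; lra|apply pow2_ge_0]) Hc).
    apply Rmult_le_pos; [apply pow_le; lra|apply pow2_ge_0]. }
  nra.
Qed.

End Weight.

(** * Steps along edges *)

Definition half (e : C) : C := (e - 1) / 2.

Lemma half_opp e : half (- e) = - (1 + half e).
Proof. unfold half. field. Qed.
(** [- (1 + half e)] is the root [half (- e)] of the reversed edge. It differs from [half x] unless
    [x = - e]; this is where opposite directions have to be excluded. *)
Lemma half_plus x e : half x - - (1 + half e) = (x + e) / 2.
Proof. unfold half. field. Qed.
Lemma half_double e : 1 + half e + half e = e.
Proof. unfold half. field. Qed.
Lemma Cmod_half e : Cmod e = 1%R -> (Cmod (half e) <= 1)%R.
Proof.
  intros He. unfold half. rewrite Cmod_div by (intros E; apply RtoC_inj in E; lra).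
  rewrite Cmod_R, (Rabs_pos_eq 2) by lra.
  assert (A := Cmod_triangle e (- (1))). rewrite Cmod_opp, Cmod_1, He in A.
  unfold Cminus. lra.
Qed.
Lemma Cmod_one_plus_half e : Cmod e = 1%R -> (Cmod (1 + half e) <= 1)%R.
Proof.
  intros He. rewrite <- Cmod_opp, <- half_opp. apply Cmod_half. rewrite Cmod_opp; auto.
Qed.

(* The values [z^(n)] at the two ends of an edge [e] are related by
   [(1 - a t) G_v(t) = (1 + (1 + a) t) G_u(t)], where [a = half e]. *)
Definition step (e : C) (zeta : nat -> C) : nat -> C :=
  div_factor (half e) (mul_factor (- (1 + half e)) zeta).

Lemma mul_factor_comm c d h : mul_factor c (mul_factor d h) = mul_factor d (mul_factor c h).
Proof. extensionality n. unfold mul_factor, lin, delay. destruct n as [|[|n]]; ring. Qed.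
Lemma div_factor_mul_factor_comm c d h : div_factor c (mul_factor d h) = mul_factor d (div_factor c h).
Proof.
  rewrite <- (mul_factor_div_factor c h) at 1. rewrite mul_factor_comm. apply div_factor_mul_factor.
Qed.
Lemma div_factor_comm c d h : div_factor c (div_factor d h) = div_factor d (div_factor c h).
Proof.
  rewrite <- (mul_factor_div_factor c h) at 1. rewrite div_factor_mul_factor_comm.
  apply div_factor_mul_factor.
Qed.

Lemma step_comm e e' z : step e (step e' z) = step e' (step e z).
Proof.
  unfold step. rewrite <- !div_factor_mul_factor_comm, div_factor_comm.
  f_equal. f_equal. apply mul_factor_comm.
Qed.
Lemma step_opp e z : step (- e) (step e z) = z.
Proof.
  unfold step. rewrite half_opp.
  replace (- (1 + - (1 + half e))) with (half e) by ring.
  rewrite mul_factor_div_factor. apply div_factor_mul_factor.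
Qed.

(** The edge relation between generating functions, read at the coefficient of [t ^ (n + 1)]. Since
    [mul_root a] is transposed to [advance] minus [a], it yields [pairing_step]. *)
Lemma advance_step e z :
  lin 1 (advance (step e z)) (- half e) (step e z) = lin 1 (advance z) (1 + half e) z.
Proof.
  extensionality n. unfold lin, advance, step. simpl. unfold mul_factor, lin, delay. ring.
Qed.

Notation steps_fold := (fold_steps (nat -> C) step).

Definition eval (a : C) (h : nat -> C) : C := pairing (fun n => a ^ n) h.

(** * Transport of pairings along a walk *)

Section Growth.

Variable r : R.
Hypothesis Hr : (1 < r)%R.

Lemma grow_step e z : Cmod e = 1%R -> grow r z -> grow r (step e z).
Proof.
  intros He Hz. destruct (grow_K _ _ Hz) as (K & HK & H).
  (* One step of the recursion adds at most [K * (r + 1) * r ^ n], and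
     [K' + K * (r + 1) = K' * r]. *)
  set (K' := (K * (r + 1) / (r - 1))%R).
  assert (E : (K' * (r - 1) = K * (r + 1))%R) by (unfold K'; field; lra).
  assert (HK' : (K <= K')%R) by nra.
  exists K'. induction n as [|n IH].
  - simpl. unfold step. simpl. unfold mul_factor, lin, delay.
    replace (1 * z 0%nat + - - (1 + half e) * 0) with (z 0%nat) by ring.
    generalize (H 0%nat). simpl. lra.
  - assert (S0 : step e z (S n) = half e * step e z n + (z (S n) + (1 + half e) * z n)).
    { assert (A := equal_f (advance_step e z) n). unfold lin, advance in A.
      replace (step e z (S n)) with (1 * step e z (S n) + - half e * step e z n
        + half e * step e z n) by ring. rewrite A. ring. }
    rewrite S0. eapply Rle_trans; [apply Cmod_triangle|].
    assert (A1 : (Cmod (half e * step e z n) <= K' * r ^ n)%R).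
    { rewrite Cmod_mult. generalize (Cmod_half e He), (Cmod_ge_0 (half e)), (Cmod_ge_0 (step e z n)).
      nra. }
    assert (A2 : (Cmod (z (S n) + (1 + half e) * z n) <= K * r ^ S n + K * r ^ n)%R).
    { eapply Rle_trans; [apply Cmod_triangle|]. apply Rplus_le_compat; auto.
      rewrite Cmod_mult. generalize (Cmod_one_plus_half e He), (Cmod_ge_0 (1 + half e)),
        (Cmod_ge_0 (z n)), (H n).
      nra. }
    assert (P := pow_r_pos r Hr n). simpl in *. nra.
Qed.

Lemma grow_steps l z : (forall e, In e l -> Cmod e = 1%R) -> grow r z ->
  grow r (steps_fold l z).
Proof.
  revert z. induction l as [|e l IH]; simpl; intros z Hl Hz; auto.
  apply IH; auto. apply grow_step; auto.
Qed.

Lemma adm_mul_root a h : adm r h -> adm r (mul_root a h).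
Proof. intros. apply adm_lin; auto using adm_delay. Qed.
Lemma adm_mul_roots l h : adm r h -> adm r (mul_roots l h).
Proof. intros. induction l; simpl; auto using adm_mul_root. Qed.

Lemma pairing_mul_root z a h : grow r z -> adm r h ->
  pairing z (mul_root a h) = pairing (lin 1 (advance z) (- a) z) h.
Proof.
  intros Hz Hh. unfold mul_root.
  rewrite (pairing_lin_r r), (pairing_lin_l r), (pairing_delay r);
    auto using grow_advance, adm_delay.
Qed.

Lemma pairing_step e z h : Cmod e = 1%R -> grow r z -> adm r h ->
  pairing (step e z) (mul_root (half e) h) = pairing z (mul_root (- (1 + half e)) h).
Proof.
  intros He Hz Hh. rewrite !pairing_mul_root; auto using grow_step.
  rewrite advance_step. f_equal. extensionality n. unfold lin; ring.
Qed.

Lemma pairing_steps l z h : (forall e, In e l -> Cmod e = 1%R) -> grow r z -> adm r h ->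
  pairing (steps_fold l z) (mul_roots (map half l) h)
  = pairing z (mul_roots (map (fun e => - (1 + half e)) l) h).
Proof.
  revert z h. induction l as [|e l IH]; simpl; intros z h Hl Hz Hh; auto.
  change (fold_left _ l (step e z)) with (steps_fold l (step e z)).
  change (fold_right mul_root h (map half l)) with (mul_roots (map half l) h).
  rewrite <- mul_roots_comm, IH; auto using grow_step, adm_mul_root.
  rewrite mul_roots_comm. apply pairing_step; auto using adm_mul_roots.
Qed.

Lemma eval_mul_root a b h : (Cmod a <= 1)%R -> adm r h ->
  eval a (mul_root b h) = (a - b) * eval a h.
Proof.
  intros Ha Hh. unfold eval. rewrite pairing_mul_root; auto using grow_geom.
  transitivity (pairing (lin (a - b) (fun n => a ^ n) 0 (fun n => a ^ n)) h).
  - f_equal. extensionality n. unfold lin, advance. simpl. ring.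
  - rewrite (pairing_lin_l r); auto using grow_geom. ring.
Qed.

Lemma eval_mul_roots_zero a l h : (Cmod a <= 1)%R -> adm r h ->
  (forall b, In b l -> a - b <> 0) -> eval a (mul_roots l h) = 0 -> eval a h = 0.
Proof.
  intros Ha Hh. induction l as [|b l IH]; simpl; intros Hl H; auto.
  apply IH; auto. rewrite eval_mul_root in H; auto using adm_mul_roots.
  apply NNPP; intros N. revert H. apply Cmult_neq_0; auto.
Qed.

(** Steps commute, so [x] may be taken first; undoing [l] then replaces each root [half e] by
    [- (1 + half e)]. What remains is a single edge from the origin, with generating function
    [1 + x t / (1 - half x t)] because [1 + 2 half x = x], and transposing the factor [t] leaves
    only the geometric part. *)
Lemma pairing_last_step l x h : (forall e, In e l -> Cmod e = 1%R) -> Cmod x = 1%R ->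
  adm r h ->
  pairing (steps_fold (l ++ [x]) unit_seq) (mul_roots (RtoC 0 :: map half l) h)
  = x * eval (half x) (mul_roots (map (fun e => - (1 + half e)) l) h).
Proof.
  intros Hl Hx Hh. rewrite fold_steps_app. simpl fold_steps at 1.
  rewrite <- (fold_steps_comm _ _ step_comm).
  simpl mul_roots. change (fold_right mul_root h (map half l)) with (mul_roots (map half l) h).
  rewrite <- mul_roots_comm.
  assert (G : grow r (step x unit_seq)) by (apply grow_step; auto using grow_unit).
  rewrite pairing_steps; auto using adm_mul_root.
  rewrite mul_roots_comm, mul_root_0, (pairing_delay r); auto using adm_mul_roots.
  assert (Ha : (Cmod (half x) <= 1)%R) by (apply Cmod_half; auto).
  transitivity (pairing (lin x (fun n => half x ^ n) 0 unit_seq)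
     (mul_roots (map (fun e => - (1 + half e)) l) h)).
  - f_equal. extensionality n. unfold advance.
    induction n as [|n IH].
    + unfold lin, step. simpl. unfold mul_factor, lin, delay. simpl.
      transitivity (1 + half x + half x); [ring|]. rewrite half_double. ring.
    + unfold lin, step in *. simpl div_factor at 1. simpl div_factor in IH. simpl.
      rewrite IH. unfold mul_factor, lin, delay. simpl. ring.
  - unfold eval. rewrite (pairing_lin_l r); auto using grow_geom, grow_unit, adm_mul_roots. ring.
Qed.

End Growth.

(** * Splitting off roots of square-summable series *)

Section Weight.

Variables (mu r : R).
Hypothesis Hr : (1 < r < mu)%R.

Lemma eval_advance a h : (Cmod a <= 1)%R -> adm r h ->
  eval a h = h 0%nat + a * eval a (advance h).
Proof.
  intros Ha Hh. unfold eval, pairing.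
  rewrite Cseries_incr by (apply (pairing_summable r); auto; [apply grow_geom; lra || auto]).
  rewrite <- Cseries_scal by (apply (pairing_summable r);
    [apply grow_geom; lra || auto|apply adm_advance; auto; lra]).
  simpl. f_equal; [ring|]. apply Cseries_ext. intros n. unfold advance. ring.
Qed.

(** Synthetic division: [h' n] is the sum of the [h (n + 1 + k) a ^ k], and the remainder [eval a h]
    vanishes. The root may lie on the unit circle, but with the weights [mu ^ n] the recursion for
    [h'] still contracts by the factor [/ mu]. *)
Lemma root_division a h : (Cmod a <= 1)%R -> sq mu h -> eval a h = 0 ->
  exists h', sq mu h' /\ h = mul_root a h'.
Proof.
  intros Ha Hh E.
  assert (Hmu : (1 < mu)%R) by lra.
  assert (Had : forall n, adm r (fun k => h (n + k)%nat)).
  { induction n as [|n IH].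
    - apply (sq_adm mu Hmu); auto.
    - apply adm_advance in IH; [|lra].
      apply (ex_series_ext (fun k => Cmod (advance (fun k => h (n + k)%nat) k) * r ^ k)%R); auto.
      intros k. Req. unfold advance. rewrite <- plus_n_Sm. reflexivity. }
  set (h' := fun n => eval a (fun k => h (S n + k)%nat)).
  assert (Rec : forall n, h' n = h (S n) + a * h' (S n)).
  { intros n. unfold h'. rewrite eval_advance; auto.
    rewrite Nat.add_0_r. f_equal. f_equal. f_equal. extensionality k.
    unfold advance. rewrite <- plus_n_Sm. reflexivity. }
  assert (R0 : h 0%nat + a * h' 0%nat = 0).
  { rewrite <- E, (eval_advance a h Ha (Had 0%nat)). reflexivity. }
  exists h'. split.
  - apply sq_weight. assert (Hw := proj1 (sq_weight mu h) Hh).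
    (* A weight [w] satisfies [w <= 1 + w ^ 2], and each [w ^ 2] is at most the energy. *)
    set (X := (1 + energy mu h)%R).
    assert (HX : forall n, (weight mu h n <= X)%R).
    { intros n. assert (A := term_le_Series _ n (fun n => pow2_ge_0 (weight mu h n)) Hw).
      assert (B : Series (fun n => weight mu h n ^ 2)%R = energy mu h).
      { apply Series_ext. intros k. rewrite weight_sqr; auto. }
      rewrite B in A. unfold X. generalize (pow2_ge_0 (weight mu h n - 1)).
      assert (W := weight_pos mu Hmu h n). nra. }
    set (q := (/ mu)%R).
    assert (Hq : (0 < q < 1)%R).
    { split; [apply Rinv_0_lt_compat; lra|]. unfold q. rewrite <- Rinv_1.
      apply Rinv_lt_contravar; lra. }
    assert (Hqm : (mu * q = 1)%R) by (unfold q; field; lra).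
    assert (Hpow : forall n, (mu ^ n * q ^ n = 1)%R).
    { intros n. rewrite <- Rpow_mult_distr, Hqm, pow1; auto. }
    assert (Hh' : forall n, (Cmod (h n) <= X * q ^ n)%R).
    { intros n. generalize (HX n), (Hpow n), (pow_lt q n ltac:(lra)). unfold weight. intros A B D.
      apply Rmult_le_compat_r with (r := (q ^ n)%R) in A; [|lra].
      replace (mu ^ n * Cmod (h n) * q ^ n)%R with ((mu ^ n * q ^ n) * Cmod (h n))%R in A by ring.
      rewrite B in A. lra. }
    (* The bound in advance is the geometric series that majorizes the tail of [h], multiplied by
       [mu ^ n]. *)
    apply (contraction_backward q (X * q / (1 - q)) (fun n => q * weight mu h (S n))%R).
    + lra.
    + intros n. split; [apply weight_pos; auto|].
      assert (B : (Cmod (h' n) <= X * q ^ S n * / (1 - q))%R).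
      { unfold h', eval, pairing.
        replace (X * q ^ S n * / (1 - q))%R with (Series (fun k => X * q ^ S n * q ^ k)%R).
        - apply Cseries_le.
          + intros k. rewrite Cmod_mult, Cmod_pow.
            assert (A := Hh' (S n + k)%nat). rewrite pow_add in A.
            assert (P : (Cmod a ^ k <= 1)%R).
            { rewrite <- (pow1 k). apply pow_incr. split; [apply Cmod_ge_0|auto]. }
            generalize (Cmod_ge_0 (h (S n + k)%nat)), (pow_le (Cmod a) k (Cmod_ge_0 a)). nra.
          + apply (ex_series_scal (V := R_NormedModule)), ex_series_geom.
            rewrite Rabs_pos_eq; lra.
        - rewrite Series_scal_l, Series_geom; auto. rewrite Rabs_pos_eq; lra. }
      unfold weight. apply Rmult_le_compat_l with (r := (mu ^ n)%R) in B; [|apply pow_le; lra].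
      replace (mu ^ n * (X * q ^ S n * / (1 - q)))%R
        with ((mu ^ n * q ^ n) * (X * q / (1 - q)))%R in B by (simpl; field; lra).
      rewrite Hpow in B. lra.
    + intros n. unfold weight. rewrite Rec. simpl.
      replace (q * (mu * mu ^ n * Cmod (h' (S n))) + q * (mu * mu ^ n * Cmod (h (S n))))%R
        with ((mu * q) * (mu ^ n * (Cmod (h (S n)) + Cmod (h' (S n)))))%R by ring.
      rewrite Hqm, Rmult_1_l. apply Rmult_le_compat_l; [apply pow_le; lra|].
      rewrite <- (Rmult_1_l (Cmod (h' (S n)))).
      eapply Rle_trans; [apply Cmod_triangle|]. apply Rplus_le_compat_l.
      rewrite Cmod_mult. apply Rmult_le_compat_r; auto using Cmod_ge_0.
    + apply (ex_series_ext (fun n => q ^ 2 * weight mu h (S n) ^ 2)%R).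
      * intros n. Req. ring.
      * apply (ex_series_scal (V := R_NormedModule)).
        apply (ex_series_incr_1 (fun n => weight mu h n ^ 2)%R), Hw.
  - extensionality n. unfold mul_root, lin, delay. destruct n as [|n].
    + replace (1 * 0 + - a * h' 0%nat) with (h 0%nat - (h 0%nat + a * h' 0%nat)) by ring.
      rewrite R0. ring.
    + rewrite (Rec n) at 1. ring.
Qed.

Definition no_backtrack (l : list C) : Prop :=
  forall l1 x l2, l = l1 ++ x :: l2 -> forall e, In e l1 -> x + e <> 0.

Lemma interpolation_roots l c : (forall e, In e l -> Cmod e = 1%R) -> sq mu c ->
  no_backtrack l ->
  (forall l1 l2, l = l1 ++ l2 -> pairing (steps_fold l1 unit_seq) c = 0) ->
  exists h, sq mu h /\ c = mul_roots (RtoC 0 :: map half l) h.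
Proof.
  assert (Hr1 : (1 < r)%R) by lra. assert (Hmu : (1 < mu)%R) by lra.
  intros Hl Hc. revert Hl. induction l as [|x l IH] using rev_ind; intros Hl Hn Hz.
  - destruct (root_division 0 c) as (h & Hh & E); auto.
    + rewrite Cmod_0; lra.
    + rewrite eval_advance; [|rewrite Cmod_0; lra|apply (sq_adm mu Hmu); auto].
      assert (A := Hz nil nil eq_refl). simpl in A.
      rewrite (pairing_unit r) in A by (auto; apply (sq_adm mu Hmu); auto).
      rewrite A. ring.
    + exists h; split; auto.
  - destruct IH as (h & Hh & E).
    + intros e He; apply Hl, in_app_iff; auto.
    + intros l1 y l2 -> e He. apply (Hn l1 y (l2 ++ [x])); auto.
      rewrite <- app_assoc. reflexivity.
    + intros l1 l2 ->. apply (Hz l1 (l2 ++ [x])). rewrite <- app_assoc. reflexivity.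
    + assert (Hx : Cmod x = 1%R) by (apply Hl, in_app_iff; simpl; auto).
      assert (Hl' : forall e, In e l -> Cmod e = 1%R) by (intros; apply Hl, in_app_iff; auto).
      assert (Z := Hz (l ++ [x]) nil ltac:(rewrite app_nil_r; auto)).
      rewrite E in Z.
      assert (Had : adm r h) by (apply (sq_adm mu Hmu); auto).
      rewrite (pairing_last_step r Hr1) in Z; auto.
      destruct (root_division (half x) h) as (h' & Hh' & E'); auto using Cmod_half.
      * apply (eval_mul_roots_zero r Hr1) with (map (fun e => - (1 + half e)) l);
          auto using Cmod_half.
        -- intros b Hb. apply in_map_iff in Hb. destruct Hb as (e & <- & He).
           rewrite half_plus. intros D.
           apply (Hn l x nil eq_refl e He).
           replace (x + e) with ((x + e) / 2 * 2)
             by (field; intros D2; apply RtoC_inj in D2; lra).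
           rewrite D; ring.
        -- apply NNPP; intros N. revert Z. apply Cmult_neq_0; auto.
           intros Ex. rewrite Ex, Cmod_0 in Hx. lra.
      * exists h'; split; auto. rewrite E, E', map_app. simpl map.
        rewrite app_comm_cons, mul_roots_app. reflexivity.
Qed.

(** Transport back to the origin exchanges the roots of [l1] for others but keeps the factor [t],
    and the value at the origin is the coefficient of order 0. *)
Lemma roots_interpolation l h : (forall e, In e l -> Cmod e = 1%R) -> sq mu h ->
  forall l1 l2, l = l1 ++ l2 ->
  pairing (steps_fold l1 unit_seq) (mul_roots (RtoC 0 :: map half l) h) = 0.
Proof.
  assert (Hr1 : (1 < r)%R) by lra. assert (Hmu : (1 < mu)%R) by lra.
  intros Hl Hh l1 l2 ->. rewrite map_app, app_comm_cons, mul_roots_app.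
  set (h' := mul_roots (map half l2) h).
  assert (Hh' : sq mu h') by (apply sq_mul_roots; auto).
  assert (Had : adm r h') by (apply (sq_adm mu Hmu); auto).
  change (mul_roots (RtoC 0 :: map half l1) h') with (mul_root 0 (mul_roots (map half l1) h')).
  assert (Hl1 : forall e, In e l1 -> Cmod e = 1%R) by (intros; apply Hl, in_app_iff; auto).
  rewrite <- mul_roots_comm.
  rewrite (pairing_steps r Hr1); auto using grow_unit, adm_mul_root.
  rewrite mul_roots_comm, mul_root_0.
  rewrite (pairing_unit r Hr1) by (apply adm_delay; auto; apply adm_mul_roots; auto).
  reflexivity.
Qed.

End Weight.

(** * Discrete analytic functions *)

Section Paths.

Variable L : rhombic_lattice.

Lemma walk_vertex a l b : walk L a l b -> vertex L a -> vertex L b.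
Proof. induction 1 as [|a d l b H W IH]; auto. intros _. apply IH, (edge_vertices L _ _ H). Qed.

Lemma walk_directions a l b : walk L a l b -> forall e, In e l -> Cmod e = 1%R.
Proof.
  induction 1 as [|a d l b H W IH]; simpl; [tauto|]. intros e [<-|He]; auto.
  rewrite <- (edge_length L _ _ H). f_equal; ring.
Qed.

Lemma walk_length_bound a l b : walk L a l b -> (Cmod (b - a) <= INR (length l))%R.
Proof.
  induction 1 as [a|a d l b H W IH].
  - replace (a - a) with (RtoC 0) by ring. rewrite Cmod_0; simpl; lra.
  - assert (Hd := edge_length L _ _ H). replace (a + d - a) with d in Hd by ring.
    replace (b - a) with ((b - (a + d)) + d) by ring.
    eapply Rle_trans; [apply Cmod_triangle|]. simpl length. rewrite S_INR. lra.
Qed.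

Lemma shortest_walk_exists a b : vertex L a -> vertex L b ->
  exists l, walk L a l b /\ forall l', walk L a l' b -> (length l <= length l')%nat.
Proof.
  intros Ha Hb. destruct (vertices_reachable L a b Ha Hb) as [l W].
  remember (length l) as n eqn:En. revert l W En.
  induction n as [n IH] using lt_wf_ind. intros l W En.
  destruct (classic (exists l', walk L a l' b /\ (length l' < n)%nat)) as [(l' & W' & H)|H].
  - apply (IH _ H l'); auto.
  - exists l; split; auto. intros l' W'. apply Nat.nlt_ge. intros D. apply H.
    exists l'; split; auto; lia.
Qed.

Lemma shortest_walk_no_backtrack a l b : walk L a l b ->
  (forall l', walk L a l' b -> (length l <= length l')%nat) -> no_backtrack l.
Proof.
  intros W Hmin l1 x l2 E e He D.
  destruct (in_split _ _ He) as (m1 & m2 & ->).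
  apply (shortest_walk_no_opposite L a l b W Hmin m1 e m2 l2).
  rewrite E, <- app_assoc. simpl. do 4 f_equal.
  replace x with (x + e - e) by ring. rewrite D. ring.
Qed.

Definition path_steps (z : nat -> C) (N : nat) : list C :=
  map (fun n => z (S n) - z n) (seq 0 N).

Lemma path_steps_firstn z N k : (k <= N)%nat -> firstn k (path_steps z N) = path_steps z k.
Proof.
  intros Hk. unfold path_steps. rewrite firstn_map. f_equal.
  replace N with (k + (N - k))%nat by lia. rewrite seq_app, firstn_app, length_seq.
  rewrite Nat.sub_diag, firstn_O, app_nil_r, firstn_all2; auto. rewrite length_seq; auto.
Qed.

Lemma path_walk N z a b k : is_path L N z a b -> (k <= N)%nat ->
  walk L a (path_steps z k) (z k).
Proof.
  intros (_ & H0 & _ & He) Hk. induction k as [|k IH].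
  - rewrite H0. constructor.
  - unfold path_steps. rewrite seq_S, map_app. eapply walk_app; [apply IH; lia|].
    apply walk_edge, He; lia.
Qed.

Lemma walk_path a l b : walk L a l b -> vertex L a ->
  exists z, is_path L (length l) z a b.
Proof.
  induction 1 as [a|a d l b H W IH]; intros Ha.
  - exists (fun _ => a). repeat split; auto. simpl; lia.
  - destruct IH as (z & Hv & Z0 & ZN & Ze); [apply (edge_vertices L _ _ H)|].
    exists (fun n => match n with 0%nat => a | S m => z m end).
    split; [auto|split; [auto|split; [auto|]]].
    intros [|n] Hn; [rewrite Z0; auto|]. apply Ze. simpl in Hn; lia.
Qed.

Lemma path_vertex N z a b k : is_path L N z a b -> (k <= N)%nat -> vertex L (z k).
Proof. intros P Hk. eapply walk_vertex; [eapply path_walk; eauto|apply P]. Qed.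

Lemma some_path_correct a b : vertex L a -> vertex L b ->
  is_path L (fst (some_path L a b)) (snd (some_path L a b)) a b.
Proof.
  intros Ha Hb. unfold some_path. apply epsilon_spec.
  destruct (vertices_reachable L a b Ha Hb) as [l W].
  destruct (walk_path _ _ _ W Ha) as [z Hz]. exists (length l, z). exact Hz.
Qed.

(* [F] is [Z_+ f] up to a constant. *)
Definition primitive (F f : C -> C) : Prop := forall u v, edge L u v ->
  F v - F u = (1 + half (v - u)) * f u + half (v - u) * f v.

(** [F + f / 2] is an antiderivative for the trapezoidal rule, since the weights [1 + half e] and
    [half e] are [e / 2] plus and minus [1 / 2]. *)
Lemma path_integral_primitive F f N z a b : primitive F f -> is_path L N z a b ->
  path_integral f N z = (F b + f b / 2) - (F a + f a / 2).
Proof.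
  intros HF (_ & Z0 & ZN & Ze). rewrite <- Z0, <- ZN. clear Z0 ZN.
  assert (K : forall k, (k <= N)%nat -> path_integral f k z
    = (F (z k) + f (z k) / 2) - (F (z 0%nat) + f (z 0%nat) / 2)).
  { unfold path_integral. induction k as [|k IH]; intros Hk.
    - rewrite sum_n_m_zero by lia.
      change (RtoC 0 = F (z 0%nat) + f (z 0%nat) / 2 - (F (z 0%nat) + f (z 0%nat) / 2)).
      ring.
    - rewrite sum_n_Sm by lia. rewrite IH by lia.
      replace (S k - 1)%nat with k by lia.
      assert (E := HF _ _ (Ze k ltac:(lia))). unfold half in E.
      match goal with |- plus ?x ?y = _ => change (plus x y) with (Cplus x y) end.
      transitivity (F (z k) + (F (z (S k)) - F (z k)) + f (z (S k)) / 2 - (F (z 0%nat) + f (z 0%nat) / 2));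
        [rewrite E; field|ring]. }
  apply K; auto.
Qed.

Lemma primitive_analytic F f : primitive F f -> discrete_analytic L f.
Proof.
  intros HF N z a Hp. rewrite (path_integral_primitive F f N z a a); auto. ring.
Qed.

Lemma Zplus_primitive F f v : vertex L 0 -> primitive F f -> vertex L v ->
  Zplus L f v = F v - F 0.
Proof.
  intros V0 HF Hv. unfold Zplus, integral.
  rewrite (path_integral_primitive F f _ _ 0 v); auto using some_path_correct. field.
Qed.

End Paths.

(** * The Hardy space and its products in terms of coefficients *)

Section Hardy.

Variable L : rhombic_lattice.
Hypothesis V0 : vertex L 0.
Variables (mu r : R).
Hypothesis Hr : (1 < r < mu)%R.

Local Lemma mu_gt_1 : (1 < mu)%R. Proof. lra. Qed.
Local Lemma r_gt_1 : (1 < r)%R. Proof. lra. Qed.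
Hint Resolve mu_gt_1 r_gt_1 : core.

(* [zeta v n] is the value [z^(n)] at [z = v]. *)
Definition zeta (v : C) : nat -> C :=
  steps_fold (epsilon (inhabits nil) (fun l => walk L 0 l v)) unit_seq.

Lemma zeta_walk l v : walk L 0 l v -> zeta v = steps_fold l unit_seq.
Proof.
  intros W. unfold zeta. apply (walks_fold L _ _ step_comm step_opp 0 v); auto.
  apply epsilon_spec. eauto.
Qed.
Lemma zeta_edge u v : edge L u v -> zeta v = step (v - u) (zeta u).
Proof.
  intros H. destruct (vertices_reachable L 0 u V0 (proj1 (edge_vertices L _ _ H))) as [l W].
  rewrite (zeta_walk l u W), (zeta_walk (l ++ [v - u]) v).
  - apply fold_steps_app.
  - eapply walk_app; [exact W|apply walk_edge, H].
Qed.
Lemma zeta_origin : zeta 0 = unit_seq.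
Proof. rewrite (zeta_walk nil 0); [reflexivity|constructor]. Qed.
Lemma grow_zeta v : vertex L v -> grow r (zeta v).
Proof.
  intros Hv. destruct (vertices_reachable L 0 v V0 Hv) as [l W].
  rewrite (zeta_walk l v W). apply grow_steps; auto using grow_unit.
  apply (walk_directions L _ _ _ W).
Qed.
Lemma zeta_0 v : vertex L v -> zeta v 0%nat = 1.
Proof.
  intros Hv. destruct (vertices_reachable L 0 v V0 Hv) as [l W].
  rewrite (zeta_walk l v W). clear.
  assert (K : forall z, steps_fold l z 0%nat = z 0%nat).
  { induction l as [|e l IH]; intros z; auto. simpl.
    etransitivity; [apply IH|]. unfold step; simpl. unfold mul_factor, lin, delay. ring. }
  rewrite K; reflexivity.
Qed.

Lemma zeta_primitive n : primitive L (fun v => zeta v (S n)) (fun v => zeta v n).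
Proof.
  intros u v H. rewrite (zeta_edge u v H). set (e := v - u).
  assert (A := equal_f (advance_step e (zeta u)) n). unfold lin, advance in A.
  transitivity ((1 * step e (zeta u) (S n) + - half e * step e (zeta u) n)
    + half e * step e (zeta u) n - zeta u (S n)); [ring|]. rewrite A. ring.
Qed.

Lemma zpow_zeta n v : vertex L v -> zpow L n v = zeta v n.
Proof.
  revert v. induction n as [|n IH]; intros v Hv.
  - rewrite zeta_0; auto.
  - change (Zplus L (zpow L n) v = zeta v (S n)).
    rewrite (Zplus_primitive L (fun v => zeta v (S n))); auto.
    + rewrite zeta_origin. simpl. ring.
    + intros u w H. destruct (edge_vertices L _ _ H).
      rewrite !IH by auto. apply zeta_primitive; auto.
Qed.

(** A relation rather than a statement about [coef], which is known to return the right sequence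
    only after [represents_unique]. *)
Definition represents (c : nat -> C) (f : C -> C) : Prop :=
  forall v, vertex L v -> f v = pairing (zeta v) c.

(** [pairing_step], with the factor [t - half e] split into its two terms, is the defining relation
    of a primitive; thus [Zplus] acts as [delay] and no series is integrated term by term. *)
Lemma represents_primitive c f : adm r c -> represents c f ->
  primitive L (fun v => pairing (zeta v) (delay c)) f.
Proof.
  intros Hc Hf u v H. destruct (edge_vertices L _ _ H) as [Hu Hv].
  rewrite (Hf u), (Hf v) by auto.
  assert (He := edge_length L _ _ H).
  assert (A := pairing_step r r_gt_1 _ _ c He (grow_zeta u Hu) Hc).
  rewrite <- (zeta_edge u v H) in A. unfold mul_root in A.
  rewrite !(pairing_lin_r r) in A; auto using grow_zeta, adm_delay.
  set (e := v - u) in *.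
  transitivity ((1 * pairing (zeta v) (delay c) + - half e * pairing (zeta v) c)
    + half e * pairing (zeta v) c - pairing (zeta u) (delay c)); [ring|].
  rewrite A. ring.
Qed.

Lemma represents_analytic c f : adm r c -> represents c f -> discrete_analytic L f.
Proof. intros. eapply primitive_analytic, represents_primitive; eauto. Qed.

Lemma represents_Zplus c f : adm r c -> represents c f -> represents (delay c) (Zplus L f).
Proof.
  intros Hc Hf v Hv.
  rewrite (Zplus_primitive L (fun v => pairing (zeta v) (delay c))); auto using represents_primitive.
  rewrite zeta_origin, (pairing_unit r) by auto using adm_delay. simpl. ring.
Qed.

Lemma is_coef_iff f c : is_coef L mu f c <-> sq mu c /\ represents c f.
Proof.
  unfold is_coef, sq. split; intros [H1 H2]; split; auto; intros v Hv.
  - unfold pairing. symmetry. apply Cseries_unique.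
    apply (is_series_ext (fun n => zpow L n v * c n)); auto.
    intros n. rewrite zpow_zeta; auto.
  - apply (is_series_ext (fun n => zeta v n * c n)).
    + intros n. rewrite zpow_zeta; auto.
    + rewrite (H2 v Hv). apply Cseries_correct, (pairing_summable r); auto using grow_zeta.
      apply (sq_adm mu); auto.
Qed.

Lemma H2_iff f : H2 L mu f <-> exists c, sq mu c /\ represents c f.
Proof.
  split.
  - intros [_ [c Hc]]. exists c. apply is_coef_iff, Hc.
  - intros (c & Hc & Hf). split.
    + eapply represents_analytic; eauto. apply (sq_adm mu); auto.
    + exists c. apply is_coef_iff; auto.
Qed.

(** A corner of a tile through the point [N + 3] is at most 2 away from it. Since [n] steps cover at
    most distance [n], this yields arbitrarily long shortest paths. *)
Lemma far_vertex (N : nat) : exists v, vertex L v /\ (INR N < Cmod v)%R.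
Proof.
  set (x := RtoC (INR N + 3)). destruct (tile_cover L x) as [i Hi].
  exists (org (tile L i)). split; [exists i; simpl; auto|].
  destruct (tile_unit L i) as (Hu & Hv & _).
  destruct Hi as (s & t & Hs & Ht & E).
  assert (A : (Cmod x <= Cmod (org (tile L i)) + 1 + 1)%R).
  { rewrite E. eapply Rle_trans; [apply Cmod_triangle|].
    apply Rplus_le_compat; [eapply Rle_trans; [apply Cmod_triangle|]; apply Rplus_le_compat_l|];
      rewrite Cmod_mult, Cmod_R, Rabs_pos_eq by lra; [rewrite Hu|rewrite Hv]; lra. }
  unfold x in A. rewrite Cmod_R, Rabs_pos_eq in A; generalize (pos_INR N); lra.
Qed.

Lemma half_path_bound l : (forall e, In e l -> Cmod e = 1%R) ->
  forall a, In a (RtoC 0 :: map half l) -> (Cmod a <= 1)%R.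
Proof.
  intros Hl a [<-|Ha].
  - rewrite Cmod_0; lra.
  - apply in_map_iff in Ha. destruct Ha as (e & <- & He). apply Cmod_half; auto.
Qed.

(** A shortest path to a far vertex has more than [N] steps. Vanishing along it gives as many roots,
    which are exchanged for Blaschke factors; as [N] is arbitrary, [blaschke_divisible_zero]
    applies. *)
Lemma represents_zero c : sq mu c -> represents c (fun _ => 0) -> forall n, c n = 0.
Proof.
  intros Hc Hf. apply (blaschke_divisible_zero mu mu_gt_1); auto.
  intros N. destruct (far_vertex N) as (v & Hv & Hfar).
  destruct (shortest_walk_exists L 0 v V0 Hv) as (l & W & Hmin).
  assert (Hl := walk_directions L _ _ _ W).
  destruct (interpolation_roots mu r Hr l c) as (h & Hh & E); auto.
  - eapply shortest_walk_no_backtrack; eauto.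
  - intros l1 l2 ->. destruct (walk_split L _ _ _ _ W) as (w & W1 & _).
    rewrite <- (zeta_walk _ _ W1). symmetry. apply Hf. eapply walk_vertex; eauto.
  - destruct (roots_blaschke_coefs mu mu_gt_1 (RtoC 0 :: map half l) h) as (g & Hg & E'); auto.
    { apply half_path_bound; auto. }
    exists (RtoC 0 :: map half l), g. repeat split; auto.
    + simpl. rewrite length_map. apply walk_length_bound in W.
      replace (v - 0) with v in W by ring.
      assert (INR N < INR (length l))%R by lra. apply INR_lt in H. lia.
    + apply half_path_bound; auto.
    + rewrite E; auto.
Qed.

Lemma represents_unique c c' f : sq mu c -> sq mu c' -> represents c f ->
  represents c' f -> c = c'.
Proof.
  intros Hc Hc' Hf Hf'. extensionality n.
  assert (A : lin 1 c (- (1)) c' n = 0).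
  { apply represents_zero.
    - apply sq_lin; auto.
    - intros v Hv. rewrite (pairing_lin_r r); auto using grow_zeta; try (apply (sq_adm mu); auto).
      rewrite <- Hf, <- Hf' by auto. ring. }
  unfold lin in A. replace (c n) with (1 * c n + - (1) * c' n + c' n) by ring.
  rewrite A. ring.
Qed.

Lemma coef_unique c f : sq mu c -> represents c f -> coef L mu f = c.
Proof.
  intros Hc Hf.
  assert (K : is_coef L mu f (coef L mu f)).
  { unfold coef. apply epsilon_spec. exists c. apply is_coef_iff; auto. }
  apply is_coef_iff in K. destruct K. eapply represents_unique; eauto.
Qed.

Lemma H2norm_energy c f : sq mu c -> represents c f -> H2norm L mu f = sqrt (energy mu c).
Proof. intros Hc Hf. unfold H2norm. rewrite (coef_unique c f); auto. Qed.

Lemma pairing_unit_r z : grow r z -> pairing z unit_seq = z 0%nat.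
Proof.
  intros Hz. unfold pairing.
  rewrite Cseries_incr by (apply (pairing_summable r); auto using adm_unit).
  rewrite (Cseries_ext (fun n => z (S n) * unit_seq (S n)) (fun n => 0 * (z n * unit_seq n)))
    by (intros; simpl; ring).
  rewrite Cseries_scal by (apply (pairing_summable r); auto using adm_unit).
  simpl. ring.
Qed.

Lemma pairing_scale z k c : grow r z -> adm r c -> pairing z (scale k c) = k * pairing z c.
Proof.
  intros Hz Hc. transitivity (pairing z (lin k c 0 c)).
  - f_equal. extensionality n. unfold scale, lin. ring.
  - rewrite (pairing_lin_r r) by auto. ring.
Qed.

(** The pairing is the generating function [G_v] at [t = c], so this is the edge relation at that
    point. It is deduced from [c t g = g - 1] for the geometric series [g]. *)
Lemma geometric_edge c u v : (r * Cmod c < 1)%R -> edge L u v ->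
  (1 - c * half (v - u)) * pairing (zeta v) (fun n => c ^ n)
  = (1 + c * (1 + half (v - u))) * pairing (zeta u) (fun n => c ^ n).
Proof.
  intros Hc H. set (g := fun n => c ^ n).
  assert (Hg : adm r g) by (apply adm_geom; auto).
  destruct (edge_vertices L _ _ H) as [Hu Hv].
  assert (D : forall w, vertex L w -> c * pairing (zeta w) (delay g) = pairing (zeta w) g - 1).
  { intros w Hw.
    transitivity (pairing (zeta w) (lin 1 g (- (1)) unit_seq)).
    - rewrite <- pairing_scale by auto using grow_zeta, adm_delay.
      f_equal. extensionality n. unfold scale, lin, delay, g.
      destruct n as [|n]; simpl; ring.
    - rewrite (pairing_lin_r r), pairing_unit_r, zeta_0 by auto using grow_zeta, adm_unit. ring. }
  assert (A := represents_primitive g (fun w => pairing (zeta w) g) Hg (fun _ _ => eq_refl) u v H).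
  cbv beta in A. set (a := half (v - u)) in *.
  assert (B : c * pairing (zeta v) (delay g) - c * pairing (zeta u) (delay g)
    = c * ((1 + a) * pairing (zeta u) g + a * pairing (zeta v) g)) by (rewrite <- A; ring).
  rewrite !D in B by auto.
  transitivity ((pairing (zeta v) g - 1 - (pairing (zeta u) g - 1))
    + pairing (zeta u) g - c * a * pairing (zeta v) g); [ring|].
  rewrite B. ring.
Qed.

Lemma represents_geom c : (r * Cmod c < 1)%R -> represents (fun n => c ^ n) (geom L c).
Proof.
  intros Hc v Hv. unfold geom.
  assert (P := some_path_correct L 0 v V0 Hv).
  set (N := fst (some_path L 0 v)) in *. set (u := snd (some_path L 0 v)) in *.
  destruct P as (_ & P0 & PN & Pe). rewrite <- PN.
  assert (K : forall k, (k <= N)%nat ->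
    fold_right Cmult 1 (map (fun k => (2 + c * (1 + u k - u (k - 1)%nat))
                   / (2 + c * (1 + u (k - 1)%nat - u k))) (seq 1 k))
    = pairing (zeta (u k)) (fun n => c ^ n)).
  { induction k as [|k IH]; intros Hk.
    - rewrite P0, zeta_origin, (pairing_unit r) by auto using adm_geom. reflexivity.
    - rewrite seq_S, map_app.
      assert (F : forall l x, fold_right Cmult 1 (l ++ [x]) = fold_right Cmult 1 l * x).
      { intros l x. induction l as [|y l IHl]; simpl; [|rewrite IHl]; ring. }
      simpl map. rewrite F, IH, ?Nat.sub_0_r by lia.
      replace (1 + k)%nat with (S k) by lia. replace (S k - 1)%nat with k by lia.
      assert (He := Pe k ltac:(lia)).
      assert (G := geometric_edge c _ _ Hc He).
      assert (Hlen := edge_length L _ _ He).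
      assert (Ha := Cmod_half _ Hlen).
      set (e := u (S k) - u k) in *.
      replace (1 + u (S k) - u k) with (1 + e) by (unfold e; ring).
      replace (1 + u k - u (S k)) with (1 - e) by (unfold e; ring).
      (* [half e] lies in the closed unit disc, and [r * Cmod c < 1] with [r > 1] forces
         [Cmod c < 1]. *)
      assert (Nz : 1 - c * half e <> 0).
      { intros Z. assert (E : c * half e = 1).
        { replace (c * half e) with (1 - (1 - c * half e)) by ring. rewrite Z; ring. }
        apply (f_equal Cmod) in E. rewrite Cmod_mult, Cmod_1 in E.
        generalize (Cmod_ge_0 c), (Cmod_ge_0 (half e)), r_gt_1. nra. }
      assert (N2 : 2 + c * (1 - e) <> 0).
      { intros Z. apply Nz. unfold half.
        replace (1 - c * ((e - 1) / 2)) with ((2 + c * (1 - e)) / 2) by field.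
        rewrite Z. field. }
      transitivity ((1 + c * (1 + half e)) * pairing (zeta (u k)) (fun n => c ^ n) / (1 - c * half e)).
      + unfold half. field. intros Z; apply N2; rewrite <- Z; ring.
      + rewrite <- G. field. auto. }
  apply K; auto.
Qed.

Lemma represents_blaschke a : (Cmod a <= 1)%R ->
  let s := RtoC (sqrt (1 - Cmod a ^ 2 / mu ^ 2)) in
  represents (lin (- a / mu) unit_seq (s * (s / mu)) (delay (fun n => (Cconj a / mu / mu) ^ n)))
    (blaschke L mu a).
Proof.
  intros Ha s v Hv. assert (Hc := blaschke_factor_bound mu mu_gt_1 a Ha).
  assert (Hrc : (r * Cmod (Cconj a / mu / mu) < 1)%R).
  { generalize (Cmod_ge_0 (Cconj a / mu / mu)). nra. }
  unfold blaschke. fold s.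
  rewrite (represents_Zplus (fun n => (Cconj a / mu / mu) ^ n) _); auto using represents_geom, adm_geom.
  rewrite (pairing_lin_r r), pairing_unit_r, zeta_0
    by auto using grow_zeta, adm_unit, adm_delay, adm_geom.
  ring.
Qed.

(** The defining series is [pairing phi c], where [phi n] is the value at [v] of the [n]-th shift of
    the Blaschke factor. Writing [c = (1 - k t) q] with [k = conj a / mu^2] and transposing the
    factor to [phi] leads to pairings with [(1 - k t) beta], where [beta] is the series of the
    Blaschke factor. The entries of the defining matrix make this product equal to
    [(t - a) / mu]. *)
Lemma represents_blaschke_mul a c h : (Cmod a <= 1)%R -> sq mu c -> represents c h ->
  represents (blaschke_coef mu a c) (blaschke_mul L mu a h).
Proof.
  intros Ha Hc Hh v Hv. unfold blaschke_mul. rewrite (coef_unique c h) by auto.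
  assert (Hrep := represents_blaschke a Ha). cbv zeta in Hrep.
  assert (Hd := blaschke_factor_bound mu mu_gt_1 a Ha).
  assert (Hn : RtoC mu <> 0) by (intros E; apply RtoC_inj in E; generalize mu_gt_1; lra).
  set (s := sqrt (1 - Cmod a ^ 2 / mu ^ 2)) in *.
  assert (Hs : RtoC s * RtoC s = 1 - a * Cconj a / (mu * mu)).
  { rewrite <- RtoC_mult. unfold s. rewrite sqrt_sqrt.
    - rewrite RtoC_minus, RtoC_div by (apply pow_nonzero; lra).
      rewrite Cmod2_conj, RtoC_pow. simpl. field. auto.
    - assert (Cmod a ^ 2 / mu ^ 2 <= 1)%R; [|lra].
      generalize mu_gt_1; intros. apply Rmult_le_reg_r with (mu ^ 2)%R; [nra|].
      unfold Rdiv. rewrite Rmult_assoc, Rinv_l by nra. generalize (Cmod_ge_0 a). nra. }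
  set (k := Cconj a / mu / mu) in *.
  set (beta := lin (- a / mu) unit_seq (s * (s / mu)) (delay (fun n => k ^ n))) in *.
  assert (Hrk : (r * Cmod k < 1)%R) by (generalize (Cmod_ge_0 k); nra).
  assert (Hb : adm r beta) by (apply adm_lin; auto using adm_unit, adm_delay, adm_geom).
  assert (Hit : forall n, adm r (Nat.iter n delay beta) /\
     represents (Nat.iter n delay beta) (Nat.iter n (Zplus L) (blaschke L mu a))).
  { induction n as [|n [I1 I2]]; simpl; auto. split; auto using adm_delay.
    apply represents_Zplus; auto. }
  set (drop := fun n k => zeta v (n + k)%nat).
  assert (Hdrop : forall n, grow r (drop n)).
  { intros n. unfold drop. destruct (grow_zeta v Hv) as [K HK].
    exists (K * r ^ n)%R. intros j. rewrite Rmult_assoc, <- pow_add. apply HK. }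
  assert (Hadv : forall n, advance (drop n) = drop (S n)).
  { intros n. extensionality j. unfold advance, drop. f_equal. lia. }
  (* Delaying [beta] by [n] amounts to dropping the first [n] entries of [zeta v]. *)
  set (phi := fun n => pairing (drop n) beta).
  assert (Hphi : forall n j, pairing (drop j) (Nat.iter n delay beta) = phi (n + j)%nat).
  { induction n as [|n IH]; intros j; auto. simpl Nat.iter.
    rewrite (pairing_delay r), Hadv, IH; auto; [f_equal; lia|apply Hit]. }
  assert (Gphi : grow r phi) by (apply pairing_bound; auto using grow_zeta).
  rewrite (Cseries_ext _ (fun n => phi n * c n)).
  2:{ intros n. rewrite (proj2 (Hit n) v Hv). change (zeta v) with (drop 0%nat).
      rewrite Hphi, Nat.add_0_r. ring. }
  change (pairing phi c = pairing (zeta v) (blaschke_coef mu a c)).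
  unfold blaschke_coef. fold k. set (q := div_factor k c).
  assert (Hq : adm r q) by (apply (sq_adm mu); auto; apply sq_div_factor; auto).
  rewrite pairing_scale by auto using grow_zeta, adm_mul_root.
  rewrite (pairing_mul_root r) by auto using grow_zeta.
  rewrite <- (mul_factor_div_factor k c). fold q. unfold mul_factor.
  rewrite (pairing_lin_r r), (pairing_delay r), <- (pairing_lin_l r)
    by auto using grow_advance, adm_delay.
  transitivity (pairing (lin (/ mu) (lin 1 (advance (zeta v)) (- a) (zeta v)) 0 (zeta v)) q).
  2:{ rewrite (pairing_lin_l r); auto using grow_lin, grow_advance, grow_zeta. ring. }
  f_equal. extensionality n.
  (* The coefficient of [t] is [a k / mu + s^2 / mu], which is [1 / mu] by [Hs]; the higher ones
     cancel. *)
  assert (Eb : lin 1 beta (- k) (delay beta) = lin (- a / mu) unit_seq (/ mu) (delay unit_seq)).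
  { extensionality j. unfold beta, lin.
    assert (Es : RtoC s * (RtoC s / mu) = (1 - a * Cconj a / (mu * mu)) / mu).
    { rewrite <- Hs. unfold Cdiv. ring. }
    rewrite Es. unfold k. destruct j as [|[|j]]; simpl; field; auto. }
  transitivity (pairing (drop n) (lin 1 beta (- k) (delay beta))).
  - rewrite (pairing_lin_r r), (pairing_delay r), Hadv by auto using adm_delay. reflexivity.
  - rewrite Eb, (pairing_lin_r r), (pairing_delay r), !pairing_unit_r
      by auto using grow_advance, adm_delay, adm_unit.
    unfold lin, advance, drop. rewrite Nat.add_0_r, <- plus_n_Sm, Nat.add_0_r.
    unfold Cdiv. ring.
Qed.

Lemma represents_shift_mul c h : sq mu c -> represents c h ->
  represents (blaschke_coef mu 0 c) (shift_mul L mu h).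
Proof.
  intros Hc Hh v Hv. unfold shift_mul, blaschke_coef.
  assert (Had : adm r c) by (apply (sq_adm mu); auto).
  rewrite (represents_Zplus c h Had Hh v Hv).
  replace (Cconj 0 / mu / mu) with (RtoC 0).
  - rewrite div_factor_0, mul_root_0, pairing_scale by auto using grow_zeta, adm_delay.
    unfold Cdiv. ring.
  - replace (Cconj 0) with (RtoC 0) by (unfold Cconj, RtoC; simpl; f_equal; ring).
    unfold Cdiv. ring.
Qed.

Lemma represents_product l c g : (forall a, In a l -> (Cmod a <= 1)%R) -> sq mu c ->
  represents c g ->
  represents (blaschke_coefs mu (RtoC 0 :: l) c)
    (shift_mul L mu (fold_right (blaschke_mul L mu) g l)).
Proof.
  intros Hl Hc Hg.
  assert (K : represents (blaschke_coefs mu l c) (fold_right (blaschke_mul L mu) g l)).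
  { induction l as [|a l IH]; auto. simpl.
    apply represents_blaschke_mul; [apply Hl; simpl; auto| |apply IH; intros; apply Hl; simpl; auto].
    apply blaschke_coefs_sq; auto. intros; apply Hl; simpl; auto. }
  apply represents_shift_mul; auto. apply blaschke_coefs_sq; auto.
Qed.

End Hardy.

Theorem theorem5p6 (L : rhombic_lattice) (HL : standing_assumptions L)
  (mu : R) (Hmu : (1 < mu)%R) (lam : C) (Hlam : vertex L lam)
  (N : nat) (z : nat -> C) (Hz : shortest_path L N z 0 lam) :
  let a (n : nat) : C := (z n - z (n - 1)%nat - 1) / 2 in
  let has_form (f g : C -> C) : Prop :=
    forall w : C, vertex L w ->
      f w = shift_mul L mu
              (fold_right (blaschke_mul L mu) g (map a (seq 1 N))) w in
  (forall f : C -> C,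
     (H2 L mu f /\ forall n : nat, (n <= N)%nat -> f (z n) = 0) <->
     (exists g : C -> C, H2 L mu g /\ has_form f g)) /\
  (forall f g : C -> C,
     H2 L mu g -> has_form f g -> H2norm L mu f = H2norm L mu g).
Proof.
  intros a has_form.
  assert (V0 := vertex_0 L HL).
  (* Any radius strictly between 1 and [mu] would do. *)
  set (r := ((1 + mu) / 2)%R). assert (Hr : (1 < r < mu)%R) by (unfold r; lra).
  destruct Hz as [Hp Hshort].
  set (l := path_steps z N).
  assert (W : walk L 0 l lam).
  { assert (A := path_walk L N z 0 lam N Hp (le_n N)).
    destruct Hp as (_ & _ & E & _). rewrite E in A; exact A. }
  assert (Hl := walk_directions L _ _ _ W).
  assert (Ea : map a (seq 1 N) = map half l).
  { unfold l, path_steps. rewrite <- seq_shift, !map_map. apply map_ext.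
    intros n. unfold a, half. replace (S n - 1)%nat with n by lia. reflexivity. }
  assert (Hn : no_backtrack l).
  { apply (shortest_walk_no_backtrack L 0 l lam W). intros l' W'.
    destruct (walk_path L _ _ _ W' V0) as [w Hw]. unfold l, path_steps.
    rewrite length_map, length_seq. eapply Hshort; eauto. }
  assert (Hb : forall b, In b (map half l) -> (Cmod b <= 1)%R).
  { intros b Hb. apply (half_path_bound l Hl). simpl; auto. }
  assert (Hform : forall f g c, sq mu c -> represents L c g -> has_form f g ->
     represents L (blaschke_coefs mu (RtoC 0 :: map half l) c) f).
  { intros f g c Hc Hg Hf v Hv. unfold has_form in Hf. rewrite Ea in Hf.
    rewrite (Hf v Hv). apply (represents_product L V0 mu r Hr); auto. }
  assert (Hb0 := half_path_bound l Hl).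
  split; [intros f; split|].
  - intros [Hf Hzero]. apply (H2_iff L V0 mu r Hr) in Hf. destruct Hf as (c & Hc & Hf).
    destruct (interpolation_roots mu r Hr l c) as (h & Hh & E); auto.
    { intros l1 l2 El.
      assert (Hk : (length l1 <= N)%nat).
      { apply (f_equal (@length C)) in El. rewrite length_app in El.
        unfold l, path_steps in El. rewrite length_map, length_seq in El. lia. }
      assert (E1 : path_steps z (length l1) = l1).
      { rewrite <- (path_steps_firstn z N) by auto. fold l.
        rewrite El, firstn_app, firstn_all, Nat.sub_diag, firstn_O. apply app_nil_r. }
      assert (W1 := path_walk L N z 0 lam _ Hp Hk). rewrite E1 in W1.
      rewrite <- (zeta_walk L _ _ W1), <- Hf; auto.
      eapply path_vertex; eauto. }
    destruct (roots_blaschke_coefs mu Hmu _ h Hb0 Hh) as (d & Hd & E').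
    (* Only the values at the vertices count, so the pairing with [d] itself serves as [g]. *)
    assert (Hg : represents L d (fun v => pairing (zeta L v) d)) by (intros v Hv; auto).
    exists (fun v => pairing (zeta L v) d). split.
    + apply (H2_iff L V0 mu r Hr). exists d; auto.
    + intros v Hv. rewrite Ea, (Hf v Hv), E, E'.
      symmetry. apply (represents_product L V0 mu r Hr); auto.
  - intros (g & Hg & Hf). apply (H2_iff L V0 mu r Hr) in Hg. destruct Hg as (d & Hd & Hg).
    assert (Hrep := Hform f g d Hd Hg Hf).
    split.
    + apply (H2_iff L V0 mu r Hr). eexists; split; [|exact Hrep].
      apply blaschke_coefs_sq; auto.
    + intros n Hk. rewrite (Hrep (z n)) by (eapply path_vertex; eauto).
      destruct (blaschke_coefs_roots mu Hmu _ d Hb0 Hd) as (h & Hh & E). rewrite E.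
      assert (W1 := path_walk L N z 0 lam n Hp Hk).
      rewrite (zeta_walk L _ _ W1).
      apply (roots_interpolation mu r Hr l h Hl Hh _ (skipn n l)).
      rewrite <- (path_steps_firstn z N) by auto. fold l. symmetry; apply firstn_skipn.
  - intros f g Hg Hf. apply (H2_iff L V0 mu r Hr) in Hg. destruct Hg as (d & Hd & Hg).
    assert (Hrep := Hform f g d Hd Hg Hf).
    destruct (blaschke_coefs_sq mu Hmu _ d Hb0 Hd) as [S1 S2].
    rewrite (H2norm_energy L V0 mu r Hr d g), (H2norm_energy L V0 mu r Hr _ f S1 Hrep), S2; auto.
Qed.
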